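(* Let $1<p,q<\infty$, $n\ge1$ and $0\le k\le n$. There exists a constant $C<\infty$ such that $$\|\theta\|_{L^q(\mathbb{R}^n)}\le C\left(\|d\theta\|_{L^p(\mathbb{R}^n)}+\|\delta\theta\|_{L^p(\mathbb{R}^n)}\right)$$ for any $\theta\in L^p(\mathbb{R}^n,\Lambda^k)$, if and only if $\frac1p-\frac1q=\frac1n$.
   Context: $\Lambda^k=\Lambda^k(\mathbb{R}^{n*})$ is the space of alternating $k$-forms on $\mathbb{R}^n$; $L^p(\mathbb{R}^n,\Lambda^k)$ is the space of degree $k$ differential forms with coefficients in $L^p(\mathbb{R}^n)$. Derivatives are taken in the sense of distributions: $d=\sum_{\mu}dx_\mu\wedge\partial_\mu$ and $\delta=-\sum_\mu \iota_\mu\partial_\mu$ with $\iota_\mu$ the interior product with $\partial/\partial x_\mu$. The $L^s$ norm of a current that is not in $L^s$ is understood to be $+\infty$. *)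

(* Defs.v *)
From HB Require Import structures.
From mathcomp Require Import all_boot all_order all_algebra.
From mathcomp Require Import all_classical all_reals all_analysis.

Set Implicit Arguments.
Unset Strict Implicit.
Unset Printing Implicit Defensive.

Import Order.TTheory GRing.Theory Num.Theory.
Import numFieldNormedType.Exports.

Local Open Scope classical_set_scope.
Local Open Scope ring_scope.

(* R^n is 'rV[R]_n, with its library topology and, as for n.-tuple R in the
   library, the sigma-algebra generated by the coordinates (the Borel sets). *)
Definition rV_display : measure_display. Proof. exact: default_measure_display. Qed.

Section rV_measurable.
Variables (R : realType) (n : nat).

Definition coord_rV (i : 'I_n) (x : 'rV[R]_n) : measurableTypeR R := x 0 i.

Let rV_set0 : g_sigma_preimage coord_rV set0.
Proof. exact: sigma_algebra0. Qed.

Let rV_setC A : g_sigma_preimage coord_rV A -> g_sigma_preimage coord_rV (~` A).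
Proof. exact: sigma_algebraC. Qed.

Let rV_bigcup (F : (set 'rV[R]_n)^nat) :
  (forall i, g_sigma_preimage coord_rV (F i)) ->
  g_sigma_preimage coord_rV (\bigcup_i (F i)).
Proof. exact: sigma_algebra_bigcup. Qed.

HB.instance Definition _ := @isMeasurable.Build rV_display
  'rV[R]_n (g_sigma_preimage coord_rV) rV_set0 rV_setC rV_bigcup.

Lemma measurable_coord_rV (i : 'I_n) : measurable_fun [set: 'rV[R]_n] (coord_rV i).
Proof.
move=> _ Y mY; rewrite setTI; apply: sub_sigma_algebra => /=.
rewrite -bigcup_seq/=; exists i => /=; first by rewrite mem_index_enum.
by exists Y => //; rewrite setTI.
Qed.

Lemma measurable_fun_rV d (T : measurableType d) (f : T -> 'rV[R]_n) :
  (forall i, measurable_fun [set: T] (coord_rV i \o f)) ->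
  measurable_fun [set: T] f.
Proof.
move=> mf _ A mA; rewrite setTI.
have : preimage_set_system [set: T] f (g_sigma_preimage coord_rV) (f @^-1` A).
  by exists A => //; rewrite setTI.
rewrite -g_sigma_preimage_comp; move: (f @^-1` A) => {mA}.
apply: smallest_sub; first exact: sigma_algebra_measurable.
rewrite -bigcup_seq; apply: bigcup_sub => i _ B [C mC <-].
exact: mf.
Qed.

End rV_measurable.

Section lebesgue_rV.
Variable R : realType.

Definition cons_rV n (p : measurableTypeR R * 'rV[R]_n) : 'rV[R]_n.+1 :=
  row_mx (p.1%:M : 'M[R]_1) p.2.

Definition uncons_rV n (x : 'rV[R]_n.+1) : measurableTypeR R * 'rV[R]_n :=
  (x 0 0, rsubmx (x : 'rV_(1 + n))).

Lemma cons_rVK n : cancel (@cons_rV n) (@uncons_rV n).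
Proof.
move=> [a v]; rewrite /uncons_rV /cons_rV row_mxKr mxE; congr pair.
by case: splitP => //= j _; rewrite ord1 mxE.
Qed.

Lemma measurable_cons_rV n : measurable_fun [set: _] (@cons_rV n).
Proof.
apply: measurable_fun_rV => i.
case: (@split_ordP 1 n i) => j ->.
- have -> : coord_rV (lshift n j) \o @cons_rV n = fst.
    by apply/funext => p /=; rewrite /coord_rV /cons_rV row_mxEl ord1 mxE eqxx.
  exact: measurable_fst.
- have -> : coord_rV (rshift 1 j) \o @cons_rV n = coord_rV j \o snd.
    by apply/funext => p /=; rewrite /coord_rV /cons_rV row_mxEr.
  apply: measurableT_comp; last exact: measurable_snd.
  exact: measurable_coord_rV.
Qed.

Lemma measurable_uncons_rV n : measurable_fun [set: _] (@uncons_rV n).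
Proof.
apply/measurable_fun_pairP; split; first exact: (measurable_coord_rV (0 : 'I_n.+1)).
apply: measurable_fun_rV => i.
have -> : coord_rV i \o (snd \o @uncons_rV n) = coord_rV (rshift 1 i).
  by apply/funext => x; rewrite /= /coord_rV /uncons_rV mxE.
exact: measurable_coord_rV.
Qed.

Section step.
Variables (n : nat) (mu : {sigma_finite_measure set 'rV[R]_n -> \bar R}).

Definition lebesgue_step : set 'rV[R]_n.+1 -> \bar R :=
  pushforward (@lebesgue_measure R \x mu)%E (@cons_rV n).

Let measurable_preimage_cons A :
  measurable A -> measurable (@cons_rV n @^-1` A).
Proof. by move=> mA; rewrite -[X in measurable X]setTI; exact: measurable_cons_rV. Qed.

Let lebesgue_step0 : lebesgue_step set0 = 0%E.
Proof. by rewrite /lebesgue_step /pushforward preimage_set0 measure0. Qed.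

Let lebesgue_step_ge0 A : (0 <= lebesgue_step A)%E.
Proof. by rewrite /lebesgue_step /pushforward; exact: measure_ge0. Qed.

Let lebesgue_step_sigma_additive : semi_sigma_additive lebesgue_step.
Proof.
move=> F mF tF mUF; rewrite /lebesgue_step /pushforward preimage_bigcup.
apply: measure_semi_sigma_additive.
- by move=> i; exact: measurable_preimage_cons.
- apply/trivIsetP => /= i j _ _ ij; rewrite -preimage_setI.
  by move/trivIsetP : tF => /(_ _ _ _ _ ij) ->//; rewrite preimage_set0.
- by rewrite -preimage_bigcup; exact: measurable_preimage_cons.
Qed.

HB.instance Definition _ := isMeasure.Build _ _ _ lebesgue_step
  lebesgue_step0 lebesgue_step_ge0 lebesgue_step_sigma_additive.

Let lebesgue_step_sigma_finite : sigma_finite setT lebesgue_step.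
Proof.
have /sigma_finiteP[F [TF ndF Foo]] := sigma_finiteT (@lebesgue_measure R).
have /sigma_finiteP[G [TG ndG Goo]] := sigma_finiteT mu.
exists (fun i => @uncons_rV n @^-1` (F i `*` G i)).
  rewrite -preimage_bigcup (_ : \bigcup_i (F i `*` G i) = setT) ?preimage_setT//.
  rewrite -setXTT TF TG predeqE => -[x y]; split.
    by move=> [i _ []/= ? ?]; split; exists i.
  move=> [/= [i _ Fix] [j _ Gjy]]; exists (maxn i j) => //; split.
  - by move: x Fix; exact/subsetPset/ndF/leq_maxl.
  - by move: y Gjy; exact/subsetPset/ndG/leq_maxr.
move=> i; have [mF Fi] := Foo i; have [mG Gi] := Goo i; split.
  rewrite -[X in measurable X]setTI; apply: measurable_uncons_rV => //.
  exact: measurableX.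
rewrite /lebesgue_step /pushforward -comp_preimage.
have -> : @uncons_rV n \o @cons_rV n = id by apply/funext => x; exact: cons_rVK.
by rewrite preimage_id product_measure1E// lte_mul_pinfty// ge0_fin_numE.
Qed.

HB.instance Definition _ := Measure_isSigmaFinite.Build _ _ _ lebesgue_step
  lebesgue_step_sigma_finite.

End step.

(* Lebesgue measure on R^n, by iterated products; on R^0 it is the Dirac mass. *)
Fixpoint lebesgue_rV n : {sigma_finite_measure set 'rV[R]_n -> \bar R} :=
  match n with
  | 0%N => @dirac _ 'rV[R]_0 0 R
  | m.+1 => lebesgue_step (lebesgue_rV m)
  end.

End lebesgue_rV.

Section test_functions.
Variables (R : realType) (n : nat).

Definition partial (i : 'I_n) (f : 'rV[R]_n -> R) : 'rV[R]_n -> R :=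
  fun x => 'D_(delta_mx 0 i) f x.

Fixpoint Ck (m : nat) (f : 'rV[R]_n -> R) : Prop :=
  match m with
  | 0%N => continuous f
  | m'.+1 => continuous f /\
      forall i, (forall x, derivable f x (delta_mx 0 i)) /\ Ck m' (partial i f)
  end.

Definition test_function (phi : 'rV[R]_n -> R) : Prop :=
  (forall m, Ck m phi) /\ compact (closure [set x | phi x != 0]).

End test_functions.

Section alternating_forms.
Variables (R : realType) (n : nat).

(* A k-form is a function of k vectors of R^n, given as the rows of a matrix. *)
Definition multilinear_form k (w : 'M[R]_(k, n) -> R) : Prop :=
  forall (A B C : 'M[R]_(k, n)) (i : 'I_k) (b c : R),
    row i A = b *: row i B + c *: row i C ->
    row' i B = row' i A -> row' i C = row' i A ->
    w A = b * w B + c * w C.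

Definition alternating_form k (w : 'M[R]_(k, n) -> R) : Prop :=
  multilinear_form w /\
  forall (A : 'M[R]_(k, n)) (i j : 'I_k), i != j -> row i A = row j A -> w A = 0.

(* (dx_mu /\ w)(v_0,...,v_k) = \sum_j (-1)^j v_j^mu w(v_0,..,v_j omitted,..,v_k) *)
Definition dx_wedge (mu : 'I_n) k (w : 'M[R]_(k, n) -> R) : 'M[R]_(k.+1, n) -> R :=
  fun A => \sum_(j < k.+1) (-1) ^+ j * A j mu * w (row' j A).

(* The interior product of a 0-form is zero; for lack of forms of degree -1,
   this zero is put in degree 0.-1 = 0. *)
Definition iota_dx (mu : 'I_n) k : ('M[R]_(k, n) -> R) -> 'M[R]_(k.-1, n) -> R :=
  match k with
  | 0%N => fun _ _ => 0
  | k'.+1 => fun w A => w (col_mx (delta_mx 0 mu : 'rV[R]_n) A)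
  end.

Definition multi_index k (f : {ffun 'I_k -> 'I_n}) : bool :=
  [forall i : 'I_k, forall j : 'I_k, (i < j)%N ==> (f i < f j)%N].

(* Row i of [rowsub f 1%:M] is e_(f i), so this is w(e_(f 0), ..., e_(f (k-1))),
   the coefficient of w on dx_(f 0) /\ ... /\ dx_(f (k-1)). *)
Definition form_coef k (w : 'M[R]_(k, n) -> R) (f : {ffun 'I_k -> 'I_n}) : R :=
  w (rowsub f 1%:M).

Definition form_norm k (w : 'M[R]_(k, n) -> R) : R :=
  Num.sqrt (\sum_(f : {ffun 'I_k -> 'I_n} | multi_index f) form_coef w f ^+ 2).

End alternating_forms.

Section currents.
Variables (R : realType) (n : nat).
Local Notation mu := (lebesgue_rV R n).

Definition Lp_form (s : R) k (theta : 'rV[R]_n -> 'M[R]_(k, n) -> R) : Prop :=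
  (forall x, alternating_form (theta x)) /\
  forall f : {ffun 'I_k -> 'I_n}, multi_index f ->
    (fun x => form_coef (theta x) f) \in Lfun mu s%:E.

Definition form_Lnorm (s : R) k (theta : 'rV[R]_n -> 'M[R]_(k, n) -> R) : \bar R :=
  Lnorm mu s%:E (fun x => (form_norm (theta x))%:E).

(* A current is a distribution with values in the k-forms, acting on scalar
   test functions coefficient by coefficient. *)
Definition current k := ('rV[R]_n -> R) -> 'M[R]_(k, n) -> R.

Definition current_of k (theta : 'rV[R]_n -> 'M[R]_(k, n) -> R) : current k :=
  fun phi A => \int[mu]_x (theta x A * phi x).

Definition current_partial k (i : 'I_n) (T : current k) : current k :=
  fun phi A => - T (partial i phi) A.

Definition current_d k (T : current k) : current k.+1 :=
  fun phi A => \sum_(i < n) dx_wedge i (current_partial i T phi) A.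

Definition current_delta k (T : current k) : current k.-1 :=
  fun phi A => - \sum_(i < n) iota_dx i (current_partial i T phi) A.

(* The L^s norm of the form of L^s representing T, which is unique almost
   everywhere; if there is none, the infimum over the empty set is +oo. *)
Definition current_Lnorm (s : R) k (T : current k) : \bar R :=
  ereal_inf [set form_Lnorm s eta | eta in
    [set eta | Lp_form s eta /\
       forall phi, test_function phi -> T phi =1 current_of eta phi]].

End currents.

(* Main.v *)
Require Import Defs.
From mathcomp Require Import all_boot all_order all_algebra.
From mathcomp Require Import all_classical all_reals all_analysis.
From mathcomp Require Import perm measurable_realfun ring lra.

Set Implicit Arguments.
Unset Strict Implicit.
Unset Printing Implicit Defensive.

Import Order.TTheory GRing.Theory Num.Theory.
Import numFieldNormedType.Exports.

Local Open Scope classical_set_scope.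
Local Open Scope ring_scope.

(** Sufficiency. Fix a point [y] and let [V] be the gradient of the Newton
    potential centred at [y], so that [|V(x)|] is of order [|x - y| ^ (1 - n)].
    Since [iota_i (dx_j /\ w) + dx_j /\ iota_i w = delta_ij w] and
    [d_j V_i = d_i V_j], testing a coefficient of [theta] with the divergence of
    [V] amounts to testing coefficients of [d theta] and [delta theta] with the
    components of [V] ([current_hodge]); this is the formula
    [d delta + delta d = - Laplacian] in weak form. To have test functions, [V]
    is truncated smoothly between two radii [e] and [r] ([newton]); its
    divergence is then the difference of two mollifying kernels, of scales [e]
    and [r] ([partial_newton_div]). As [r] grows, the mollification at the scale
    [r] of a function of [L^p] tends to zero. What remains says that the
    mollification at the scale [e] of a coefficient of [theta] is bounded by a
    Riesz potential of order one of [|d theta| + k |delta theta|], uniformly in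
    [e] ([mollify_le_riesz]). Letting [e] tend to zero, the coefficient itself is
    bounded almost everywhere ([le_riesz]), and the Hardy-Littlewood-Sobolev
    inequality ([riesz_strong]) gives the estimate when [1/p - 1/q = 1/n].

    The passage to the limit in [e] uses weak convergence: by Fubini, the
    integral over a box of a mollification is an integral against the mollified
    indicator of the box, which converges almost everywhere; a pi-lambda argument
    then covers all measurable sets ([le_of_mollify]).

    The Hardy-Littlewood-Sobolev inequality is proved for a dyadic form of the
    potential. The weak type inequality for the maximal function on the line is
    interpolated ([maxfun1_strong]) and applied along each coordinate in turn,
    which bounds the maximal function over cubes in [L^p] ([maxfun_strong]).
    Splitting the potential at a suitable radius, as Hedberg does, bounds it
    pointwise by a power of this maximal function ([hedberg]).

    Necessity. Let [theta_a] be the constant form [dx_0 /\ ... /\ dx_(k-1)] times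
    a cut-off function dilated by [a]. Its [L^q] norm is at least of order
    [a ^ (n / q)]. The coefficients of [d theta_a] and [delta theta_a] are bounded
    by a multiple of [1 / a] and vanish outside a cube of side of order [a], so
    their [L^p] norms are at most of order [a ^ (n / p - 1)]. If the inequality
    holds, then [a ^ (n / q - n / p + 1)] is bounded for [0 < a], and the exponent
    is zero ([exponents_of_gaffney]). The distributional derivatives of [theta_a]
    are computed by integration by parts, which follows from the translation
    invariance of the measure ([integral_partial0]). *)

(** * Lebesgue measure in coordinates *)

Section rV_basics.
Variable R : realType.

Lemma uncons_rVK n : cancel (@uncons_rV R n) (@cons_rV R n).
Proof.
move=> x; rewrite /cons_rV /uncons_rV /= -[RHS](@hsubmxK _ 1 1 n x).
have -> // : (x 0 0)%:M = lsubmx (x : 'rV[R]_(1 + n)).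
apply/rowP => i; rewrite !mxE !ord1 eqxx mulr1n.
by congr fun_of_matrix; exact: val_inj.
Qed.

Lemma cons_rV0 n (a : R) (v : 'rV[R]_n) : cons_rV (a, v) 0 0 = a.
Proof. by have := @cons_rVK R n (a, v) => -[]. Qed.

Lemma cons_rVS n (a : R) (v : 'rV[R]_n) (i : 'I_n) :
  cons_rV (a, v) 0 (lift 0 i) = v 0 i.
Proof.
have : (uncons_rV (cons_rV (a, v))).2 = v by rewrite cons_rVK.
move=> /(congr1 (fun w : 'rV[R]_n => w 0 i)); rewrite mxE => <-.
by congr fun_of_matrix; exact: val_inj.
Qed.

Lemma integral_rVS n (f : 'rV[R]_n.+1 -> \bar R) :
  measurable_fun [set: 'rV[R]_n.+1] f -> (forall x, 0 <= f x)%E ->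
  (\int[lebesgue_rV R n.+1]_x f x =
   \int[lebesgue_measure]_a \int[lebesgue_rV R n]_v f (cons_rV (a, v)))%E.
Proof.
move=> mf f0.
transitivity (\int[pushforward (lebesgue_measure \x lebesgue_rV R n)%E (@cons_rV R n)]_x f x)%E.
  by [].
rewrite (@ge0_integral_pushforward _ _ _ _ _ _ (@measurable_cons_rV R n)) //.
rewrite preimage_setT fubini_tonelli1 //; last by move=> x; exact: f0.
by apply: measurableT_comp => //; exact: measurable_cons_rV.
Qed.

Lemma integral_rVS_sym n (f : 'rV[R]_n.+1 -> \bar R) :
  measurable_fun [set: 'rV[R]_n.+1] f -> (forall x, 0 <= f x)%E ->
  (\int[lebesgue_rV R n.+1]_x f x =
   \int[lebesgue_rV R n]_v \int[lebesgue_measure]_a f (cons_rV (a, v)))%E.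
Proof.
move=> mf f0; rewrite integral_rVS //.
apply: (@fubini_tonelli _ _ _ _ R lebesgue_measure (lebesgue_rV R n) (fun z => f (cons_rV z))) => //.
by apply: measurableT_comp => //; exact: measurable_cons_rV.
Qed.

Lemma ball_rVP n (x y : 'rV[R]_n) (r : R) :
  0 < r -> ball x r y <-> forall i, `|x 0 i - y 0 i| < r.
Proof.
move=> r0; split.
  by move=> [_ h] i; exact: h.
by move=> h; split => // i j; rewrite ord1; exact: h.
Qed.

Lemma ball_cons_rV n (a b : R) (v w : 'rV[R]_n) (r : R) : 0 < r ->
  ball (cons_rV (a, v)) r (cons_rV (b, w)) <-> ball a r b /\ ball v r w.
Proof.
move=> r0; split.
  move=> /(ball_rVP _ _ r0) h; split.
    by have := h 0; rewrite !cons_rV0.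
  by apply/(ball_rVP _ _ r0) => i; have := h (lift 0 i); rewrite !cons_rVS.
move=> [h1 /(ball_rVP _ _ r0) h2]; apply/(ball_rVP _ _ r0) => i.
by case: (unliftP 0 i) => [j ->|->]; rewrite ?cons_rV0 ?cons_rVS.
Qed.

Lemma measurable_ball_rV n (x : 'rV[R]_n) (r : R) : measurable (ball x r : set 'rV[R]_n).
Proof.
have [r0|r0] := ltP 0 r; last first.
  suff -> : ball x r = set0 by [].
  by apply/seteqP; split => // y [+ _]; rewrite ltNge r0.
have -> : ball x r = \bigcap_(i in [set: 'I_n]) ((@coord_rV R n i) @^-1` ball (x 0 i) r).
  apply/seteqP; split => y.
    by move/(ball_rVP _ _ r0) => h i _; exact: h.
  by move=> h; apply/(ball_rVP _ _ r0) => i; exact: h.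
apply: fin_bigcap_measurable => // i _.
rewrite -[X in measurable X]setTI.
by apply: measurable_coord_rV => //; exact: measurable_ball.
Qed.

Lemma measurable_ball_prod n (r : R) :
  measurable [set z : 'rV[R]_n * 'rV[R]_n | ball z.1 r z.2].
Proof.
have [r0|r0] := ltP 0 r; last first.
  suff -> : [set z : 'rV[R]_n * 'rV[R]_n | ball z.1 r z.2] = set0 by [].
  by apply/seteqP; split => // z [+ _]; rewrite ltNge r0.
have -> : [set z : 'rV[R]_n * 'rV[R]_n | ball z.1 r z.2] =
   \bigcap_(i in [set: 'I_n])
    ((fun z : 'rV[R]_n * 'rV[R]_n => `|coord_rV i z.1 - coord_rV i z.2|) @^-1` `]-oo, r[).
  apply/seteqP; split => y /=.
    by move/(ball_rVP _ _ r0) => h i _; rewrite /= in_itv /=; exact: h.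
  move=> h; apply/(ball_rVP _ _ r0) => i; have := h i I.
  by rewrite /= in_itv.
apply: fin_bigcap_measurable => // i _.
rewrite -[X in measurable X]setTI.
suff : measurable_fun setT (fun z : 'rV[R]_n * 'rV[R]_n => `|coord_rV i z.1 - coord_rV i z.2|).
  by apply.
apply: measurableT_comp => //.
apply: measurable_funB; apply: measurableT_comp => //; exact: measurable_coord_rV.
Qed.

Lemma measure_ball_rV n (x : 'rV[R]_n) (r : R) : 0 < r ->
  lebesgue_rV R n (ball x r) = ((r *+ 2) ^+ n)%:E.
Proof.
move=> r0; elim: n x => [|n IH] x.
  by rewrite /= diracE expr0 mem_set //; apply/(ball_rVP _ _ r0) => -[].
have m1 := @measurable_ball_rV n.+1 x r.
rewrite -[ball x r in LHS]setIT -integral_indic //.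
rewrite integral_rVS //; last first.
  by apply/measurable_EFinP/measurable_indic.
rewrite -(uncons_rVK x); case: (uncons_rV x) => a v.
transitivity (\int[lebesgue_measure]_b ((\1_(ball a r) b)%:E * ((r *+ 2) ^+ n)%:E))%E.
  apply: eq_integral => b _; rewrite -(IH v).
  rewrite -[X in (_ * lebesgue_rV R n X)%E]setIT -integral_indic //; last exact: measurable_ball_rV.
  rewrite -ge0_integralZl //; last first.
    by apply/measurable_EFinP/measurable_indic; exact: measurable_ball_rV.
  apply: eq_integral => w _; rewrite -EFinM; congr EFin.
  rewrite !indicE -natrM mulnb; congr ((nat_of_bool _)%:R).
  apply/idP/andP; rewrite !inE => /(ball_cons_rV _ _ _ _ r0) //.
rewrite ge0_integralZr //; last 2 first.
- by apply/measurable_EFinP/measurable_indic; exact: measurable_ball.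
- by rewrite lee_fin exprn_ge0 // mulrn_wge0 // ltW.
rewrite integral_indic //; last exact: measurable_ball.
have h : lebesgue_measure (ball a r) = (r *+ 2)%:E := lebesgue_measure_ball a (ltW r0).
by rewrite setIT [X in (X * _)%E]h -EFinM exprS.
Qed.

(** By uniqueness of Lebesgue measure, as intervals are dilated by [c]. *)
Lemma integral_affineR (f : R -> \bar R) (c b : R) : 0 < c ->
  measurable_fun [set: R] f -> (forall x, 0 <= f x)%E ->
  (\int[lebesgue_measure]_x f (c * x + b)%R =
   c^-1%:E * \int[lebesgue_measure]_x f x)%E.
Proof.
move=> c0 mf f0.
have mphi : measurable_fun [set: measurableTypeR R]
    (fun x : measurableTypeR R => c * x + b : measurableTypeR R).
  by apply: measurable_funD => //; apply: measurable_funM.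
have c0' : 0 <= c by exact: ltW.
have key A : measurable A -> lebesgue_measure A =
   mscale (NngNum c0') (pushforward (@lebesgue_measure R) (fun x : measurableTypeR R => c * x + b : measurableTypeR R)) A.
  move=> mA; apply: lebesgue_measure_unique => // _ [[x y]] _ <-.
  pose J : set R := `](x - b) / c, (y - b) / c]%classic.
  transitivity (c%:E * lebesgue_measure J)%E; last first.
    rewrite /mscale /= /pushforward; congr (_ * lebesgue_measure _)%E.
    apply/seteqP; split => z; rewrite /J /= !in_itv /= ltr_pdivrMr // ler_pdivlMr // [z * c]mulrC.
      by move=> /andP[h1 h2]; apply/andP; split; lra.
    by move=> /andP[h1 h2]; apply/andP; split; lra.
  rewrite !lebesgue_measure_itv /= !lte_fin ltr_pM2r ?invr_gt0 // ltrD2r.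
  case: ifP => _; last by rewrite mule0.
  by rewrite -!EFinB -EFinM; congr EFin; field; exact: lt0r_neq0.
rewrite [X in (_ * X)%E](eq_measure_integral _ (fun A mA _ => key mphi A mA)).
rewrite ge0_integral_mscale // ge0_integral_pushforward //.
by rewrite preimage_setT muleA -EFinM mulVf ?lt0r_neq0 // mul1e.
Qed.

(** One coordinate at a time, by Fubini. *)
Lemma integral_affine n (f : 'rV[R]_n -> \bar R) (c : R) (b : 'rV[R]_n) : 0 < c ->
  measurable_fun [set: 'rV[R]_n] f -> (forall x, 0 <= f x)%E ->
  (\int[lebesgue_rV R n]_x f (c *: x + b)%R =
   (c^-1 ^+ n)%:E * \int[lebesgue_rV R n]_x f x)%E.
Proof.
move=> c0; elim: n f b => [|n IH] f b mf f0.
  rewrite expr0 mul1e; apply: eq_integral => x _; congr f.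
  by apply/rowP => -[].
have maff m (d : 'rV[R]_m) : measurable_fun [set: 'rV[R]_m] (fun x : 'rV[R]_m => c *: x + d : 'rV[R]_m).
  apply: measurable_fun_rV => i.
  have -> : coord_rV i \o (fun x : 'rV[R]_m => c *: x + d) = fun x => c * coord_rV i x + d 0 i.
    by apply/funext => x; rewrite /= /coord_rV !mxE.
  apply: measurable_funD => //; apply: measurable_funM => //; exact: measurable_coord_rV.
rewrite integral_rVS //; last by apply: measurableT_comp => //; exact: maff.
rewrite integral_rVS // -(uncons_rVK b); case: (uncons_rV b) => b0 b1.
pose g (a : R) := (\int[lebesgue_rV R n]_v f (cons_rV (a, v)))%E.
have mfc : measurable_fun [set: measurableTypeR R * 'rV[R]_n] (f \o @cons_rV R n).
  by apply: measurableT_comp => //; exact: measurable_cons_rV.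
have mg : measurable_fun [set: R] g.
  apply: (@measurable_fun_fubini_tonelli_F _ _ _ _ R (lebesgue_rV R n) (f \o @cons_rV R n)) => //.
  by move=> z; exact: f0.
transitivity (\int[lebesgue_measure]_a (g (c * a + b0)%R * (c^-1 ^+ n)%:E))%E.
  apply: eq_integral => a _; rewrite muleC /g -(IH _ b1) //.
    apply: eq_integral => v _; congr f; apply/rowP => i.
    by case: (unliftP 0 i) => [j ->|->];
      rewrite mxE [X in X + _]mxE ?cons_rV0 // !cons_rVS !mxE.
  exact: (measurableT_comp mfc (measurable_pair1 (c * a + b0))).
rewrite ge0_integralZr //; last 3 first.
- apply: measurableT_comp => //.
  by apply: measurable_funD => //; apply: measurable_funM.
- by move=> a _; exact: integral_ge0.
- by rewrite lee_fin exprn_ge0 // invr_ge0 ltW.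
rewrite integral_affineR //; last by move=> a; exact: integral_ge0.
by rewrite muleAC -EFinM exprS.
Qed.

Lemma null_coord_rV n (i : 'I_n) (N : set R) : measurable (N : set (measurableTypeR R)) ->
  lebesgue_measure N = 0%E -> lebesgue_rV R n (@coord_rV R n i @^-1` N) = 0%E.
Proof.
move=> mN N0; elim: n i => [[] //|n IH] i.
have mP m (j : 'I_m) : measurable (@coord_rV R m j @^-1` N).
  by rewrite -[X in measurable X]setTI; apply: measurable_coord_rV.
rewrite -[X in lebesgue_rV _ _ X]setIT -integral_indic //; last exact: mP.
have mi : measurable_fun [set: 'rV[R]_n.+1] (fun x => (\1_(@coord_rV R n.+1 i @^-1` N) x : R)%:E).
  by apply/measurable_EFinP/measurable_indic; exact: mP.
case: (unliftP 0 i) mi => [j|] -> mi.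
  rewrite integral_rVS //.
  rewrite integral0_eq // => a _.
  transitivity (\int[lebesgue_rV R n]_v (\1_(@coord_rV R n j @^-1` N) v : R)%:E)%E.
    apply: eq_integral => v _; congr EFin; rewrite !indicE; congr ((nat_of_bool _)%:R).
    by apply/idP/idP; rewrite !inE /= /coord_rV cons_rVS.
  by rewrite (integral_indic _ _ (mP n j)) // setIT; exact: IH.
rewrite integral_rVS_sym //.
rewrite integral0_eq // => v _.
transitivity (\int[lebesgue_measure]_a (\1_N a : R)%:E)%E.
  apply: eq_integral => a _; congr EFin; rewrite !indicE; congr ((nat_of_bool _)%:R).
  by apply/idP/idP; rewrite !inE /= /coord_rV cons_rV0.
by rewrite integral_indic // setIT; exact: N0.
Qed.

(** An open set is the union of the countably many balls with rational centre
    and radius [1 / (k + 1)] that it contains. *)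
Lemma open_measurable_rV n (O : set 'rV[R]_n) : open O -> measurable O.
Proof.
move=> oO.
pose B (z : 'rV[rat]_n * nat) : set 'rV[R]_n :=
  if pselect (ball (map_mx ratr z.1 : 'rV[R]_n) z.2.+1%:R^-1 `<=` O)
  then ball (map_mx ratr z.1 : 'rV[R]_n) z.2.+1%:R^-1 else set0.
have -> : O = \bigcup_z B z.
  apply/seteqP; split => [x Ox|x [z _]]; last by rewrite /B; case: pselect => // h; exact: h.
  have := open_nbhs_nbhs (conj oO Ox); rewrite -nbhs_ballE => -[e /= e0 he].
  have [k hk] : exists k : nat, k.+1%:R^-1 < e / 2.
    exists (Num.bound (e / 2)^-1); rewrite invf_plt ?posrE ?divr_gt0 //.
    apply: lt_trans (archi_boundP _) _; first by rewrite invr_ge0 divr_ge0 // ltW.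
    by rewrite ltr_nat.
  have k0 : (0 : R) < k.+1%:R^-1 by rewrite invr_gt0.
  have /choice[c hc] : forall i : 'I_n, exists q : rat, `|x 0 i - ratr q| < k.+1%:R^-1.
    move=> i.
    have [q] : exists q, ratr q \in `](x 0 i - k.+1%:R^-1), (x 0 i)[ by apply: rat_in_itvoo; rewrite ltrBlDr ltrDl.
    rewrite in_itv /= => /andP[h1 h2]; exists q.
    by rewrite ger0_norm ?subr_ge0 ?ltW // ltrBlDl -ltrBlDr.
  exists (\row_i c i, k) => //; rewrite /B /=.
  have bx : ball (map_mx ratr (\row_i c i) : 'rV[R]_n) k.+1%:R^-1 x.
    by apply/ball_rVP => // i; rewrite !mxE distrC.
  case: pselect => // -[] y /(ball_rVP _ _ k0) hy; apply: he.
  apply/ball_rVP => // i; have := hy i; have := hc i; rewrite !mxE => h1 h2.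
  rewrite (le_lt_trans (ler_distD (ratr (c i)) _ _)) //.
  by rewrite (splitr e) ltrD // (lt_trans _ hk).
apply: countable_bigcupT_measurable => [|z]; first exact: countableP.
rewrite /B; case: pselect => h; [exact: measurable_ball_rV|exact: measurable0].
Qed.

Lemma continuous_measurable_rV n (f : 'rV[R]_n -> R) : continuous f -> measurable_fun setT f.
Proof.
move=> cf; apply: (measurability _ (RGenOInfty.measurableE R)).
move=> _ [_ [a ->] <-]; rewrite setTI; apply: open_measurable_rV.
by apply: open_comp => // x _; exact: cf.
Qed.

Lemma rV_bounded n (x : 'rV[R]_n) : exists N : nat, forall j, `|x 0 j| < N%:R.
Proof.
exists (Num.bound (\sum_j `|x 0 j|)) => j.
rewrite (le_lt_trans _ (archi_boundP _)) ?sumr_ge0 //.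
by rewrite (bigD1 j) //= lerDl sumr_ge0.
Qed.

End rV_basics.

(** * Dyadic radii and geometric series *)

Section dyadic_radii.
Variable R : realType.

(** The even indices run through the powers [2 ^ m] and the odd ones through
    [2 ^ - m], so that a series over the natural numbers covers all dyadic
    scales. *)
Definition rad (m : nat) : R :=
  if odd m then 2 ^- m./2 else 2 ^+ m./2.

Lemma rad_gt0 m : 0 < rad m.
Proof. by rewrite /rad; case: ifP => _; rewrite ?invr_gt0 exprn_gt0. Qed.

Lemma rad_cover (t : R) : 0 < t -> exists m, rad m <= t <= 2 * rad m.
Proof.
have big (u : R) : 1 <= u -> exists n, 2 ^+ n <= u <= 2 ^+ n.+1.
  move=> u1; have u0 : 0 <= u by exact: le_trans u1.
  have /andP[h1 h2] := Num.Theory.truncn_itv u0.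
  have t0 : (0 < Num.truncn u)%N by rewrite Num.Theory.truncn_gt0.
  have /andP[h3 h4] := trunc_log_bounds (isT : (1 < 2)%N) t0.
  exists (trunc_log 2 (Num.truncn u)); apply/andP; split.
    by apply: le_trans h1; rewrite -natrX ler_nat.
  by apply: (le_trans (ltW h2)); rewrite -natrX ler_nat.
move=> t0; have [t1|t1] := leP 1 t.
  have [n /andP[h1 h2]] := big _ t1.
  by exists n.*2; rewrite /rad odd_double doubleK -exprS h1.
have [n /andP[h1 h2]] : exists n, 2 ^+ n <= t^-1 <= 2 ^+ n.+1.
  by apply: big; rewrite invf_ge1 // ltW.
exists n.+1.*2.+1; rewrite /rad /= odd_double /= uphalf_double.
rewrite -[t]invrK lef_pV2 ?posrE ?exprn_gt0 ?invr_gt0 // h2 /=.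
by rewrite exprS invfM mulrA divff // mul1r lef_pV2 ?posrE ?exprn_gt0 ?invr_gt0.
Qed.

(** The terms below [D] form a tail (if [b < 1]) or a beginning (if [b > 1])
    of the geometric series, comparable with its largest term. For [b < 1] the
    induction carries the remainder of the series along. *)
Lemma geometric_below (b : R) : 0 < b -> b != 1 -> exists2 C : R, 0 <= C &
  forall D N, 0 < D -> \sum_(n < N | b ^+ n <= D) b ^+ n <= C * D.
Proof.
move=> b0 b1; case: (ltgtP b 1) b1 => // b1 _.
- have bb : 0 < 1 - b by lra.
  exists (1 - b)^-1; first by rewrite invr_ge0 ltW.
  move=> D N D0.
  suff [->|h] : \sum_(n < N | b ^+ n <= D) b ^+ n = 0 \/
     \sum_(n < N | b ^+ n <= D) b ^+ n + b ^+ N / (1 - b) <= (1 - b)^-1 * D.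
  - by rewrite mulr_ge0 ?invr_ge0 ?ltW.
  - by apply: le_trans h; rewrite lerDl divr_ge0 ?exprn_ge0 ?ltW.
  elim: N => [|N IH]; first by rewrite big_ord0; left.
  have e : b ^+ N + b ^+ N.+1 / (1 - b) = b ^+ N / (1 - b).
    by rewrite exprS; field; rewrite lt0r_neq0.
  have e' : b ^+ N.+1 / (1 - b) <= b ^+ N / (1 - b).
    by rewrite ler_pM2r ?invr_gt0 // exprS ger_pMl ?exprn_gt0 // ltW.
  rewrite big_mkcond big_ord_recr -big_mkcond /=; case: ifP => hN.
    right; case: IH => [->|h].
      by rewrite add0r e mulrC ler_pM2l // invr_gt0.
    by rewrite -addrA e.
  rewrite addr0; case: IH => [->|h]; [by left|right].
  by apply: le_trans h; rewrite lerD2l.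
- have bb : 0 < b - 1 by lra.
  exists (b / (b - 1)); first by rewrite divr_ge0 ?ltW.
  move=> D N D0.
  suff /andP[] : (\sum_(n < N | b ^+ n <= D) b ^+ n <= b / (b - 1) * D) &&
     (\sum_(n < N | b ^+ n <= D) b ^+ n <= b ^+ N / (b - 1)) by [].
  elim: N => [|N /andP[IH1 IH2]].
    by rewrite big_ord0 expr0 mulr_ge0 ?divr_ge0 ?invr_ge0 ?ltW.
  have e : b ^+ N / (b - 1) + b ^+ N = b ^+ N * (b / (b - 1)).
    by field; rewrite lt0r_neq0.
  rewrite big_mkcond big_ord_recr -big_mkcond /=; case: ifP => hN.
    have h : \sum_(n < N | b ^+ n <= D) b ^+ n + b ^+ N <= b ^+ N * (b / (b - 1)).
      by rewrite -e lerD2r.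
    apply/andP; split; last by rewrite exprS [b * b ^+ N]mulrC -mulrA.
    by rewrite (le_trans h) // mulrC ler_pM2l // divr_gt0.
  rewrite addr0 IH1 /= (le_trans IH2) // ler_pM2r ?invr_gt0 //.
  by rewrite exprS ler_pMl ?exprn_gt0 // ltW.
Qed.

(** The even and the odd indices give the geometric series of ratios [2 ^ c]
    and [2 ^ - c]. *)
Lemma rad_sum (c : R) : c != 0 -> exists2 C : R, 0 <= C &
  forall D N, 0 < D -> \sum_(m < N | rad m `^ c <= D) rad m `^ c <= C * D.
Proof.
move=> c0; pose b : R := 2 `^ c.
have b0 : 0 < b by rewrite powR_gt0.
have b1 : b != 1 by rewrite powR_eq1 negb_or (negbTE c0); lra.
have bV0 : 0 < b^-1 by rewrite invr_gt0.
have bV1 : b^-1 != 1 by rewrite invr_eq1.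
have [C1 C10 h1] := geometric_below b0 b1.
have [C2 C20 h2] := geometric_below bV0 bV1.
have pX n : (2 ^+ n : R) `^ c = b ^+ n.
  by rewrite -powR_mulrn // -powRrM mulrC powRrM powR_mulrn // ltW.
have pV n : (2 ^- n : R) `^ c = b^-1 ^+ n.
  by rewrite -powR_inv1 ?exprn_ge0 // -powRrM mulN1r powRN pX exprVn.
exists (C1 + C2); first exact: addr_ge0.
move=> D N D0; rewrite mulrDl.
apply: le_trans (lerD (h1 D N D0) (h2 D N D0)).
apply: (@le_trans _ _ (\sum_(m < N.*2 | rad m `^ c <= D) rad m `^ c)).
  rewrite [leLHS]big_mkcond [leRHS]big_mkcond /=.
  rewrite -(big_mkord xpredT (fun m => if rad m `^ c <= D then rad m `^ c else 0)).
  rewrite -(big_mkord xpredT (fun m => if rad m `^ c <= D then rad m `^ c else 0)).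
  rewrite [leRHS](@big_cat_nat _ _ _ N) //=; last by rewrite -addnn leq_addr.
  by rewrite lerDl sumr_ge0 // => i _; case: ifP => // _; exact: powR_ge0.
rewrite big_mkcond [X in _ <= X + _]big_mkcond [X in _ <= _ + X]big_mkcond /=.
elim: N => [|N IH]; first by rewrite !big_ord0 addr0.
rewrite doubleS !big_ord_recr /= [in leRHS]addrACA -addrA lerD //.
by rewrite {1 2 3 4}/rad /= odd_double /= uphalf_double doubleK pX pV.
Qed.

Lemma nneseries_le (u : nat -> \bar R) (B : \bar R) : (forall m, 0 <= u m)%E ->
  (forall N, \sum_(m < N) u m <= B)%E -> (\sum_(m <oo) u m <= B)%E.
Proof.
move=> u0 h; apply: lime_le; first by apply: is_cvg_nneseries => n _ _; exact: u0.
by apply: nearW => N; rewrite /= big_mkord; exact: h.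
Qed.

End dyadic_radii.

(** * Measurability of averages *)

Section averaging_operators.
Context {d d'} {S : measurableType d'} {T : measurableType d} {R : realType}.
Variable mu : {sigma_finite_measure set T -> \bar R}.

(** The parameter in [S] makes the maximal function in some of the coordinates
    jointly measurable in all of them, as Fubini requires. *)
Lemma measurable_section_integral (E : T -> set T) (F : S * T -> \bar R) :
  measurable [set z : T * T | E z.1 z.2] ->
  measurable_fun [set: S * T] F -> (forall z, 0 <= F z)%E ->
  measurable_fun [set: S * T] (fun z => \int[mu]_(y in E z.2) F (z.1, y))%E.
Proof.
move=> mE mF F0.
pose G (z : (S * T) * T) : \bar R := (F (z.1.1, z.2) * (\1_(E z.1.2) z.2)%:E)%E.
have -> : (fun z : S * T => \int[mu]_(y in E z.2) F (z.1, y))%E = fubini_F mu G.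
  apply/funext => z; rewrite /fubini_F /= integral_mkcond.
  apply: eq_integral => y _.
  by rewrite /G /= patchE indicE; case: ifP => _; rewrite ?mule1 ?mule0.
apply: measurable_fun_fubini_tonelli_F; last first.
  by move=> z; rewrite /G mule_ge0 // lee_fin.
apply: emeasurable_funM.
  apply: measurableT_comp => //; apply: measurable_fun_pair => //.
  exact: (measurableT_comp measurable_fst measurable_fst).
apply/measurable_EFinP.
have -> : (fun z : S * T * T => \1_(E z.1.2) z.2 : R) =
   \1_[set z : T * T | E z.1 z.2] \o (fun z : S * T * T => (z.1.2, z.2)).
  by apply/funext => z; rewrite /= !indicE; congr (_ %:R); congr nat_of_bool;
    apply/idP/idP; rewrite !inE.
apply: measurableT_comp; first exact: measurable_indic.
apply: measurable_fun_pair => //.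
exact: (measurableT_comp measurable_snd measurable_fst).
Qed.

Lemma measurable_ereal_supT (f : nat -> S -> \bar R) :
  (forall m, measurable_fun setT (f m)) ->
  measurable_fun setT (fun x => ereal_sup (range (f ^~ x))).
Proof.
move=> mf; have := measurable_fun_esups mf 0%N.
rewrite /esups /=; congr measurable_fun; apply/funext => x.
by congr ereal_sup; apply/seteqP; split => [_ [m _ <-]|_ [m _ <-]]; exists m.
Qed.

End averaging_operators.
Arguments measurable_section_integral {d d' S T R} mu E F.

(** * The maximal function on the line *)

Section maximal_function_line.
Variable R : realType.
Local Notation leb := (@lebesgue_measure R).

(** A supremum over dyadic radii is countable, hence measurable, and
    comparable with the one over all radii. *)
Definition maxfun1 (f : R -> \bar R) (x : R) : \bar R :=
  ereal_sup (range (fun m => ((2 * rad R m)^-1%:E *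
    \int[leb]_(y in ball x (rad R m)) f y)%E)).

Lemma measurable_ball_prodR (r : R) :
  measurable [set z : measurableTypeR R * measurableTypeR R | ball (z.1 : R) r (z.2 : R)].
Proof.
have -> : [set z : measurableTypeR R * measurableTypeR R | ball (z.1 : R) r (z.2 : R)] =
   (fun z : measurableTypeR R * measurableTypeR R => `|z.1 - z.2|) @^-1` `]-oo, r[.
  by apply/seteqP; split => z /=; rewrite in_itv.
rewrite -[X in measurable X]setTI.
have : measurable_fun setT (fun z : measurableTypeR R * measurableTypeR R => `|z.1 - z.2|).
  by apply: measurableT_comp => //; apply: measurable_funB.
by apply.
Qed.

Lemma measurable_maxfun1 d (S : measurableType d) (F : S * measurableTypeR R -> \bar R) :
  measurable_fun setT F -> (forall z, 0 <= F z)%E ->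
  measurable_fun [set: S * measurableTypeR R] (fun z => maxfun1 (fun y => F (z.1, y)) z.2).
Proof.
move=> mF F0; apply: measurable_ereal_supT => m.
apply: emeasurable_funM => //.
by apply: (measurable_section_integral leb (fun x => ball (x : R) (rad R m))) => //;
  exact: measurable_ball_prodR.
Qed.

Lemma measurable_maxfun1T (f : R -> \bar R) :
  measurable_fun setT f -> (forall z, 0 <= f z)%E -> measurable_fun setT (maxfun1 f).
Proof.
move=> mf f0.
have h : measurable_fun [set: unit * measurableTypeR R] (fun z => maxfun1 f z.2).
  apply: (@measurable_maxfun1 _ unit (fun z => f z.2)) => //.
  exact: measurableT_comp.
exact: (measurableT_comp h (measurable_pair1 tt)).
Qed.

(** Only the part of the function above half the level matters, since the
    average of the rest is at most half the level. *)
Lemma maxfun1_weak (f : R -> R) (t : R) : 0 < t ->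
  measurable_fun setT f -> (forall x, 0 <= f x) ->
  let g := fun x => if t / 2 < f x then f x else 0 in
  (\int[leb]_x (g x)%:E < +oo)%E ->
  (leb [set x | t%:E < maxfun1 (EFin \o f) x] <= (6 / t)%:E * \int[leb]_x (g x)%:E)%E.
Proof.
move=> t0 mf f0 g gfin.
have g0 x : 0 <= g x by rewrite /g; case: ifP.
have mg : measurable_fun setT g.
  by apply: measurable_fun_ifT => //; apply: measurable_fun_ltr.
have lg : locally_integrable setT g.
  apply: open_integrable_locally; first exact: openT.
  apply/integrableP; split; first exact/measurable_EFinP.
  by under eq_integral => x _ do rewrite /= ger0_norm //.
have t20 : 0 < t / 2 by rewrite divr_gt0.
(* The factor 3 of the covering argument, at the level [t / 2]. *)
have := maximal_inequality lg t20.
have -> : 3 / (t / 2) = 6 / t by field; rewrite lt0r_neq0.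
under [in X in (_ <= X)%E -> _]eq_integral => x _ do rewrite /= ger0_norm //.
apply: le_trans; apply: le_measure.
- rewrite inE -[X in measurable X]setTI; apply: emeasurable_fun_o_infty => //.
  apply: measurable_maxfun1T => //; first exact/measurable_EFinP.
- rewrite inE -[X in measurable X]setTI; apply: emeasurable_fun_o_infty => //.
  exact: measurable_HL_maximal.
move=> x /= /ereal_sup_gt[_ [m _ <-]] hm.
set r := rad R m in hm.
have r0 : 0 < r by exact: rad_gt0.
have bE : leb (ball x r) = (2 * r)%:E by rewrite (lebesgue_measure_ball x (ltW r0)) mulr_natl.
apply: (@lt_le_trans _ _ (iavg g (ball x r))); last first.
  by apply: ereal_sup_ubound; exists r => //=; rewrite in_itv /= r0.
rewrite /iavg bE inver gt_eqF ?mulr_gt0 //.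
have mb : measurable (ball x r) by exact: measurable_ball.
under eq_integral => y _ do rewrite /= ger0_norm //.
have : (\int[leb]_(y in ball x r) (f y)%:E <= \int[leb]_(y in ball x r) ((t / 2)%:E + (g y)%:E))%E.
  apply: ge0_le_integral => //.
  - by move=> y _; rewrite lee_fin.
  - by apply/measurable_EFinP; exact: measurable_funTS.
  - by apply: emeasurable_funD => //; apply/measurable_EFinP; exact: measurable_funTS.
  - move=> y _; rewrite -EFinD lee_fin /g; case: ltP => h; last by rewrite addr0.
    by rewrite lerDr ltW.
rewrite ge0_integralD //; last 3 first.
- by move=> y _; rewrite lee_fin ltW.
- by move=> y _; rewrite lee_fin.
- by apply/measurable_EFinP; exact: measurable_funTS.
rewrite integral_cst // [X in (_ * X)%E]bE => hf.
have r20 : 0 < (2 * r)^-1 by rewrite invr_gt0 mulr_gt0.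
have : (t%:E < (2 * r)^-1%:E * ((t / 2)%:E * (2 * r)%:E + \int[leb]_(y in ball x r) (g y)%:E))%E.
  by apply: (lt_le_trans hm); rewrite lee_pmul2l.
rewrite ge0_muleDr; last 2 first.
- by rewrite -EFinM lee_fin mulr_ge0 ?ltW // mulr_gt0.
- by apply: integral_ge0 => y _; rewrite lee_fin.
rewrite -!EFinM.
have -> : (2 * r)^-1 * (t / 2 * (2 * r)) = t / 2 by field; rewrite lt0r_neq0.
by rewrite {1}(splitr t) EFinD lteD2lE.
Qed.

End maximal_function_line.

Lemma eq_leW d (T : porderType d) (x y : T) : x = y -> (x <= y)%O.
Proof. by move=> ->. Qed.

Section maximal_function_line_strong.
Variable R : realType.
Local Notation leb := (@lebesgue_measure R).

Lemma nneseries_ge_term (u : nat -> \bar R) m : (forall i, 0 <= u i)%E ->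
  (u m <= \sum_(i <oo) u i)%E.
Proof.
move=> u0; apply: le_trans (nneseries_lim_ge m.+1 _); last by move=> i _ _; exact: u0.
by rewrite big_nat_recr //= leeDr // sume_ge0.
Qed.

Lemma measurable_nneseries d (T : measurableType d) (h : nat -> T -> \bar R) :
  (forall m, measurable_fun setT (h m)) -> (forall m x, 0 <= h m x)%E ->
  measurable_fun setT (fun x => \sum_(m <oo) h m x)%E.
Proof.
move=> mh h0; apply: (ge0_emeasurable_sum (P := xpredT)) => [m x _ _|m _].
  exact: h0.
exact: mh.
Qed.

(** Layer-cake decomposition along the dyadic levels, which costs a factor
    bounded in terms of [p] only. *)
Lemma dyadic_layer_cake (p : R) (v : \bar R) : 0 < p -> (0 <= v)%E ->
  (v `^ p <= \sum_(m <oo) (((4 * rad R m) `^ p)%:E * ((rad R m)%:E < v)%E%:R%:E))%E.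
Proof.
move=> p0 v0; set rhs := (X in (_ <= X)%E).
have key (w : R) : 0 < w -> (w%:E <= v)%E -> ((w `^ p)%:E <= rhs)%E.
  move=> w0 wv; have [m /andP[h1 h2]] := rad_cover (divr_gt0 w0 (ltr0n R 2)).
  have r0 := rad_gt0 R m.
  apply: le_trans (nneseries_ge_term m _); last first.
    by move=> i; rewrite mule_ge0 // lee_fin ?powR_ge0 // ler0n.
  have -> : ((rad R m)%:E < v)%E by apply: lt_le_trans wv; rewrite lte_fin; lra.
  (* As [rad m <= w / 2 <= 2 * rad m], the level [rad m] lies below [w], and
     [w <= 4 * rad m]. *)
  rewrite mule1 lee_fin ge0_ler_powR ?nnegrE //; [exact: ltW|exact: ltW|lra|lra].
have r0 : (0 <= rhs)%E.
  by apply: nneseries_ge0 => i _ _; rewrite mule_ge0 // lee_fin ?powR_ge0 // ler0n.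
case: v v0 @rhs r0 key => [v| |] // v0 rhs r0 key.
- rewrite poweR_EFin; move: v0; rewrite lee_fin le_eqVlt => /predU1P[<-|v0].
    by rewrite powR0 // gt_eqF.
  exact: key.
- rewrite poweRyr ?gt_eqF //.
  case: rhs r0 key => [r| |] // r0 key.
  pose w := ((r + 1) `^ p^-1).
  have w0 : 0 < w by rewrite powR_gt0 // ltr_pwDr.
  have := key _ w0 (leey _).
  by rewrite /w -powRrM mulVf ?gt_eqF // powRr1 ?addr_ge0 // lee_fin leNgt ltrDl ltr01.
Qed.

(** Marcinkiewicz interpolation: at each dyadic level the weak type bound is
    applied to the part of [f] above half that level, and for each [x] the
    resulting sum over the levels below [2 * f x] is geometric. *)
Lemma maxfun1_strong_fin (p : R) : 1 < p -> exists2 C : R, 0 <= C &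
  forall f : R -> R, measurable_fun setT f -> (forall x, 0 <= f x) ->
  (\int[leb]_x (f x `^ p)%:E < +oo)%E ->
  (\int[leb]_x (maxfun1 (EFin \o f) x `^ p) <= C%:E * \int[leb]_x (f x `^ p)%:E)%E.
Proof.
move=> p1; have p0 : 0 < p by lra.
have [C1 C10 hC1] := @rad_sum R (p - 1) ltac:(by rewrite gt_eqF // subr_gt0).
have C0 : 0 <= 4 `^ p * 6 * C1 * 2 `^ (p - 1) by rewrite !mulr_ge0 // powR_ge0.
exists (4 `^ p * 6 * C1 * 2 `^ (p - 1)) => // f mf f0 ffin.
have mef : measurable_fun setT (EFin \o f) by exact/measurable_EFinP.
have ef0 x : (0 <= (EFin \o f) x)%E by rewrite /= lee_fin.
have mM := measurable_maxfun1T mef ef0.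
have mfp : measurable_fun setT (fun x => (f x `^ p)%:E).
  by apply/measurable_EFinP; exact: (measurableT_comp (measurable_powR p) mf).
pose g m x := if rad R m / 2 < f x then f x else 0.
have g0 m x : 0 <= g m x by rewrite /g; case: ifP.
have mg m : measurable_fun setT (g m).
  by apply: measurable_fun_ifT => //; apply: measurable_fun_ltr.
have gfin m : (\int[leb]_x (g m x)%:E < +oo)%E.
  have r20 : 0 < rad R m / 2 by rewrite divr_gt0 // rad_gt0.
  apply: (@le_lt_trans _ _ (\int[leb]_x (((rad R m / 2) `^ (1 - p))%:E * (f x `^ p)%:E))%E).
    apply: ge0_le_integral => //.
    - by move=> x _; rewrite lee_fin.
    - by apply/measurable_EFinP; exact: mg.
    - exact: emeasurable_funM.
    - move=> x _; rewrite -EFinM lee_fin /g; case: ifP => h; last first.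
        by rewrite mulr_ge0 ?powR_ge0.
      have fx0 : 0 < f x by exact: lt_trans h.
      rewrite -[1 - p]opprB powRN -(mulr_powRB1 (ltW fx0) p0) mulrCA ler_pMr //.
      rewrite ler_pdivlMl ?powR_gt0 // mulr1.
      by rewrite ge0_ler_powR ?nnegrE ?subr_ge0 ?(ltW p1) ?(ltW r20) ?(ltW h).
  rewrite ge0_integralZl //; last by rewrite lee_fin powR_ge0.
    by rewrite lte_mul_pinfty // lee_fin powR_ge0.
  by move=> x _; rewrite lee_fin powR_ge0.
have mE m : measurable [set x | ((rad R m)%:E < maxfun1 (EFin \o f) x)%E].
  by rewrite -[X in measurable X]setTI; apply: emeasurable_fun_o_infty.
have indE m : (fun x => ((rad R m)%:E < maxfun1 (EFin \o f) x)%E%:R%:E : \bar R) =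
    fun x => (\1_[set x | ((rad R m)%:E < maxfun1 (EFin \o f) x)%E] x)%:E.
  apply/funext => x; rewrite indicE; congr (_ %:R%:E); congr nat_of_bool.
  by apply/idP/idP; rewrite inE.
have mi0 m : measurable_fun setT
    (fun x => ((rad R m)%:E < maxfun1 (EFin \o f) x)%E%:R%:E : \bar R).
  by rewrite indE; apply/measurable_EFinP/measurable_indic.
have mind m : measurable_fun setT
    (fun x => ((4 * rad R m) `^ p)%:E * ((rad R m)%:E < maxfun1 (EFin \o f) x)%E%:R%:E : \bar R)%E.
  exact: emeasurable_funM.
have ind0 m x : (0 <= ((4 * rad R m) `^ p)%:E * ((rad R m)%:E < maxfun1 (EFin \o f) x)%E%:R%:E :> \bar R)%E.
  by rewrite mule_ge0 // lee_fin ?powR_ge0 // ler0n.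
have M0 x : (0 <= maxfun1 (EFin \o f) x)%E.
  apply: le_trans (ereal_sup_ubound (ex_intro2 _ _ 0%N I erefl)).
  apply: mule_ge0; first by rewrite lee_fin invr_ge0 mulr_ge0 // ltW // rad_gt0.
  by apply: integral_ge0 => y _; rewrite lee_fin.
apply: (@le_trans _ _ (\int[leb]_x \sum_(m <oo)
   (((4 * rad R m) `^ p)%:E * ((rad R m)%:E < maxfun1 (EFin \o f) x)%E%:R%:E))%E).
  apply: ge0_le_integral => //.
  - by move=> x _; exact: poweR_ge0.
  - exact: (measurableT_comp (measurable_poweR p)).
  - exact: measurable_nneseries.
  - by move=> x _; exact: dyadic_layer_cake.
rewrite integral_nneseries //.
apply: (@le_trans _ _ (\sum_(m <oo) \int[leb]_x
   ((4 * rad R m) `^ p * (6 / rad R m) * g m x)%:E)%E).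
  apply: lee_nneseries => [m _ _|m _].
    by apply: integral_ge0 => x _; exact: ind0.
  under [leRHS]eq_integral => x _ do rewrite EFinM.
  have r0 := rad_gt0 R m.
  rewrite !ge0_integralZl //; first last.
  - by rewrite lee_fin powR_ge0.
  - exact: mi0.
  - by rewrite lee_fin mulr_ge0 ?powR_ge0 // divr_ge0 // ltW.
  - by move=> x _; rewrite lee_fin.
  - by apply/measurable_EFinP; exact: mg.
  rewrite EFinM -muleA lee_wpmul2l ?lee_fin ?powR_ge0 //.
  apply: le_trans (maxfun1_weak r0 mf f0 (gfin m)).
  apply: (@le_trans _ _ (\int[leb]_x (\1_[set x | ((rad R m)%:E < maxfun1 (EFin \o f) x)%E] x)%:E)%E).
    by apply/eq_leW/eq_integral => x _; exact: (congr1 (fun F => F x) (indE m)).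
  by have := integral_indic leb measurableT (mE m); rewrite setIT => ->.
rewrite -integral_nneseries //; last 2 first.
- by move=> m; apply/measurable_EFinP; apply: measurable_funM => //; exact: mg.
- by move=> m x _; rewrite lee_fin !mulr_ge0 ?powR_ge0 // invr_ge0 ltW // rad_gt0.
rewrite -ge0_integralZl //; last by move=> x _; rewrite lee_fin powR_ge0.
apply: ge0_le_integral => //.
- move=> x _; apply: nneseries_ge0 => m _ _.
  by rewrite lee_fin !mulr_ge0 ?powR_ge0 // invr_ge0 ltW // rad_gt0.
- apply: measurable_nneseries => [m|m x].
    by apply/measurable_EFinP; apply: measurable_funM => //; exact: mg.
  by rewrite lee_fin !mulr_ge0 ?powR_ge0 // invr_ge0 ltW // rad_gt0.
- exact: emeasurable_funM.
move=> x _; apply: nneseries_le => [m|N].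
  by rewrite lee_fin !mulr_ge0 ?powR_ge0 // invr_ge0 ltW // rad_gt0.
rewrite sumEFin -EFinM lee_fin.
have := f0 x; rewrite le_eqVlt => /predU1P[fx0|fx0].
  rewrite big1 ?mulr_ge0 ?powR_ge0 // => m _.
  by rewrite /g -fx0 if_same mulr0.
have D0 : 0 < (2 * f x) `^ (p - 1) by rewrite powR_gt0 // mulr_gt0.
apply: (@le_trans _ _ (4 `^ p * 6 * f x *
   \sum_(m < N | rad R m `^ (p - 1) <= (2 * f x) `^ (p - 1)) rad R m `^ (p - 1))).
  rewrite [X in _ <= _ * X]big_mkcond mulr_sumr; apply: ler_sum => m _ /=.
  have r0 := rad_gt0 R m.
  rewrite /g; case: ifP => h; last first.
    by rewrite mulr0 mulr_ge0 // ?mulr_ge0 ?powR_ge0 //; case: ifP => // _; exact: powR_ge0.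
  have -> : rad R m `^ (p - 1) <= (2 * f x) `^ (p - 1).
    by rewrite ge0_ler_powR ?nnegrE ?subr_ge0; [|exact: ltW|exact: ltW|lra|lra].
  rewrite powRM //; last exact: ltW.
  rewrite -(mulr_powRB1 (ltW r0) p0).
  by apply/eq_leW; field; rewrite lt0r_neq0.
apply: (@le_trans _ _ (4 `^ p * 6 * f x * (C1 * (2 * f x) `^ (p - 1)))).
  by rewrite ler_pM2l ?hC1 // !mulr_gt0 // powR_gt0.
rewrite powRM // -(mulr_powRB1 (ltW fx0) p0).
by apply/eq_leW; ring.
Qed.

(** Extended-real functions reduce to finite ones, with which they agree
    almost everywhere if the right-hand side is finite. *)
Lemma maxfun1_strong (p : R) : 1 < p -> exists2 C : R, 0 < C &
  forall f : R -> \bar R, measurable_fun setT f -> (forall x, 0 <= f x)%E ->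
  (\int[leb]_x (maxfun1 f x `^ p) <= C%:E * \int[leb]_x (f x `^ p))%E.
Proof.
move=> p1; have p0 : 0 < p by lra.
have [C C0 hC] := maxfun1_strong_fin p1.
exists (C + 1); first by rewrite ltr_pwDr.
move=> f mf f0.
have [fy|ffin] := leP +oo%E (\int[leb]_x (f x `^ p))%E.
  move: fy; rewrite leye_eq => /eqP ->.
  by rewrite gt0_muley ?leey // lte_fin ltr_pwDr.
have mfp : measurable_fun setT (fun x => f x `^ p)%E.
  exact: (measurableT_comp (measurable_poweR p)).
have intf : leb.-integrable setT (fun x => f x `^ p)%E.
  apply/integrableP; split => //.
  by under eq_integral => x _ do rewrite gee0_abs ?poweR_ge0 //.
pose g x := fine (f x).
have mg : measurable_fun setT g by exact: measurableT_comp.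
have g0 x : 0 <= g x by exact: fine_ge0.
have fg : ae_eq leb setT f (EFin \o g).
  have := integrable_ae measurableT intf; apply: filterS => x h _.
  have := h I; rewrite /g /=; case: (f x) (f0 x) => //= _.
  by rewrite gt_eqF.
have e1 : (\int[leb]_x (f x `^ p) = \int[leb]_x (g x `^ p)%:E)%E.
  apply: ge0_ae_eq_integral => //.
  - by apply/measurable_EFinP; exact: (measurableT_comp (measurable_powR p) mg).
  - by move=> x _; exact: poweR_ge0.
  - by move=> x _; rewrite lee_fin powR_ge0.
  - by apply: filterS fg => x h _; rewrite (h I) poweR_EFin.
have e2 : maxfun1 f = maxfun1 (EFin \o g).
  apply/funext => x; rewrite /maxfun1; congr ereal_sup; apply: eq_imagel => m _.
  congr (_ * _)%E; apply: ge0_ae_eq_integral => //.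
  - exact: measurable_ball.
  - exact: measurable_funTS.
  - by apply/measurable_EFinP; exact: measurable_funTS.
  - by move=> y _; rewrite lee_fin.
  - by apply: filterS fg => y h _; exact: h.
rewrite e1 e2 (le_trans (hC g mg g0 _)) -?e1 // e1.
rewrite lee_wpmul2r ?lee_fin ?lerDl //.
by apply: integral_ge0 => x _; rewrite lee_fin powR_ge0.
Qed.

End maximal_function_line_strong.

(** * The maximal function over cubes *)

Section maximal_function_rV.
Variable R : realType.
Local Notation leb := (@lebesgue_measure R).
Local Notation mu n := (lebesgue_rV R n).

Definition maxfun n (f : 'rV[R]_n -> \bar R) (x : 'rV[R]_n) : \bar R :=
  ereal_sup (range (fun m => (((2 * rad R m)^-1 ^+ n)%:E *
    \int[mu n]_(y in ball x (rad R m)) f y)%E)).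

Lemma measurable_maxfun d (S : measurableType d) n (F : S * 'rV[R]_n -> \bar R) :
  measurable_fun setT F -> (forall z, 0 <= F z)%E ->
  measurable_fun [set: S * 'rV[R]_n] (fun z => maxfun (fun y => F (z.1, y)) z.2).
Proof.
move=> mF F0; apply: measurable_ereal_supT => m.
apply: emeasurable_funM => //.
by apply: (measurable_section_integral (mu n) (fun x => ball x (rad R m))) => //;
  exact: measurable_ball_prod.
Qed.

Lemma measurable_maxfunT n (f : 'rV[R]_n -> \bar R) :
  measurable_fun setT f -> (forall z, 0 <= f z)%E -> measurable_fun setT (maxfun f).
Proof.
move=> mf f0.
have h : measurable_fun [set: unit * 'rV[R]_n] (fun z => maxfun f z.2).
  apply: (@measurable_maxfun _ unit n (fun z => f z.2)) => //.
  exact: measurableT_comp.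
exact: (measurableT_comp h (measurable_pair1 tt)).
Qed.

Lemma maxfun_ge0 n (f : 'rV[R]_n -> \bar R) x : (forall z, 0 <= f z)%E -> (0 <= maxfun f x)%E.
Proof.
move=> f0; apply: le_trans (ereal_sup_ubound (ex_intro2 _ _ 0%N I erefl)).
apply: mule_ge0; last by apply: integral_ge0 => y _.
by rewrite lee_fin exprn_ge0 // invr_ge0 mulr_ge0 // ltW // rad_gt0.
Qed.

Lemma integral_ball_le_maxfun n (f : 'rV[R]_n -> \bar R) x m :
  (\int[mu n]_(y in ball x (rad R m)) f y <= ((2 * rad R m) ^+ n)%:E * maxfun f x)%E.
Proof.
have r0 := rad_gt0 R m.
rewrite -lee_pdivrMl ?exprn_gt0 ?mulr_gt0 // -exprVn.
exact: (ereal_sup_ubound (ex_intro2 _ _ m I erefl)).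
Qed.

Lemma integral_ball_cons n (f : 'rV[R]_n.+1 -> \bar R) (a : R) (v : 'rV[R]_n) (r : R) :
  0 < r -> measurable_fun setT f -> (forall z, 0 <= f z)%E ->
  (\int[mu n.+1]_(y in ball (cons_rV (a, v)) r) f y =
   \int[leb]_(b in ball a r) \int[mu n]_(w in ball v r) f (cons_rV (b, w)))%E.
Proof.
move=> r0 mf f0.
rewrite integral_mkcond integral_rVS; last 2 first.
- by apply/(measurable_restrictT _ _).1; [exact: measurable_ball_rV|exact: measurable_funTS].
- by move=> x; rewrite patchE; case: ifP.
rewrite [RHS]integral_mkcond; apply: eq_integral => b _.
rewrite [RHS]patchE; case: ifPn; rewrite ?inE ?notin_setE => hb.
  rewrite [RHS]integral_mkcond; apply: eq_integral => w _.
  rewrite !patchE; case: ifPn; case: ifPn => //; rewrite ?inE ?notin_setE.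
    by move=> h /(ball_cons_rV _ _ _ _ r0) [].
  by move=> h []; apply/(ball_cons_rV _ _ _ _ r0).
rewrite integral0_eq // => w _; rewrite patchE; case: ifPn => //; rewrite inE.
by move=> /(ball_cons_rV _ _ _ _ r0) [].
Qed.

(** The balls of the supremum norm are cubes, so an average over a ball is an
    average in the first coordinate of averages over a ball in the others,
    with the same radius. *)
Lemma maxfun_cons n (f : 'rV[R]_n.+1 -> \bar R) (a : R) (v : 'rV[R]_n) :
  measurable_fun setT f -> (forall z, 0 <= f z)%E ->
  (maxfun f (cons_rV (a, v)) <=
   maxfun1 (fun b => maxfun (fun w => f (cons_rV (b, w))) v) a)%E.
Proof.
move=> mf f0; apply: ge_ereal_sup => _ [m _ <-].
have r0 := rad_gt0 R m.
apply: le_trans (ereal_sup_ubound (ex_intro2 _ _ m I erefl)).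
have mfc : measurable_fun [set: measurableTypeR R * 'rV[R]_n] (f \o @cons_rV R n).
  by apply: measurableT_comp => //; exact: measurable_cons_rV.
have c0 : 0 <= (2 * rad R m)^-1 by rewrite invr_ge0 mulr_ge0 // ltW.
rewrite integral_ball_cons // exprS EFinM -muleA lee_wpmul2l ?lee_fin //.
have mb : measurable (ball a (rad R m)) by exact: measurable_ball.
rewrite -ge0_integralZl //; last 3 first.
- apply: measurable_funTS.
  have := (measurable_section_integral (mu n) (fun x => ball x (rad R m)) _
    (measurable_ball_prod (rad R m)) mfc (fun z => f0 _)).
  by move=> h; exact: (measurableT_comp h (measurable_pair2 v)).
- by move=> b _; apply: integral_ge0.
- by rewrite lee_fin exprn_ge0.
apply: ge0_le_integral => //.
- by move=> b _; rewrite mule_ge0 ?lee_fin ?exprn_ge0 //; apply: integral_ge0.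
- apply: measurable_funTS; apply: emeasurable_funM => //.
  have := (measurable_section_integral (mu n) (fun x => ball x (rad R m)) _
    (measurable_ball_prod (rad R m)) mfc (fun z => f0 _)).
  by move=> h; exact: (measurableT_comp h (measurable_pair2 v)).
- apply: measurable_funTS.
  exact: (measurableT_comp (measurable_maxfun mfc (fun z => f0 _)) (measurable_pair2 v)).
- by move=> b _; exact: (ereal_sup_ubound (ex_intro2 _ _ m I erefl)).
Qed.

(** By [maxfun_cons], the bound on the line is applied in each coordinate in
    turn. On [R^0], a point of mass one, every average is the value of the
    function. *)
Lemma maxfun_strong (p : R) n : 1 < p -> exists2 C : R, 0 < C &
  forall f : 'rV[R]_n -> \bar R, measurable_fun setT f -> (forall x, 0 <= f x)%E ->
  (\int[mu n]_x (maxfun f x `^ p) <= C%:E * \int[mu n]_x (f x `^ p))%E.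
Proof.
move=> p1; elim: n => [|n [C C0 IH]].
  exists 1 => // f mf f0; rewrite mul1e; apply/eq_leW/eq_integral => x _.
  congr (_ `^ _)%E.
  have -> : (maxfun f x = ereal_sup (range (fun m : nat => f (0 : 'rV[R]_0)%R)))%E.
    congr ereal_sup; apply: eq_imagel => m _.
    rewrite expr0 mul1e integral_dirac //; last 2 first.
    - exact: measurable_ball_rV.
    - exact: measurable_funTS.
    rewrite diracE mem_set ?mul1e //.
    by apply/ball_rVP => [|[]//]; exact: rad_gt0.
  have -> : x = 0 by apply/rowP => -[].
  have -> : range (fun m : nat => f 0) = [set f 0].
    by apply/seteqP; split => [_ [m _ <-]//|_ ->]; exists 0%N.
  exact: ereal_sup1.
have [C1 C10 h1] := maxfun1_strong p1.
exists (C1 * C); first exact: mulr_gt0.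
move=> f mf f0.
have mfc : measurable_fun [set: measurableTypeR R * 'rV[R]_n] (f \o @cons_rV R n).
  by apply: measurableT_comp => //; exact: measurable_cons_rV.
have IHa a := IH (fun w => f (cons_rV (a, w)))
  (measurableT_comp mfc (measurable_pair1 a)) (fun w => f0 _).
pose h (z : R * 'rV[R]_n) := maxfun (fun w => f (cons_rV (z.1, w))) z.2.
have mh : measurable_fun [set: measurableTypeR R * 'rV[R]_n] h.
  exact: (measurable_maxfun mfc (fun z => f0 _)).
have h0 z : (0 <= h z)%E by exact: maxfun_ge0.
have mhs v : measurable_fun setT (fun b => h (b, v)).
  exact: (measurableT_comp mh (measurable_pair2 v)).
have mhp : measurable_fun [set: measurableTypeR R * 'rV[R]_n] (fun z => h z `^ p)%E.
  exact: (measurableT_comp (measurable_poweR p)).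
have mhsw : measurable_fun [set: 'rV[R]_n * measurableTypeR R] (fun z => h (z.2, z.1)).
  by apply: (measurableT_comp mh); apply: measurable_fun_pair.
have mM : measurable_fun [set: 'rV[R]_n * measurableTypeR R]
    (fun z => maxfun1 (fun b => h (b, z.1)) z.2).
  exact: (measurable_maxfun1 mhsw).
have hM v a : (0 <= maxfun1 (fun b => h (b, v)) a)%E.
  apply: le_trans (ereal_sup_ubound (ex_intro2 _ _ 0%N I erefl)).
  apply: mule_ge0; last by apply: integral_ge0 => y _.
  by rewrite lee_fin invr_ge0 mulr_ge0 // ltW // rad_gt0.
have mMp : measurable_fun [set: 'rV[R]_n * measurableTypeR R]
    (fun z => maxfun1 (fun b => h (b, z.1)) z.2 `^ p)%E.
  exact: (measurableT_comp (measurable_poweR p)).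
have mfp : measurable_fun setT (fun x => f x `^ p)%E.
  exact: (measurableT_comp (measurable_poweR p)).
have mMf : measurable_fun setT (fun x => maxfun f x `^ p)%E.
  by apply: (measurableT_comp (measurable_poweR p)); exact: measurable_maxfunT.
rewrite integral_rVS_sym //; last by move=> x; exact: poweR_ge0.
apply: (@le_trans _ _ (\int[mu n]_v (C1%:E * \int[leb]_a (h (a, v) `^ p)))%E).
  apply: ge0_le_integral => //.
  - by move=> v _; apply: integral_ge0 => a _; exact: poweR_ge0.
  - apply: (@measurable_fun_fubini_tonelli_G _ _ _ _ R leb
      (fun z => maxfun f (cons_rV z) `^ p)%E); last by move=> z; exact: poweR_ge0.
    by apply: (measurableT_comp mMf); exact: measurable_cons_rV.
  - apply: emeasurable_funM => //.
    apply: (@measurable_fun_fubini_tonelli_G _ _ _ _ R leb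
      (fun z => h z `^ p)%E) => //; by move=> z; exact: poweR_ge0.
  - move=> v _; apply: le_trans (h1 _ (mhs v) (fun b => h0 _)).
    apply: ge0_le_integral => //.
    + by move=> a _; exact: poweR_ge0.
    + apply: (measurableT_comp mMf).
      exact: (measurableT_comp (@measurable_cons_rV R n) (measurable_pair2 v)).
    + exact: (measurableT_comp mMp (measurable_pair1 v)).
    + move=> a _; apply: gt0_ler_poweR.
      * by rewrite ltW // (lt_trans _ p1).
      * by rewrite in_itv /= leey maxfun_ge0.
      * by rewrite in_itv /= leey hM.
      * exact: maxfun_cons.
rewrite ge0_integralZl //; last 3 first.
- apply: (@measurable_fun_fubini_tonelli_G _ _ _ _ R leb
      (fun z => h z `^ p)%E) => //; by move=> z; exact: poweR_ge0.
- by move=> v _; apply: integral_ge0 => a _; exact: poweR_ge0.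
- by rewrite lee_fin ltW.
rewrite EFinM -muleA lee_wpmul2l ?lee_fin ?(ltW C10) //.
have := @fubini_tonelli _ _ _ _ R leb (mu n) (fun z => h z `^ p)%E mhp (fun z => poweR_ge0 _ _).
move=> /= <-.
rewrite integral_rVS //; last by move=> x; exact: poweR_ge0.
rewrite -ge0_integralZl //; last 3 first.
- apply: (@measurable_fun_fubini_tonelli_F _ _ _ _ R (mu n)
      (fun z => f (cons_rV z) `^ p)%E); last by move=> z; exact: poweR_ge0.
  by apply: (measurableT_comp mfp); exact: measurable_cons_rV.
- by move=> v _; apply: integral_ge0 => a _; exact: poweR_ge0.
- by rewrite lee_fin ltW.
apply: ge0_le_integral => //.
- by move=> v _; apply: integral_ge0 => a _; exact: poweR_ge0.
- apply: (@measurable_fun_fubini_tonelli_F _ _ _ _ R (mu n)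
      (fun z => h z `^ p)%E) => //; by move=> z; exact: poweR_ge0.
- apply: emeasurable_funM => //.
  apply: (@measurable_fun_fubini_tonelli_F _ _ _ _ R (mu n)
      (fun z => f (cons_rV z) `^ p)%E); last by move=> z; exact: poweR_ge0.
  by apply: (measurableT_comp mfp); exact: measurable_cons_rV.
- by move=> a _; exact: IHa.
Qed.

End maximal_function_rV.

(** * The Riesz potential and the Hardy-Littlewood-Sobolev inequality *)

Section riesz_potential.
Variables (R : realType) (n : nat).
Local Notation mu := (lebesgue_rV R n).
Implicit Type g : 'rV[R]_n -> R.

(** A dyadic version of the Riesz potential of order one: for [n > 1] its
    kernel is comparable with [`|x - y| ^ (1 - n)]. *)
Definition riesz g (y : 'rV[R]_n) : \bar R :=
  (\sum_(m <oo) ((rad R m `^ (1 - n%:R))%:E * \int[mu]_(x in ball y (rad R m)) (g x)%:E))%E.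

Lemma riesz_ge0 g y : (forall x, 0 <= g x) -> (0 <= riesz g y)%E.
Proof.
move=> g0; apply: nneseries_ge0 => m _ _; rewrite mule_ge0 ?lee_fin ?powR_ge0 //.
by apply: integral_ge0 => x _; rewrite lee_fin.
Qed.

Lemma measurable_riesz g : measurable_fun setT g -> (forall x, 0 <= g x) ->
  measurable_fun setT (riesz g).
Proof.
move=> mg g0; apply: measurable_nneseries => [m|m x]; last first.
  by rewrite mule_ge0 ?lee_fin ?powR_ge0 //; apply: integral_ge0 => y _; rewrite lee_fin.
apply: emeasurable_funM => //.
have mG : measurable_fun [set: unit * 'rV[R]_n] (fun z => (g z.2)%:E).
  by apply/measurable_EFinP; exact: (measurableT_comp mg measurable_snd).
have h := measurable_section_integral mu (fun x => ball x (rad R m)) _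
    (measurable_ball_prod (rad R m)) mG (fun z => _).
have {}h := h (fun z => ltac:(by rewrite /= lee_fin)).
exact: (measurableT_comp h (measurable_pair1 tt)).
Qed.

Lemma ball_hoelder g (p r : R) (y : 'rV[R]_n) : 1 < p -> 0 < r ->
  measurable_fun setT g -> (forall x, 0 <= g x) ->
  (\int[mu]_(x in ball y r) (g x)%:E <=
   (\int[mu]_x (g x `^ p)%:E) `^ p^-1 * (((2 * r) ^+ n) `^ (1 - p^-1))%:E)%E.
Proof.
move=> p1 r0 mg g0; have p0 : 0 < p by lra.
have pV : 0 < 1 - p^-1 by rewrite subr_gt0 invf_lt1.
have mb := measurable_ball_rV y r.
have mi : measurable_fun setT (\1_(ball y r) : 'rV[R]_n -> R) by exact: measurable_indic.
have := hoelder mu mg mi p0 (_ : 0 < (1 - p^-1)^-1) (_ : p^-1 + (1 - p^-1)^-1^-1 = 1).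
rewrite invr_gt0 invrK => /(_ pV) /(_ ltac:(lra)).
rewrite Lnorm1 unlock.
have -> : (\int[mu]_x `|(EFin \o (g \* \1_(ball y r))%R) x| = \int[mu]_(x in ball y r) (g x)%:E)%E.
  rewrite [RHS]integral_mkcond; apply: eq_integral => x _ /=.
  rewrite patchE indicE; case: ifP => _; first by rewrite mulr1 ger0_norm.
  by rewrite mulr0 normr0.
have -> : (\int[mu]_x (`|(EFin \o g) x| `^ p) = \int[mu]_x (g x `^ p)%:E)%E.
  by apply: eq_integral => x _; rewrite /= ger0_norm // poweR_EFin.
have -> : (\int[mu]_x (`|(EFin \o \1_(ball y r)) x| `^ (1 - p^-1)^-1) = mu (ball y r))%E.
  rewrite -[X in mu X]setIT -integral_indic //; apply: eq_integral => x _ /=.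
  rewrite indicE; case: (_ \in _); first by rewrite normr1 powR1.
  by rewrite normr0 powR0 // gt_eqF // invr_gt0.
by rewrite (measure_ball_rV y r0) poweR_EFin invrK mulr_natl.
Qed.

End riesz_potential.

Section hardy_littlewood_sobolev.
Variables (R : realType) (n : nat) (p q : R).
Hypotheses (p1 : 1 < p) (q1 : 1 < q) (n0 : (0 < n)%N) (pq : p^-1 - q^-1 = n%:R^-1).
Local Notation mu := (lebesgue_rV R n).

Let p0 : 0 < p. Proof. exact: lt_trans ltr01 p1. Qed.
Let q0 : 0 < q. Proof. exact: lt_trans ltr01 q1. Qed.
Let nR0 : 0 < n%:R :> R. Proof. by rewrite ltr0n. Qed.
Let pqn : 1 - n%:R / p = - (n%:R / q).
Proof.
have : n%:R * (p^-1 - q^-1) = 1 by rewrite pq mulfV // gt_eqF.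
by rewrite mulrBr => /eqP; rewrite subr_eq => /eqP ->; rewrite opprD addrA subrr add0r.
Qed.

(** Below the radius [d] the averages of [g] are bounded by the maximal
    function, above [d] by the norm of [g] with the inequality of Hoelder;
    each of the two geometric series is comparable with its term at [d]. *)
Lemma riesz_split : exists2 K : R, 0 < K &
  forall (g : 'rV[R]_n -> R) (y : 'rV[R]_n) (nu M d : R),
  measurable_fun setT g -> (forall x, 0 <= g x) ->
  ((\int[mu]_x (g x `^ p)%:E) `^ p^-1 = nu%:E)%E -> maxfun (EFin \o g) y = M%:E ->
  0 < d -> (riesz g y <= (K * (M * d + nu * d `^ (- (n%:R / q))))%:E)%E.
Proof.
have nq0 : - (n%:R / q) != 0 by rewrite oppr_eq0 mulf_neq0 ?invr_eq0 ?gt_eqF.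
have [C1 C10 h1] := @rad_sum R 1 (oner_neq0 _).
have [C2 C20 h2] := rad_sum nq0.
have K0 : 0 < 2 ^+ n * (C1 + C2 + 1) :> R.
  by rewrite mulr_gt0 ?exprn_gt0 // ltr_pwDr // addr_ge0.
exists (2 ^+ n * (C1 + C2 + 1)) => // g y nu M d mg g0 hnu hM d0.
have nu0 : 0 <= nu by rewrite -lee_fin -hnu poweR_ge0.
have M0 : 0 <= M by rewrite -lee_fin -hM; apply: maxfun_ge0 => x; rewrite /= lee_fin.
have B0 m : (0 <= \int[mu]_(x in ball y (rad R m)) (g x)%:E)%E.
  by apply: integral_ge0 => x _; rewrite lee_fin.
apply: nneseries_le => [m|N]; first by rewrite mule_ge0 ?lee_fin ?powR_ge0.
have term m : ((rad R m `^ (1 - n%:R))%:E * \int[mu]_(x in ball y (rad R m)) (g x)%:E <=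
   (2 ^+ n * ((if rad R m `^ 1 <= d then rad R m `^ 1 else 0) * M +
    (if rad R m `^ (- (n%:R / q)) <= d `^ (- (n%:R / q)) then
       rad R m `^ (- (n%:R / q)) else 0) * nu))%:E)%E.
  have r0 := rad_gt0 R m.
  have := integral_ball_le_maxfun (EFin \o g) y m; rewrite hM => hB.
  have hB' := ball_hoelder y p1 r0 mg g0.
  have Bfin : (\int[mu]_(x in ball y (rad R m)) (g x)%:E)%E \is a fin_num.
    by rewrite ge0_fin_numE // (le_lt_trans hB) // ltry.
  move: hB hB' (B0 m); rewrite -(fineK Bfin) hnu; set b := fine _.
  rewrite -!EFinM !lee_fin => hB hB' b0.
  rewrite powRr1 ?(ltW r0) //.
  have e1 : rad R m `^ (1 - n%:R) = rad R m / rad R m ^+ n.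
    by rewrite powRB ?(gt_eqF r0) ?implybT // (powRr1 (ltW r0)) powR_mulrn // ltW.
  have [hr|hr] := leP (rad R m) d.
    apply: (@le_trans _ _ (2 ^+ n * (rad R m * M))); last first.
      rewrite ler_pM2l ?exprn_gt0 // lerDl mulr_ge0 //.
      by case: ifP => // _; exact: powR_ge0.
    rewrite e1; apply: (@le_trans _ _ (rad R m / rad R m ^+ n * ((2 * rad R m) ^+ n * M))).
      by rewrite ler_wpM2l // mulr_ge0 ?invr_ge0 ?exprn_ge0 ?(ltW r0).
    by apply/eq_leW; rewrite exprMn; field; rewrite gt_eqF ?exprn_gt0.
  have -> : rad R m `^ (- (n%:R / q)) <= d `^ (- (n%:R / q)).
    rewrite !powRN lef_pV2 ?posrE ?powR_gt0 //.
    by rewrite ge0_ler_powR ?nnegrE ?(ltW d0) ?(ltW r0) ?(ltW hr) // divr_ge0 ?ltW.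
  rewrite mul0r add0r.
  apply: (@le_trans _ _ (rad R m `^ (1 - n%:R) * (nu * ((2 * rad R m) ^+ n) `^ (1 - p^-1)))).
    by rewrite ler_wpM2l ?powR_ge0.
  rewrite -powR_mulrn ?mulr_ge0 ?(ltW r0) // -powRrM powRM ?(ltW r0) //.
  have -> : rad R m `^ (1 - n%:R) * (nu * (2 `^ (n%:R * (1 - p^-1)) * rad R m `^ (n%:R * (1 - p^-1)))) =
     2 `^ (n%:R * (1 - p^-1)) * (rad R m `^ (1 - n%:R) * rad R m `^ (n%:R * (1 - p^-1)) * nu) by ring.
  rewrite -powRD ?(gt_eqF r0) ?implybT //.
  have -> : 1 - n%:R + n%:R * (1 - p^-1) = - (n%:R / q) by rewrite -pqn; ring.
  rewrite ler_wpM2r ?mulr_ge0 ?powR_ge0 //.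
  rewrite -[2 ^+ n]powR_mulrn // ler_powR ?ler1n // ger_pMr //.
  by rewrite gerBl invr_ge0 ltW.
apply: le_trans; first by apply: lee_sum => m _; exact: term.
rewrite sumEFin lee_fin -mulr_sumr -mulrA ler_pM2l ?exprn_gt0 //.
rewrite big_split /= -!mulr_suml -!big_mkcond /=.
have := h1 d N d0; have := h2 (d `^ (- (n%:R / q))) N (powR_gt0 _ d0).
set S1 := \sum_(m < N | _) _; set S2 := \sum_(m < N | _) _ => hS1 hS2.
have D0 : 0 <= d `^ (- (n%:R / q)) by exact: powR_ge0.
have h3 : S2 * M <= C1 * d * M by rewrite ler_wpM2r.
have h4 : S1 * nu <= C2 * d `^ (- (n%:R / q)) * nu by rewrite ler_wpM2r.
have h5 : 0 <= M * d by rewrite mulr_ge0 // ltW.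
have h6 : 0 <= nu * d `^ (- (n%:R / q)) by rewrite mulr_ge0.
have h7 : 0 <= C2 * (M * d) by rewrite mulr_ge0.
have h8 : 0 <= C1 * (nu * d `^ (- (n%:R / q))) by rewrite mulr_ge0.
apply: le_trans (lerD h3 h4) _; rewrite !mulrDl mul1r !mulrDr.
have -> : C1 * d * M = C1 * (M * d) by ring.
have -> : C2 * d `^ (- (n%:R / q)) * nu = C2 * (nu * d `^ (- (n%:R / q))) by ring.
by move: (M * d) (nu * _) h5 h6 h7 h8 => u v h5 h6 h7 h8; lra.
Qed.

(** Hedberg's pointwise inequality: the two parts of [riesz_split] balance at
    [d = (nu / M) ^ (p / n)]. *)
Lemma hedberg : exists2 K : R, 0 < K &
  forall (g : 'rV[R]_n -> R) (y : 'rV[R]_n) (nu : R),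
  measurable_fun setT g -> (forall x, 0 <= g x) -> 0 < nu ->
  ((\int[mu]_x (g x `^ p)%:E) `^ p^-1 = nu%:E)%E ->
  (riesz g y `^ q <= (K * nu `^ (q - p))%:E * maxfun (EFin \o g) y `^ p)%E.
Proof.
have [K K0 hK] := riesz_split.
exists ((K * 2) `^ q) => [|g y nu mg g0 nu0 hnu]; first by rewrite powR_gt0 // mulr_gt0.
have c0 : 0 < (K * 2) `^ q * nu `^ (q - p) by rewrite mulr_gt0 // powR_gt0 // mulr_gt0.
have J0 := riesz_ge0 y g0.
have := maxfun_ge0 y (fun z => _ : 0 <= (EFin \o g) z)%E.
move=> /(_ ltac:(by move=> z; rewrite /= lee_fin)).
case hM : (maxfun (EFin \o g) y) => [M| |] // M0; last first.
  by rewrite poweRyr ?(gt_eqF p0) // gt0_muley ?lte_fin ?leey.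
move: M0; rewrite lee_fin le_eqVlt => /predU1P[M0|M0].
  have -> : riesz g y = 0%E.
    rewrite /riesz eseries0 // => m _ _.
    suff -> : (\int[mu]_(x in ball y (rad R m)) (g x)%:E = 0)%E by rewrite mule0.
    have := integral_ball_le_maxfun (EFin \o g) y m; rewrite hM -M0 mule0 => h.
    by apply/eqP; rewrite eq_le h /=; apply: integral_ge0 => x _; rewrite lee_fin.
  by rewrite poweR0r ?gt_eqF // mule_ge0 ?poweR_ge0 // lee_fin ltW.
pose d := (nu / M) `^ (p / n%:R).
have d0 : 0 < d by rewrite powR_gt0 // divr_gt0.
have hd := hK _ _ _ _ _ mg g0 hnu hM d0.
have t0 : 0 < nu / M by rewrite divr_gt0.
have pn : p / n%:R = 1 - p / q.
  by rewrite -pq mulrBr mulfV ?(gt_eqF p0).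
have e : nu * d `^ (- (n%:R / q)) = M * d.
  have -> : d `^ (- (n%:R / q)) = (nu / M) `^ (- (p / q)).
    rewrite /d -powRrM; congr (_ `^ _); field.
    by rewrite !gt_eqF.
  rewrite {1}(_ : nu = M * (nu / M) `^ 1); last first.
    by rewrite powRr1 ?(ltW t0) // mulrC mulfVK ?(gt_eqF M0).
  by rewrite -mulrA -powRD ?(gt_eqF t0) ?implybT // /d pn.
have {}hd : (riesz g y <= (K * (M * d * 2))%:E)%E.
  by move: hd; rewrite e -mulr2n mulr_natr.
have Md0 : 0 <= K * (M * d * 2) by rewrite !mulr_ge0 // ltW.
apply: (@le_trans _ _ ((K * (M * d * 2))%:E `^ q)%E).
  by apply: gt0_ler_poweR; rewrite ?(ltW q0) ?in_itv /= ?J0 ?lee_fin ?Md0 ?leey.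
rewrite !poweR_EFin -EFinM lee_fin.
have -> : K * (M * d * 2) = (K * 2) * (M * d) by ring.
have Kn : 0 <= K * 2 by rewrite mulr_ge0 // ltW.
have Mn := ltW M0; have dn := ltW d0; have tn := ltW t0; have nun := ltW nu0.
rewrite (powRM _ Kn (mulr_ge0 Mn dn)) -mulrA; apply/eq_leW; congr (_ * _).
rewrite powRM // /d -powRrM.
have -> : p / n%:R * q = q - p by rewrite pn mulrBl mul1r mulfVK ?(gt_eqF q0).
rewrite -[M^-1]powR_inv1 // powRM ?powR_ge0 // -powRrM mulN1r mulrCA.
by rewrite -powRD ?(gt_eqF M0) ?implybT // opprB addrCA subrr addr0.
Qed.

(** The Hardy-Littlewood-Sobolev inequality: the pointwise bound of [hedberg]
    is integrated and the maximal function is bounded in [L^p]. *)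
Lemma riesz_strong : exists2 K : R, 0 < K &
  forall (g : 'rV[R]_n -> R) (nu : R), measurable_fun setT g -> (forall x, 0 <= g x) ->
  ((\int[mu]_x (g x `^ p)%:E) `^ p^-1 = nu%:E)%E ->
  (\int[mu]_x (riesz g x `^ q) <= (K * nu `^ q)%:E)%E.
Proof.
have [K K0 hK] := hedberg.
have [C C0 hC] := @maxfun_strong R p n p1.
exists (K * C) => [|g nu mg g0 hnu]; first exact: mulr_gt0.
have J0 y := riesz_ge0 y g0.
have mJ := measurable_riesz mg g0.
have meg : measurable_fun setT (EFin \o g) by exact/measurable_EFinP.
have eg0 z : (0 <= (EFin \o g) z)%E by rewrite /= lee_fin.
have : 0 <= nu by rewrite -lee_fin -hnu poweR_ge0.
rewrite le_eqVlt => /predU1P[nu0|nu0].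
  rewrite integral0_eq ?lee_fin ?mulr_ge0 ?powR_ge0 ?ltW // => y _.
  suff -> : riesz g y = 0%E by rewrite poweR0r // gt_eqF.
  rewrite /riesz eseries0 // => m _ _.
  have := ball_hoelder y p1 (rad_gt0 R m) mg g0.
  rewrite hnu -nu0 mul0e => h.
  rewrite (_ : integral _ _ _ = 0%E) ?mule0 //.
  by apply/eqP; rewrite eq_le h /=; apply: integral_ge0 => x _; rewrite lee_fin.
have c0 : 0 <= K * nu `^ (q - p) by rewrite mulr_ge0 ?powR_ge0 // ltW.
have mM := measurable_maxfunT meg eg0.
have mMp : measurable_fun setT (fun x => maxfun (EFin \o g) x `^ p)%E.
  exact: (measurableT_comp (measurable_poweR p)).
apply: (@le_trans _ _ (\int[mu]_x ((K * nu `^ (q - p))%:E * maxfun (EFin \o g) x `^ p))%E).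
  apply: ge0_le_integral => //.
  - by move=> x _; exact: poweR_ge0.
  - exact: (measurableT_comp (measurable_poweR q)).
  - exact: emeasurable_funM.
  - by move=> x _; exact: hK.
rewrite ge0_integralZl //; last by move=> x _; exact: poweR_ge0.
have hN : (\int[mu]_x ((EFin \o g) x `^ p) = (nu `^ p)%:E)%E.
  transitivity (\int[mu]_x (g x `^ p)%:E)%E; first by apply: eq_integral.
  rewrite -poweR_EFin -hnu -poweRrM mulVf ?gt_eqF // poweRe1 //.
  by apply: integral_ge0 => x _; rewrite lee_fin powR_ge0.
apply: (@le_trans _ _ ((K * nu `^ (q - p))%:E * (C%:E * (nu `^ p)%:E))%E).
  by rewrite lee_wpmul2l ?lee_fin // -hN; exact: hC.
rewrite -!EFinM lee_fin; apply/eq_leW.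
have -> : nu `^ q = nu `^ (q - p) * nu `^ p by rewrite -powRD ?subrK ?(gt_eqF nu0) ?implybT.
by ring.
Qed.

End hardy_littlewood_sobolev.

(** * Smooth functions on the line *)

Section smooth_functions_line.
Variable R : realType.
Implicit Types f g h : R -> R.

Fixpoint C1k (m : nat) f : Prop :=
  match m with
  | 0%N => continuous f
  | m'.+1 => (forall x : R, derivable f x (1 : R)) /\ C1k m' (derive1 f)
  end.

Lemma derive1_val f f' : (forall x : R, is_derive x (1 : R) f (f' x)) -> (derive1 f) = f'.
Proof. by move=> h; apply/funext => x; rewrite derive1E; exact: derive_val. Qed.

Lemma C1kS m f f' : (forall x : R, is_derive x (1 : R) f (f' x)) -> C1k m f' -> C1k m.+1 f.
Proof.
by move=> h hf'; split; [move=> x; have [] := h x|rewrite (derive1_val h)].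
Qed.

Lemma C1k_is_derive m f : C1k m.+1 f -> forall x : R, is_derive x (1 : R) f ((derive1 f) x).
Proof. by move=> [h _] x; rewrite derive1E; exact: derivableP. Qed.

Lemma C1k_continuous m f : C1k m f -> continuous f.
Proof.
case: m => [//|m [h _]] x.
exact/differentiable_continuous/derivable1_diffP.
Qed.

Lemma C1kW m f : C1k m.+1 f -> C1k m f.
Proof.
elim: m f => [f /C1k_continuous//|m IH f [h1 h2]]; split => //.
exact: IH.
Qed.

Lemma C1k_cst m (c : R) : C1k m (cst c).
Proof.
elim: m c => [c|m IH c]; first exact: cst_continuous.
exact: (C1kS (f' := cst 0)).
Qed.

Lemma C1kD m f g : C1k m f -> C1k m g -> C1k m (fun x => f x + g x).
Proof.
elim: m f g => [f g cf cg x|m IH f g hf hg]; first by apply: continuousD; [exact: cf|exact: cg].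
have hf' := C1k_is_derive hf; have hg' := C1k_is_derive hg.
apply: (C1kS (f' := fun x => (derive1 f) x + (derive1 g) x)).
by apply: IH; [case: hf|case: hg].
Qed.

Lemma C1kM m f g : C1k m f -> C1k m g -> C1k m (fun x => f x * g x).
Proof.
elim: m f g => [f g cf cg x|m IH f g hf hg]; first by apply: continuousM; [exact: cf|exact: cg].
have hf' := C1k_is_derive hf; have hg' := C1k_is_derive hg.
apply: (C1kS (f' := fun x => f x * (derive1 g) x + g x * (derive1 f) x)).
by apply: C1kD; apply: IH; [exact: C1kW|case: hg|exact: C1kW|case: hf].
Qed.

Lemma C1kV m f : (forall x, f x != 0) -> C1k m f -> C1k m (fun x => (f x)^-1).
Proof.
move=> f0; elim: m f f0 => [f f0 cf x|m IH f f0 hf].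
  by apply: continuousV; [exact: f0|exact: cf].
have hf' := C1k_is_derive hf.
apply: (C1kS (f' := fun x => (-1) * (f x)^-1 * (f x)^-1 * (derive1 f) x)).
  move=> x; apply: is_derive_eq (is_deriveV (f0 x) (hf' x)) _.
  by rewrite /GRing.scale /= expr2 invfM !mulNr mul1r.
apply: C1kM; last by case: hf.
by apply: C1kM; [apply: C1kM; [exact: C1k_cst|]|]; apply: IH => //; exact: C1kW.
Qed.

Lemma is_derive_affine (a b x : R) : is_derive x (1 : R) (fun x => a * x + b) a.
Proof.
apply: is_derive_eq (is_deriveD (is_deriveZ a (is_derive_id x 1)) (is_derive_cst b x 1)) _.
by rewrite addr0 /GRing.scale /= mulr1.
Qed.

Lemma C1k_affine m f (a b : R) : C1k m f -> C1k m (fun x => f (a * x + b)).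
Proof.
have ha := is_derive_affine a b.
have ca : continuous (fun x => a * x + b).
  by move=> x; apply/differentiable_continuous/derivable1_diffP; case: (ha x).
elim: m f => [f cf x|m IH f hf].
  by apply: continuous_comp; [exact: ca|exact: cf].
have hf' := C1k_is_derive hf.
apply: (C1kS (f' := fun x => (derive1 f) (a * x + b) * a)).
by apply: C1kM; [apply: IH; case: hf|exact: C1k_cst].
Qed.

(** The factor [h] vanishes near the singularity of the power at zero. *)
Lemma is_derive_cut_powR (a : R) h (b x : R) : 0 < a -> C1k 1 h ->
  (forall t, t < a -> h t = 0) ->
  is_derive x (1 : R) (fun t => h t * t `^ b)
    (derive1 h x * x `^ b + (b * h x) * x `^ (b - 1)).
Proof.
move=> a0 h1 h0; have hh' := C1k_is_derive h1.
have [xa|ax] := ltP x a.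
  have nh : \forall u \near x, cst 0 u = h u.
    by near=> u; rewrite h0 //; near: u; exact: lt_nbhsl.
  have -> : derive1 h x = 0.
    by rewrite derive1E -(near_eq_derive _ nh) derive_cst.
  rewrite h0 // mulr0 !mul0r addr0.
  apply: (near_eq_is_derive (f := cst 0)).
    near=> u; rewrite h0 ?mul0r //; near: u; exact: lt_nbhsl.
have x0 : 0 < x by exact: lt_le_trans ax.
apply: is_derive_eq (is_deriveM (hh' x) (is_derive1_powR b x0)) _.
by rewrite /GRing.scale /=; ring.
Unshelve. all: by end_near.
Qed.

Lemma C1k_cut_powR m (a : R) h (b : R) : 0 < a -> (forall k, C1k k h) ->
  (forall t, t < a -> h t = 0) -> C1k m (fun t => h t * t `^ b).
Proof.
move=> a0; elim: m h b => [|m IH] h b sh h0.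
  move=> x; apply/differentiable_continuous/derivable1_diffP.
  by case: (is_derive_cut_powR b x a0 (sh 1%N) h0).
apply: (C1kS (f' := fun t => derive1 h t * t `^ b + (b * h t) * t `^ (b - 1))).
  by move=> x; exact: is_derive_cut_powR (sh 1%N) h0.
have h'0 t : t < a -> derive1 h t = 0.
  move=> ta; have nh : \forall u \near t, cst 0 u = h u.
    by near=> u; rewrite h0 //; near: u; exact: lt_nbhsl.
  by rewrite derive1E -(near_eq_derive _ nh) derive_cst.
apply: C1kD; first by apply: IH => // k; have [] := sh k.+1.
apply: (IH (fun t => b * h t)) => [k|t ta]; first by apply: C1kM => //; exact: C1k_cst.
by rewrite h0 // mulr0.
Unshelve. all: by end_near.
Qed.

(** The functions [p(1/t) exp(-1/t)] for [t > 0], extended by zero, form a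
    class that is stable under differentiation. *)
Definition flat (p : {poly R}) (t : R) : R := if 0 < t then p.[t^-1] * expR (- t^-1) else 0.

(** The exponential of [u = 1 / t] dominates [u ^ (d + 2) / (d + 2)!], where
    [d] exceeds the degree of [p]. *)
Lemma flat_bound p : exists2 C : R, 0 <= C & forall t, 0 < t <= 1 -> `|flat p t| <= C * t ^+ 2.
Proof.
pose d := size p.
have hp (u : R) : 1 <= u -> `|p.[u]| <= (\sum_(i < d) `|p`_i|) * u ^+ d.
  move=> u1; have u0 : 0 <= u by exact: le_trans u1.
  rewrite horner_coef mulr_suml (le_trans (ler_norm_sum _ _ _)) //.
  apply: ler_sum => i _; rewrite normrM ler_wpM2l // normrX ger0_norm //.
  by rewrite ler_weXn2l // ltnW.
exists ((\sum_(i < d) `|p`_i|) * (d.+2)`!%:R) => [|t /andP[t0 t1]].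
  by rewrite mulr_ge0 // sumr_ge0.
have u1 : 1 <= t^-1 by rewrite invf_ge1.
have u0 : 0 < t^-1 by rewrite invr_gt0.
rewrite /flat t0 normrM [`|expR _|]ger0_norm ?expR_ge0 // expRN.
have h1 := hp _ u1.
have h2 : (expR t^-1)^-1 <= (d.+2)`!%:R / t^-1 ^+ d.+2.
  have := expR_ge1Dxn d.+1 (ltW u0).
  set F := (d.+2)`!%:R; have F0 : 0 < F by rewrite ltr0n fact_gt0.
  have X0 : 0 < t^-1 ^+ d.+2 by rewrite exprn_gt0.
  move=> h; rewrite -[_ / _]invrK lef_pV2 ?posrE ?invr_gt0 ?expR_gt0 ?divr_gt0 //.
  by rewrite invf_div (le_trans _ h) // lerDr.
apply: le_trans (ler_pM _ _ h1 h2) _; rewrite ?invr_ge0 ?expR_ge0 //.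
apply/eq_leW; have -> : (d.+2 = d + 2)%N by rewrite addn2.
rewrite exprD !exprVn.
by field; rewrite ?gt_eqF ?exprn_gt0.
Qed.

Lemma is_derive0_quadratic f (C : R) : 0 <= C -> (forall t, `|t| <= 1 -> `|f t| <= C * t ^+ 2) ->
  is_derive (0 : R) (1 : R) f 0.
Proof.
move=> C0 hf.
have f0 : f 0 = 0.
  by apply/normr0_eq0/eqP; rewrite eq_le normr_ge0 andbT (le_trans (hf _ _)) ?normr0 // expr2 !mulr0.
have cv : h^-1 *: ((f \o shift 0) (h *: (1 : R)) - f 0) @[h --> (0 : R)^'] --> (0 : R).
  apply/cvgr0Pnorm_le => e e0; near=> h.
  have h0 : h != 0 by near: h; exact: nbhs_dnbhs_neq.
  rewrite /= f0 subr0 addr0 /GRing.scale /= mulr1 normrM normfV.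
  rewrite ler_pdivrMl ?normr_gt0 //.
  have h1 : `|h| <= 1 by near: h; apply: dnbhs0_le.
  have h2 : `|h| <= e / (C + 1).
    by near: h; apply: dnbhs0_le; rewrite divr_gt0 // ltr_pwDr.
  apply: le_trans (hf _ h1) _; rewrite -real_normK ?num_real // expr2 mulrA mulrC ler_wpM2l //.
  rewrite (le_trans (ler_wpM2l C0 h2)) // mulrCA ger_pMr // ler_pdivrMr ?ltr_pwDr //.
  by rewrite mul1r lerDl.
apply: DeriveDef; first by apply/cvg_ex; exists 0.
exact: cvg_lim.
Unshelve. all: by end_near.
Qed.

Lemma is_derive_flat p t : is_derive (t : R) (1 : R) (flat p) (flat ('X^2 * (p - deriv p)) t).
Proof.
have [t0|t0|->] := ltgtP t 0.
- rewrite {2}/flat ltNge ltW //=.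
  apply: (near_eq_is_derive (f := cst 0)).
  by near=> u; rewrite /flat ltNge ltW //; near: u; exact: lt_nbhsl.
- apply: (near_eq_is_derive (f := (fun u => p.[u^-1] * expR (- u^-1)) : R -> R)).
    by near=> u; rewrite /flat ifT //; near: u; exact: lt_nbhsr.
  have tn0 : t != 0 by rewrite gt_eqF.
  have hV : is_derive t (1 : R) (fun u : R => u^-1) (- t^-1 ^+ 2).
    apply: is_derive_eq (is_deriveV tn0 (is_derive_id t (1 : R))) _.
    by rewrite /GRing.scale /= mulr1 exprVn.
  have hN : is_derive t (1 : R) (fun u : R => - u^-1) (t^-1 ^+ 2).
    by apply: is_derive_eq (is_deriveN hV) _; rewrite opprK.
  have hE := is_derive1_comp (is_derive_expR _) hN.
  have hP := is_derive1_comp (is_derive_poly p _) hV.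
  apply: is_derive_eq (is_deriveM hP hE) _.
  rewrite /flat t0 /GRing.scale /= hornerM hornerXn hornerD hornerN.
  by ring.
- have [C C0 hC] := flat_bound p.
  rewrite {2}/flat ltxx; apply: (is_derive0_quadratic C0) => u u1.
  have [u0|u0] := ltP 0 u; first by apply: hC; rewrite u0 (le_trans (ler_norm _)).
  by rewrite /flat ltNge u0 /= normr0 mulr_ge0 // sqr_ge0.
Unshelve. all: by end_near.
Qed.

Lemma C1k_flat m p : C1k m (flat p).
Proof.
elim: m p => [|m IH] p.
  move=> x; apply/differentiable_continuous/derivable1_diffP.
  by case: (is_derive_flat p x).
by apply: C1kS (IH _) => x; exact: is_derive_flat.
Qed.

(** A smooth transition from 0 on [t <= 1] to 1 on [2 <= t]. *)
Definition step (t : R) : R :=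
  flat 1 (1 * t + -1) / (flat 1 (1 * t + -1) + flat 1 (-1 * t + 2)).

Lemma flat1_ge0 t : 0 <= flat 1 t.
Proof. by rewrite /flat; case: ifP => // _; rewrite hornerE mul1r expR_ge0. Qed.

Lemma flat1_gt0 t : 0 < t -> 0 < flat 1 t.
Proof. by move=> t0; rewrite /flat t0 hornerE mul1r expR_gt0. Qed.

Lemma flat1_eq0 t : t <= 0 -> flat 1 t = 0.
Proof. by rewrite /flat leNgt => /negbTE ->. Qed.

Lemma step_den_gt0 t : 0 < flat 1 (1 * t + -1) + flat 1 (-1 * t + 2).
Proof.
have [h|h] := ltP 1 t.
  by rewrite ltr_pwDl ?flat1_ge0 // flat1_gt0 //; lra.
by rewrite ltr_pwDr ?flat1_ge0 // flat1_gt0 //; lra.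
Qed.

Lemma step_ge0 t : 0 <= step t.
Proof. by rewrite divr_ge0 ?flat1_ge0 // ltW // step_den_gt0. Qed.

Lemma step_le1 t : step t <= 1.
Proof. by rewrite /step ler_pdivrMr ?step_den_gt0 // [leRHS]mul1r lerDl flat1_ge0. Qed.

Lemma step_eq0 t : t <= 1 -> step t = 0.
Proof. by move=> t1; rewrite /step flat1_eq0 ?mul0r //; lra. Qed.

Lemma step_eq1 t : 2 <= t -> step t = 1.
Proof.
move=> t2; rewrite /step [flat 1 (-1 * t + 2)]flat1_eq0 ?addr0; last by lra.
by rewrite divff // gt_eqF // flat1_gt0 //; lra.
Qed.

Lemma C1k_step m : C1k m step.
Proof.
have hA := C1k_affine 1 (-1) (C1k_flat m 1).
have hB := C1k_affine (-1) 2 (C1k_flat m 1).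
apply: C1kM => //; apply: C1kV; last exact: C1kD.
by move=> x; rewrite gt_eqF // step_den_gt0.
Qed.

Definition bump : R -> R := derive1 step.

Lemma is_derive_step (t : R) : is_derive t (1 : R) step (bump t).
Proof. exact: (C1k_is_derive (C1k_step 1)). Qed.

(** The sign and the zeros of the derivative of [step] can be read off this
    form. *)
Lemma bumpE t : bump t =
  (flat 'X^2 (1 * t + -1) * flat 1 (-1 * t + 2) + flat 1 (1 * t + -1) * flat 'X^2 (-1 * t + 2)) /
  (flat 1 (1 * t + -1) + flat 1 (-1 * t + 2)) ^+ 2.
Proof.
have ha (a b : R) := is_derive_affine a b t.
have X1 : 'X^2 * (1 - (1 : {poly R})^`()) = 'X^2 by rewrite derivC subr0 mulr1.
have hA := is_derive1_comp (is_derive_flat 1 _) (ha 1 (-1)).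
have hB := is_derive1_comp (is_derive_flat 1 _) (ha (-1) 2).
rewrite X1 in hA hB.
have d0 : ((flat 1 \o (fun x => 1 * x + -1)) + (flat 1 \o (fun x => -1 * x + 2))) t != 0.
  by rewrite gt_eqF //; exact: step_den_gt0.
have := is_deriveM hA (is_deriveV d0 (is_deriveD hA hB)).
rewrite /bump derive1E => h.
transitivity ('D_1 ((flat 1 \o (fun x => 1 * x + -1)) *
  (fun y => (((flat 1 \o (fun x => 1 * x + -1)) + (flat 1 \o (fun x => -1 * x + 2))) y)^-1)) t).
  by [].
have -> := @derive_val _ _ _ _ _ _ _ h.
rewrite /GRing.scale /= !fctE /=.
have D0 := step_den_gt0 t.
move: (flat 1 (1 * t + -1)) (flat 1 (-1 * t + 2)) (flat 'X^2 _) (flat 'X^2 _) D0 => A B A' B' D0.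
by field; rewrite gt_eqF.
Qed.

Lemma bump_ge0 t : 0 <= bump t.
Proof.
have h p : 0 <= flat 'X^2 p.
  by rewrite /flat; case: ifP => // h; rewrite hornerXn mulr_ge0 ?expR_ge0 // exprn_ge0 // invr_ge0 ltW.
by rewrite bumpE divr_ge0 ?sqr_ge0 // addr_ge0 // mulr_ge0 // ?flat1_ge0.
Qed.

Lemma bump_gt0 : 0 < bump (3 / 2).
Proof.
have h p : 0 < p -> 0 < flat 'X^2 p.
  by move=> h; rewrite /flat h hornerXn mulr_gt0 ?expR_gt0 // exprn_gt0 // invr_gt0.
rewrite bumpE divr_gt0 ?exprn_gt0 ?step_den_gt0 // addr_gt0 // mulr_gt0 //;
 rewrite ?flat1_gt0 ?h //; lra.
Qed.

Lemma bump_eq0 t : t < 1 \/ 2 < t -> bump t = 0.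
Proof.
have h p : p <= 0 -> flat 'X^2 p = 0 by rewrite /flat leNgt => /negbTE ->.
move=> [t1|t2]; rewrite bumpE.
  by rewrite h ?[flat 1 (1 * t + -1)]flat1_eq0 ?mul0r ?addr0 ?mul0r //; lra.
by rewrite [flat 1 (-1 * t + 2)]flat1_eq0 ?[flat 'X^2 (-1 * t + 2)]h ?mulr0 ?addr0 ?mul0r //; lra.
Qed.

Lemma continuous_bump : continuous bump.
Proof. by have [] := C1k_step 1. Qed.

Lemma bump_bounded : exists2 M : R, 0 <= M & forall t, bump t <= M.
Proof.
have [c _ hc] : exists2 c, c \in `[1, 2]%classic & forall t : R, t \in `[1, 2]%classic -> bump t <= bump c.
  apply: compact_EVT_max; first by exists 1; rewrite /= in_itv /= lexx ler1n.
    exact: segment_compact.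
  exact/continuous_subspaceT/continuous_bump.
exists (bump c) => [|t]; first exact: bump_ge0.
have [ht|ht] := boolP (t \in `[1, 2]%classic); first exact: hc.
rewrite bump_eq0 ?bump_ge0 //; apply: contrapT => hn; move: ht; rewrite notin_setE; apply.
by rewrite /= in_itv /= !leNgt; apply/andP; split; apply/negP => h'; apply: hn; [left|right].
Qed.

End smooth_functions_line.

(** * Smooth functions of several variables *)

Section smooth_functions_rV.
Variables (R : realType) (n : nat).
Implicit Types f g : 'rV[R]_n -> R.
Local Notation e_ i := (delta_mx 0 i : 'rV[R]_n).

Lemma CkS m f (f' : 'I_n -> 'rV[R]_n -> R) : continuous f ->
  (forall i x, is_derive x (e_ i) f (f' i x)) -> (forall i, Ck m (f' i)) -> Ck m.+1 f.
Proof.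
move=> cf h hf'; split => // i; split; first by move=> x; have [] := h i x.
rewrite (_ : partial i f = f' i) //.
by apply/funext => x; exact: derive_val.
Qed.

Lemma Ck_is_derive m f i x : Ck m.+1 f -> is_derive x (e_ i) f (partial i f x).
Proof. by move=> [_ /(_ i)[h _]]; exact: derivableP. Qed.

Lemma Ck_continuous m f : Ck m f -> continuous f.
Proof. by case: m => [|m] // []. Qed.

Lemma CkW m f : Ck m.+1 f -> Ck m f.
Proof.
elim: m f => [f /Ck_continuous//|m IH f [h1 h2]]; split => // i.
by have [h3 h4] := h2 i; split => //; exact: IH.
Qed.

Lemma Ck_cst m (c : R) : Ck m (cst c : 'rV[R]_n -> R).
Proof.
elim: m c => [c|m IH c]; first exact: cst_continuous.
apply: (CkS (f' := fun _ => cst 0)) => //; exact: cst_continuous.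
Qed.

(** Carries the rules of calculus on the line, such as the chain rule, over to
    partial derivatives. *)
Lemma is_derive_line f (x v : 'rV[R]_n) (b : R) :
  is_derive (0 : R) (1 : R) (fun h : R => f (h *: v + x)) b <-> is_derive x v f b.
Proof.
have e : (fun h : R => h^-1 *: ((f \o shift x) (h *: v) - f x)) =
  (fun h : R => h^-1 *: (((fun h : R => f (h *: v + x)) \o shift 0) (h *: (1 : R)) -
                         f ((0 : R) *: v + x))).
  by apply/funext => h; rewrite /= scale0r add0r addr0 /GRing.scale /= mulr1.
by split=> -[h1 h2]; split; rewrite /derivable /derive ?e // -e.
Qed.

Lemma is_derive_coord (i j : 'I_n) (x : 'rV[R]_n) :
  is_derive x (e_ i) (fun x => x 0 j) (i == j)%:R.
Proof.
apply/is_derive_line.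
rewrite (_ : (fun _ => _) = (fun h : R => (i == j)%:R * h + x 0 j)).
  exact: is_derive_affine.
by apply/funext => h; rewrite !mxE eqxx eq_sym mulrC.
Qed.

Lemma Ck_coord m j : Ck m (fun x : 'rV[R]_n => x 0 j).
Proof.
case: m => [|m]; first exact: coord_continuous.
apply: (CkS (f' := fun i => cst (i == j)%:R)).
- exact: coord_continuous.
- by move=> i x; exact: is_derive_coord.
- by move=> i; exact: Ck_cst.
Qed.

Lemma CkD m f g : Ck m f -> Ck m g -> Ck m (fun x => f x + g x).
Proof.
elim: m f g => [f g cf cg x|m IH f g hf hg]; first by apply: continuousD; [exact: cf|exact: cg].
apply: (CkS (f' := fun i x => partial i f x + partial i g x)).
- by move=> x; apply: continuousD; [exact: (Ck_continuous hf)|exact: (Ck_continuous hg)].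
- by move=> i x; exact: (is_deriveD (Ck_is_derive i x hf) (Ck_is_derive i x hg)).
- by move=> i; apply: IH; [case: hf|case: hg] => _ /(_ i)[].
Qed.

Lemma CkM m f g : Ck m f -> Ck m g -> Ck m (fun x => f x * g x).
Proof.
elim: m f g => [f g cf cg x|m IH f g hf hg]; first by apply: continuousM; [exact: cf|exact: cg].
apply: (CkS (f' := fun i x => f x * partial i g x + g x * partial i f x)).
- by move=> x; apply: continuousM; [exact: (Ck_continuous hf)|exact: (Ck_continuous hg)].
- by move=> i x; exact: (is_deriveM (Ck_is_derive i x hf) (Ck_is_derive i x hg)).
- move=> i; apply: CkD; apply: IH; try exact: CkW.
    by case: hg => _ /(_ i)[].
  by case: hf => _ /(_ i)[].
Qed.

Lemma is_derive_comp_line (G : R -> R) f (x v : 'rV[R]_n) (a b : R) :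
  is_derive (f x) (1 : R) G a -> is_derive x v f b -> is_derive x v (G \o f) (a * b).
Proof.
move=> hG /is_derive_line hf; apply/is_derive_line.
have hG' : is_derive (f ((0 : R) *: v + x)) (1 : R) G a by rewrite scale0r add0r.
exact: (is_derive1_comp hG' hf).
Qed.

Lemma Ck_comp m (G : R -> R) f : C1k m G -> Ck m f -> Ck m (fun x => G (f x)).
Proof.
elim: m G f => [G f cG cf x|m IH G f hG hf].
  by apply: continuous_comp; [exact: cf|exact: cG].
apply: (CkS (f' := fun i x => derive1 G (f x) * partial i f x)).
- move=> x; apply: continuous_comp; first exact: (Ck_continuous hf).
  exact: (C1k_continuous hG).
- move=> i x; apply: is_derive_comp_line (C1k_is_derive hG _) _.
  exact: Ck_is_derive hf.
- move=> i; apply: CkM; last by case: hf => _ /(_ i)[].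
  by apply: IH; [case: hG|exact: CkW].
Qed.

Lemma Ck_sum m (I : Type) (r : seq I) (F : I -> 'rV[R]_n -> R) :
  (forall i, Ck m (F i)) -> Ck m (fun x => \sum_(i <- r) F i x).
Proof.
move=> hF; elim: r => [|i r IH].
  rewrite (_ : (fun _ => _) = cst 0); first exact: Ck_cst.
  by apply/funext => x; rewrite big_nil.
rewrite (_ : (fun _ => _) = fun x => F i x + \sum_(i <- r) F i x); first exact: CkD.
by apply/funext => x; rewrite big_cons.
Qed.

End smooth_functions_rV.

(** * Radial vector fields *)

Section radial_fields.
Variables (R : realType) (n : nat).
Local Notation e_ i := (delta_mx 0 i : 'rV[R]_n).

Definition sqnorm (x : 'rV[R]_n) : R := \sum_i (x 0 i) ^+ 2.

(** The profile [G] is a function of the squared norm, so that the field is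
    smooth at its centre [y] as well. *)
Definition radial (G : R -> R) (y : 'rV[R]_n) (i : 'I_n) (x : 'rV[R]_n) : R :=
  (x 0 i - y 0 i) * G (sqnorm (x - y)).

Lemma Ck_sqnorm m (y : 'rV[R]_n) : Ck m (fun x => sqnorm (x - y)).
Proof.
apply: Ck_sum => i.
rewrite (_ : (fun _ => _) = fun x : 'rV[R]_n => (x 0 i + cst (- y 0 i) x) * (x 0 i + cst (- y 0 i) x)).
  by apply: CkM; apply: CkD; [exact: Ck_coord|exact: Ck_cst|exact: Ck_coord|exact: Ck_cst].
by apply/funext => x; rewrite !mxE expr2.
Qed.

Lemma is_derive_sqnorm (y : 'rV[R]_n) (j : 'I_n) (x : 'rV[R]_n) :
  is_derive x (e_ j) (fun x => sqnorm (x - y)) (2 * (x 0 j - y 0 j)).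
Proof.
have h i : is_derive x (e_ j) (fun x => (x 0 i + cst (- y 0 i) x) ^+ 2)
    (if i == j then 2 * (x 0 j - y 0 j) else 0).
  apply: is_derive_eq (is_deriveX 2 (is_deriveD (is_derive_coord j i x) (is_derive_cst (- y 0 i) _ _))) _.
  rewrite addr0 /GRing.scale /= expr1 eq_sym; case: eqP => [->|_]; rewrite ?mulr1 ?mulr0 //.
have := is_derive_sum h.
rewrite -big_mkcond big_pred1_eq.
rewrite (_ : \sum_(i < n) _ = fun x => sqnorm (x - y)) //.
apply/funext => z; rewrite fct_sumE; apply: eq_bigr => i _.
by rewrite !fctE !mxE.
Qed.

Lemma is_derive_radial (G : R -> R) y i j x : C1k 1 G ->
  is_derive x (e_ j) (radial G y i)
  ((i == j)%:R * G (sqnorm (x - y)) +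
  2 * (x 0 i - y 0 i) * (x 0 j - y 0 j) * derive1 G (sqnorm (x - y))).
Proof.
move=> hG.
have h1 := is_derive_comp_line (C1k_is_derive hG _) (is_derive_sqnorm y j x).
have h2 := is_deriveD (is_derive_coord j i x) (is_derive_cst (- y 0 i) x (e_ j)).
apply: is_derive_eq (is_deriveM h2 h1) _.
by rewrite !fctE /GRing.scale /= eq_sym; ring.
Qed.

Lemma sqnorm_ge (x : 'rV[R]_n) i : `|x 0 i| ^+ 2 <= sqnorm x.
Proof.
rewrite real_normK ?num_real // /sqnorm (bigD1 i) //= lerDl.
by apply: sumr_ge0 => j _; exact: sqr_ge0.
Qed.

Lemma sqnorm_lt_ball (x y : 'rV[R]_n) (t : R) : 0 < t ->
  sqnorm (x - y) < t ^+ 2 -> ball y t x.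
Proof.
move=> t0 h; apply/ball_rVP => // i.
have := le_lt_trans (sqnorm_ge (x - y) i) h; rewrite !mxE distrC => h1.
by rewrite -(ltr_pXn2r (n := 2)) ?nnegrE ?(ltW t0).
Qed.

Lemma test_function_radial (G : R -> R) (rho : R) y i : (forall m, C1k m G) ->
  (forall s, rho < s -> G s = 0) -> test_function (radial G y i).
Proof.
move=> hG G0; split.
  move=> m; apply: CkM; last by apply: Ck_comp => //; exact: Ck_sqnorm.
  by apply: (@CkD _ _ _ _ (cst (- y 0 i))); [exact: Ck_coord|exact: Ck_cst].
pose B : set 'rV[R]_n := [set v | forall k, `[y 0 k - (`|rho| + 1), y 0 k + (`|rho| + 1)]%classic (v 0 k)].
have cB : compact B.
  apply: (@rV_compact _ n (fun k => `[y 0 k - (`|rho| + 1), y 0 k + (`|rho| + 1)]%classic)) => k.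
  exact: segment_compact.
have clB : closed B by apply: compact_closed => //; exact: norm_hausdorff.
apply: (subclosed_compact _ cB); first exact: closed_closure.
rewrite [X in _ `<=` X]((closure_id B).1 clB); apply: closure_subset => x /= hx k.
have hs : sqnorm (x - y) <= rho.
  by rewrite leNgt; apply/negP => /G0 h; move: hx; rewrite /radial h mulr0 eqxx.
have := le_trans (sqnorm_ge (x - y) k) hs; rewrite !mxE => h.
have h1 : `|x 0 k - y 0 k| <= `|rho| + 1.
  have h2 := ler_norm rho; have h3 : 0 <= `|rho| by [].
  have h4 : 0 <= `|x 0 k - y 0 k| by [].
  by move: h3 h4 h2 h; move: `|rho| `|x 0 k - y 0 k| => u v *; nra.
move: h1; rewrite ler_distl => /andP[h1 h2].
by rewrite /= in_itv /= h1 h2.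
Qed.

End radial_fields.

(** * The truncated Newton field and its divergence *)

Section newton_kernel.
Variables (R : realType) (n : nat).
Hypothesis n0 : (0 < n)%N.
Local Notation mu := (lebesgue_rV R n).

(** [radial (newton e r)] is a smooth truncation, to the shell
    [e ^ 2 <= |x| ^ 2 <= 2 * r ^ 2], of the gradient [x / |x| ^ n] of the
    Newton potential; it is the full gradient for
    [2 * e ^ 2 <= |x| ^ 2 <= r ^ 2]. *)
Definition newton (e r s : R) : R :=
  (step (e ^- 2 * s + 0) - step (r ^- 2 * s + 0)) * s `^ (- n%:R / 2).

(** The profile of an approximate identity at the scale [e], up to its total
    mass. Its form is the one that [newton_div] produces. *)
Definition molli (e s : R) : R :=
  2 * ((e ^- 2 * s) * bump (e ^- 2 * s + 0)) * s `^ (- n%:R / 2).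

Let dstep (e r s : R) : is_derive s (1 : R)
  (fun s => step (e ^- 2 * s + 0) - step (r ^- 2 * s + 0))
  (bump (e ^- 2 * s + 0) * e ^- 2 - bump (r ^- 2 * s + 0) * r ^- 2).
Proof.
have ha (a b : R) := is_derive_affine a b s.
exact: (is_deriveB (is_derive1_comp (is_derive_step _) (ha (e ^- 2) 0))
                   (is_derive1_comp (is_derive_step _) (ha (r ^- 2) 0))).
Qed.

Let Cstep (e r : R) m : C1k m (fun s => step (e ^- 2 * s + 0) - step (r ^- 2 * s + 0)).
Proof.
apply: (@C1kD R m (fun s => step (e ^- 2 * s + 0)) (fun s => - step (r ^- 2 * s + 0))).
  by apply: C1k_affine; exact: C1k_step.
rewrite (_ : (fun _ => _) = fun s => cst (-1) s * step (r ^- 2 * s + 0)).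
  by apply: C1kM; [exact: C1k_cst|apply: C1k_affine; exact: C1k_step].
by apply/funext => s; rewrite mulN1r.
Qed.

Let step0 (e r s : R) : 0 < e <= r -> s < e ^+ 2 ->
  step (e ^- 2 * s + 0) - step (r ^- 2 * s + 0) = 0.
Proof.
move=> /andP[e0 er] se; have r0 := lt_le_trans e0 er.
rewrite !step_eq0 ?subrr // addr0 mulrC ler_pdivrMr ?exprn_gt0 // mul1r.
  by rewrite (le_trans (ltW se)) // ler_sqr ?nnegrE ?(ltW e0) ?(ltW r0).
exact: ltW.
Qed.

Lemma C1k_newton (e r : R) m : 0 < e <= r -> C1k m (newton e r).
Proof.
move=> er; have /andP[e0 _] := er.
apply: (@C1k_cut_powR _ _ (e ^+ 2)); first by rewrite exprn_gt0.
- by move=> k; exact: Cstep.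
- by move=> t; exact: step0.
Qed.

(** The field [x / |x| ^ n] has no divergence away from zero, so only the
    derivatives of the two cut-off factors contribute. *)
Lemma newton_div (e r s : R) : 0 < e <= r -> 0 <= s ->
  n%:R * newton e r s + 2 * s * derive1 (newton e r) s = molli e s - molli r s.
Proof.
move=> er s0; have /andP[e0 _] := er.
have := is_derive_cut_powR (- n%:R / 2) s (exprn_gt0 2 e0) (Cstep e r 1) (fun t => step0 er).
rewrite derive1E => h; rewrite [derive1 _ _]derive1E.
have -> := @derive_val _ _ _ _ _ _ _ h.
have -> := @derive_val _ _ _ _ _ _ _ (dstep e r s).
rewrite /newton /molli; set b := - n%:R / 2; set E := e ^- 2; set F := r ^- 2.
move: s0; rewrite le_eqVlt => /predU1P[<-|s0].
  by rewrite !mulr0 !mul0r !addr0 !step_eq0 ?ler01 // subrr !mul0r !mulr0 !mul0r subrr.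
have -> : s `^ b = s * s `^ (b - 1).
  by rewrite -{2}(powRr1 (ltW s0)) -powRD ?(gt_eqF s0) ?implybT // addrC subrK.
by rewrite /b; field.
Qed.

Lemma newton_eq0 (e r s : R) : 0 < e <= r -> 2 * r ^+ 2 < s -> newton e r s = 0.
Proof.
move=> /andP[e0 er] rs; have r0 := lt_le_trans e0 er.
rewrite /newton !step_eq1 ?subrr ?mul0r // addr0 mulrC ler_pdivlMr ?exprn_gt0 //.
  exact: ltW.
by rewrite (le_trans _ (ltW rs)) // ler_pM2l // ler_sqr ?nnegrE ?(ltW e0) ?(ltW r0).
Qed.

Lemma newton_le (e r s : R) : `|newton e r s| <= s `^ (- n%:R / 2).
Proof.
rewrite /newton normrM [`|_ `^ _|]ger0_norm ?powR_ge0 // ler_piMl ?powR_ge0 //.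
have := step_ge0 (e ^- 2 * s + 0); have := step_ge0 (r ^- 2 * s + 0).
have := step_le1 (e ^- 2 * s + 0); have := step_le1 (r ^- 2 * s + 0).
by rewrite ler_norml => *; apply/andP; split; lra.
Qed.

Lemma sqnorm_ge0 (x : 'rV[R]_n) : 0 <= sqnorm x.
Proof. by apply: sumr_ge0 => i _; exact: sqr_ge0. Qed.

(** The dyadic form of the bound [|x - y| ^ (1 - n)] for the length of the
    field. *)
Lemma radial_newton_bound (e r : R) (y : 'rV[R]_n) i x : 0 < e <= r ->
  radial (newton e r) y i x = 0 \/
  exists2 m, ball y (rad R m) x &
    `|radial (newton e r) y i x| <= 4 ^+ n * rad R m `^ (1 - n%:R).
Proof.
move=> er; set s := sqnorm (x - y).
have : 0 <= s by exact: sqnorm_ge0.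
rewrite le_eqVlt => /predU1P[s0|s0].
  left; rewrite /radial -/s -s0 /newton !mulr0 !addr0 !step_eq0 ?ler01 //.
  by rewrite subrr mul0r mulr0.
(* The radius is chosen so that [t <= rad m / 2], which puts [x], at the
   distance [t] from [y], into the ball, while [rad m <= 4 * t] costs a factor
   [4 ^ n]. *)
right; pose t := s `^ 2^-1.
have t0 : 0 < t by rewrite powR_gt0.
have [m /andP[h1 h2]] : exists m, rad R m <= 4 * t <= 2 * rad R m.
  by apply: rad_cover; rewrite mulr_gt0.
have r0 := rad_gt0 R m.
have t2 : t ^+ 2 = s.
  by rewrite -powR_mulrn ?(ltW t0) // -powRrM mulVf ?powRr1 ?(ltW s0) // pnatr_eq0.
have hk k : `|x 0 k - y 0 k| <= t.
  have := sqnorm_ge (x - y) k; rewrite -/s -t2 !mxE => h.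
  by rewrite -(ler_pXn2r (n := 2)) ?nnegrE // ltW.
exists m.
  apply/ball_rVP => // k; rewrite distrC; apply: le_lt_trans (hk k) _; lra.
rewrite /radial normrM.
apply: (@le_trans _ _ (t * s `^ (- n%:R / 2))).
  by apply: ler_pM => //; exact: newton_le.
have -> : t * s `^ (- n%:R / 2) = t `^ (1 - n%:R).
  rewrite -{1}(powRr1 (ltW t0)) /t -!powRrM -powRD ?(gt_eqF s0) ?implybT //.
  by congr (_ `^ _); field.
have -> : 1 - n%:R = - (n.-1)%:R :> R.
  by rewrite -[in LHS](prednK n0) -natr1 opprD addrCA subrr addr0.
rewrite !powRN !powR_mulrn ?(ltW t0) ?(ltW r0) //.
apply: (@le_trans _ _ (4 ^+ n.-1 / rad R m ^+ n.-1)).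
  rewrite ler_pdivlMr ?exprn_gt0 // mulrC ler_pdivrMr ?exprn_gt0 // -exprMn.
  by apply: lerXn2r; rewrite ?nnegrE ?mulr_ge0 ?(ltW t0) ?(ltW r0).
rewrite ler_wpM2r ?invr_ge0 ?exprn_ge0 ?(ltW r0) //.
by rewrite ler_weXn2l ?ler1n // leq_pred.
Qed.

Lemma molli_ge0 e s : 0 <= s -> 0 <= molli e s.
Proof.
move=> s0; rewrite /molli !mulr_ge0 ?powR_ge0 ?bump_ge0 // ?invr_ge0 //.
by rewrite exprn_even_ge0.
Qed.

Lemma molli_supp (e s : R) : 0 < e -> molli e s != 0 -> e ^+ 2 <= s <= 2 * e ^+ 2.
Proof.
move=> e0; apply: contraR; rewrite negb_and -!ltNge => h.
rewrite /molli bump_eq0 ?mulr0 ?mul0r // addr0 mulrC.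
rewrite ltr_pdivrMr ?exprn_gt0 // ltr_pdivlMr ?exprn_gt0 // mul1r.
exact/orP.
Qed.

(** The kernels of all scales are the dilations of one of them. *)
Lemma molli_scale (e s : R) : 0 < e -> 0 <= s ->
  molli e s = e^-1 ^+ n * molli 1 (e ^- 2 * s).
Proof.
move=> e0 s0; rewrite /molli !expr1n !invr1 !mul1r addr0.
rewrite powRM ?invr_ge0 ?exprn_ge0 ?(ltW e0) //.
have -> : (e ^- 2) `^ (- n%:R / 2) = e ^+ n.
  rewrite -powR_invn ?(ltW e0) // -powRrM.
  have -> : - 2%:R * (- n%:R / 2) = n%:R :> R by field.
  by rewrite powR_mulrn ?(ltW e0).
by rewrite exprVn; field; rewrite !expf_neq0 // gt_eqF.
Qed.

Lemma measurable_molli e : measurable_fun setT (molli e).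
Proof.
apply: measurable_funM.
  apply: measurable_funM => //; apply: measurable_funM; first exact: measurable_funM.
  apply: (measurableT_comp (continuous_measurable_fun (@continuous_bump R))).
  by apply: measurable_funD => //; exact: measurable_funM.
exact: measurable_powR.
Qed.

Lemma molli_bounded : exists2 C : R, 0 <= C & forall e s, 0 < e -> molli e s <= C * e^-1 ^+ n.
Proof.
have [M M0 hM] := bump_bounded R.
exists (4 * M) => [|e s e0]; first by rewrite mulr_ge0.
have C0 : 0 <= 4 * M * e^-1 ^+ n by rewrite !mulr_ge0 // exprn_ge0 // invr_ge0 ltW.
have [->//|/(molli_supp e0)/andP[h1 h2]] := eqVneq (molli e s) 0.
have s0 : 0 < s by apply: lt_le_trans h1; rewrite exprn_gt0.
rewrite molli_scale ?(ltW s0) // mulrC ler_wpM2r ?exprn_ge0 ?invr_ge0 ?(ltW e0) //.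
set u := e ^- 2 * s.
have u1 : 1 <= u by rewrite /u mulrC ler_pdivlMr ?exprn_gt0 // mul1r.
have u2 : u <= 2 by rewrite /u mulrC ler_pdivrMr ?exprn_gt0.
rewrite /molli expr1n invr1 !mul1r addr0.
have u0 : 0 <= u by exact: le_trans ler01 u1.
have h3 := hM u.
have h4 : u `^ (- n%:R / 2) <= 1.
  by rewrite -[leRHS](powRr0 u) ler_powR // mulNr oppr_le0 divr_ge0.
have hb := bump_ge0 u.
move: (powR_ge0 u (- n%:R / 2)) h4; move: (u `^ _) => v v0 v1.
apply: (@le_trans _ _ (2 * (u * bump u) * 1)).
  by rewrite ler_wpM2l // mulr_ge0 // mulr_ge0.
have h5 : u * bump u <= 2 * M by rewrite ler_pM.
by rewrite mulr1 (le_trans (ler_wpM2l _ h5)) // mulrA -natrM.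
Qed.

Definition mollif e (x : 'rV[R]_n) : R := molli e (sqnorm x).

Lemma mollifE e x : mollif e x = molli e (sqnorm x). Proof. by []. Qed.

Lemma mollif_ge0 e x : 0 <= mollif e x. Proof. exact/molli_ge0/sqnorm_ge0. Qed.

Lemma continuous_sqnorm : continuous (@sqnorm R n).
Proof.
have h := Ck_continuous (Ck_sqnorm 0 (0 : 'rV[R]_n)).
rewrite (_ : @sqnorm R n = (fun x => sqnorm (x - 0))) //.
by apply/funext => z; rewrite subr0.
Qed.

Lemma measurable_sqnorm : measurable_fun setT (@sqnorm R n).
Proof.
exact: continuous_measurable_rV continuous_sqnorm.
Qed.

Lemma measurable_mollif e : measurable_fun setT (mollif e).
Proof. exact: (measurableT_comp (measurable_molli e) measurable_sqnorm). Qed.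

Lemma mollif_supp e (x y : 'rV[R]_n) : 0 < e -> mollif e (x - y) != 0 -> ball y (2 * e) x.
Proof.
move=> e0 /(molli_supp e0)/andP[_ h]; apply: sqnorm_lt_ball; first by rewrite mulr_gt0.
by apply: le_lt_trans h _; rewrite exprMn ltr_pM2r ?exprn_gt0 // expr2; lra.
Qed.

Definition mollif_mass : \bar R := (\int[mu]_x (mollif 1 x)%:E)%E.

Lemma integral_mollif e (y : 'rV[R]_n) : 0 < e ->
  (\int[mu]_x (mollif e (x - y))%:E = mollif_mass)%E.
Proof.
move=> e0; have ei : 0 < e^-1 by rewrite invr_gt0.
have mm : measurable_fun setT (fun x => (mollif 1 x)%:E).
  by apply/measurable_EFinP; exact: measurable_mollif.
have m0 x : (0 <= (mollif 1 x)%:E)%E by rewrite lee_fin mollif_ge0.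
transitivity (\int[mu]_x ((e^-1 ^+ n)%:E * (mollif 1 (e^-1 *: x + - (e^-1 *: y))%R)%:E))%E.
  apply: eq_integral => x _; rewrite -EFinM; congr EFin.
  rewrite /mollif molli_scale ?sqnorm_ge0 //; congr (_ * molli _ _).
  rewrite /sqnorm mulr_sumr; apply: eq_bigr => i _.
  by rewrite !mxE -mulrBr exprMn exprVn.
rewrite ge0_integralZl //; last 2 first.
- apply/measurable_EFinP; apply: (measurableT_comp (measurable_mollif 1)).
  apply: measurable_fun_rV => i.
  have -> : coord_rV i \o (fun x : 'rV[R]_n => e^-1 *: x + - (e^-1 *: y)) =
      fun x => e^-1 * coord_rV i x + - (e^-1 * y 0 i).
    by apply/funext => x; rewrite /= /coord_rV !mxE.
  apply: measurable_funD => //; apply: measurable_funM => //; exact: measurable_coord_rV.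
- by rewrite lee_fin exprn_ge0 // ltW.
rewrite (integral_affine (f := fun x => (mollif 1 x)%:E)) //.
by rewrite muleA -EFinM invrK -exprMn mulVf ?gt_eqF // expr1n mul1e.
Qed.

Lemma sqnormN (x : 'rV[R]_n) : sqnorm (- x) = sqnorm x.
Proof. by apply: eq_bigr => i _; rewrite !mxE sqrrN. Qed.

Lemma integral_mollif_sym e (x : 'rV[R]_n) : 0 < e ->
  (\int[mu]_y (mollif e (x - y))%:E = mollif_mass)%E.
Proof.
move=> e0; rewrite -(integral_mollif x e0); apply: eq_integral => y _.
by rewrite /mollif -sqnormN opprB.
Qed.

Lemma mollif_mass_lty : (mollif_mass < +oo)%E.
Proof.
have [C C0 hC] := molli_bounded.
rewrite /mollif_mass.
pose z : 'rV[R]_n := 0.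
have : (\int[mu]_(x in ball z (2 * 1)%R) (cst C%:E) x < +oo)%E.
  rewrite integral_cst; last exact: measurable_ball_rV.
  by rewrite [X in (_ * X)%E]measure_ball_rV ?mulr_gt0 // -EFinM ltry.
apply: le_lt_trans.
rewrite [leRHS]integral_mkcond; apply: ge0_le_integral => //.
- by move=> x _; rewrite lee_fin mollif_ge0.
- by apply/measurable_EFinP; exact: measurable_mollif.
- apply/(measurable_restrictT _ _).1; [exact: measurable_ball_rV|exact: measurable_cst].
- move=> x _; rewrite patchE; case: ifPn; rewrite ?inE ?notin_setE => h.
    by rewrite lee_fin (le_trans (hC _ _ ltr01)) // invr1 expr1n mulr1.
  suff -> : mollif 1 x = 0 by [].
  apply/eqP; apply: contrapT => /negP h'; apply: h.
  by apply: mollif_supp => //; rewrite subr0.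
Qed.

(** The kernel is bounded below near a point with squared norm 3/2, where
    [bump] is positive. *)
Lemma mollif_mass_gt0 : (0 < mollif_mass)%E.
Proof.
have b0 := bump_gt0 R; have nR0 : 0 < n%:R :> R by rewrite ltr0n.
pose a : R := Num.sqrt (3 / 2 / n%:R).
pose x0 : 'rV[R]_n := \row_i a.
have hx0 : sqnorm x0 = 3 / 2.
  rewrite /sqnorm (eq_bigr (fun=> 3 / 2 / n%:R)) => [|i _].
    by rewrite sumr_const card_ord -[_ *+ n]mulr_natr mulfVK // gt_eqF.
  by rewrite mxE sqr_sqrtr // divr_ge0 // ltW.
have [d d0 hd] : exists2 d : R, 0 < d & forall x, ball x0 d x ->
    bump (3 / 2) / 2 < bump (sqnorm x) /\ 1 < sqnorm x < 2.
  have cb : {for x0, continuous (@bump R \o @sqnorm R n)}.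
    by apply: continuous_comp; [exact: continuous_sqnorm|exact: continuous_bump].
  have h1 : \forall x \near x0, bump (3 / 2) / 2 < bump (sqnorm x).
    by apply: (cb [set t | bump (3 / 2) / 2 < t]); apply: lt_nbhsr; rewrite /= hx0; lra.
  have h2 : \forall x \near x0, 1 < sqnorm x.
    by apply: (@continuous_sqnorm x0 [set t | 1 < t]); apply: lt_nbhsr; rewrite hx0; lra.
  have h3 : \forall x \near x0, sqnorm x < 2.
    by apply: (@continuous_sqnorm x0 [set t | t < 2]); apply: lt_nbhsl; rewrite hx0; lra.
  move: h1 h2 h3 => /nbhs_ballP[d1 /= d10 hd1] /nbhs_ballP[d2 /= d20 hd2].
  move=> /nbhs_ballP[d3 /= d30 hd3].
  exists (Num.min d1 (Num.min d2 d3)); first by rewrite !lt_min d10 d20 d30.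
  move=> x hx; split.
    by apply: hd1; apply: le_ball hx; rewrite ge_min lexx.
  apply/andP; split; [apply: hd2|apply: hd3]; apply: le_ball hx;
    by rewrite !ge_min lexx ?orbT.
pose c : R := 2 * (1 * (bump (3 / 2) / 2)) * 2 `^ (- n%:R / 2).
have c0 : 0 < c by rewrite !mulr_gt0 ?powR_gt0.
apply: (@lt_le_trans _ _ (\int[mu]_(x in ball x0 d) (cst c%:E) x)%E).
  rewrite integral_cst; last exact: measurable_ball_rV.
  by rewrite [X in (_ * X)%E]measure_ball_rV // -EFinM lte_fin mulr_gt0 // exprn_gt0 // pmulrn_lgt0.
rewrite integral_mkcond; apply: ge0_le_integral => //.
- by move=> x _; rewrite patchE; case: ifP => // _; rewrite lee_fin ltW.
- apply/(measurable_restrictT _ _).1; [exact: measurable_ball_rV|exact: measurable_cst].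
- by apply/measurable_EFinP; exact: measurable_mollif.
move=> x _; rewrite patchE; case: ifPn; rewrite ?inE ?notin_setE => hx; last first.
  by rewrite lee_fin mollif_ge0.
have [h1 /andP[h2 h3]] := hd _ hx.
rewrite lee_fin /mollif /molli expr1n invr1 !mul1r addr0 /c mul1r.
have h4 : bump (3 / 2) / 2 <= sqnorm x * bump (sqnorm x).
  by rewrite (le_trans (ltW h1)) // ler_peMl ?bump_ge0 // ltW.
apply: ler_pM; rewrite ?powR_ge0 ?mulr_ge0 ?divr_ge0 ?(ltW b0) // ?ler_pM2l //.
rewrite mulNr !powRN lef_pV2 ?posrE ?powR_gt0 // ?(lt_trans _ h2) //.
by rewrite ge0_ler_powR ?nnegrE ?divr_ge0 ?(ltW nR0) // ?sqnorm_ge0 // ltW.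
Qed.

End newton_kernel.

(* From here on only the proved properties of the kernel and of the measure
   are used. *)
#[local] Opaque mollif lebesgue_rV.

(** * Orthants and boxes *)

Section boxes.
Variables (R : realType) (n : nat).
Local Notation mu := (lebesgue_rV R n).

Definition orthant (a : 'I_n -> R) : set 'rV[R]_n := [set x | forall i, a i < x 0 i].
Definition obox (a b : 'I_n -> R) : set 'rV[R]_n :=
  [set x | forall i, a i < x 0 i < b i].

Lemma open_obox a b : open (obox a b).
Proof.
rewrite openE => x hx; rewrite /interior.
have : \forall d \near (0:R)^'+, forall i, a i + d < x 0 i /\ x 0 i + d < b i.
  apply: filter_forall => i; have /andP[h1 h2] := hx i.
  near=> d; rewrite -ltrBrDl -[_ + _ < b i]ltrBrDl; split; near: d; apply: nbhs_right_lt; rewrite subr_gt0 //.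
move=> h; near (0:R)^'+ => d.
have d0 : 0 < d by near: d; exact: nbhs_right_gt.
have hd : forall i, a i + d < x 0 i /\ x 0 i + d < b i by near: d.
apply/nbhs_ballP; exists d => //= y /(ball_rVP _ _ d0) h1 i.
have [h2 h3] := hd i; have := h1 i; rewrite ltr_norml => /andP[h4 h5].
by apply/andP; split; lra.
Unshelve. all: by end_near. Qed.

Lemma measurable_obox a b : measurable (obox a b).
Proof. by apply: open_measurable_rV; exact: open_obox. Qed.

Lemma measurable_orthant a : measurable (orthant a).
Proof.
rewrite (_ : orthant a = \bigcap_(i in [set: 'I_n]) (@coord_rV R n i @^-1` `]a i, +oo[)).
  apply: fin_bigcap_measurable => // i _; rewrite -[X in measurable X]setTI.
  exact: (@measurable_coord_rV R n i).
apply/seteqP; split=> x /= h i; first by rewrite /= in_itv /= andbT.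
by have := h i I; rewrite /= in_itv /= andbT.
Qed.

(** A half-space [x < z_i] is the union of the orthants whose other bounds are
    [- N]. *)
Lemma orthant_generate :
  @measurable _ 'rV[R]_n = <<s [set A | exists a, A = orthant a] >>.
Proof.
apply/seteqP; split; last first.
  apply: smallest_sub; first exact: sigma_algebra_measurable.
  by move=> _ [a ->]; exact: measurable_orthant.
apply: smallest_sub; first exact: smallest_sigma_algebra.
rewrite -bigcup_seq; apply: bigcup_sub => i _ _ [Y mY <-]; rewrite setTI.
pose F := <<s [set A | exists a, A = orthant a] >>.
have sF : sigma_algebra setT F by exact: smallest_sigma_algebra.
have sY := sigma_algebra_image (@coord_rV R n i) sF.
have : image_set_system setT (@coord_rV R n i) F Y; last by rewrite /image_set_system /= setTI.
move: mY; rewrite RGenOInfty.measurableE.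
apply: (smallest_sub sY) => _ [x ->]; rewrite /image_set_system /= setTI.
rewrite (_ : _ @^-1` _ =
  \bigcup_N orthant (fun j => if j == i then x else - N%:R)).
  by case: sF => _ _; apply => N; apply: sub_sigma_algebra; eexists; reflexivity.
apply/seteqP; split=> z /=.
  rewrite in_itv /= andbT => xz.
  have [N hN] := rV_bounded z.
  exists N => // j; case: eqP => [->//|_].
  by have := hN j; rewrite ltr_norml => /andP[].
by move=> [N _ /(_ i)]; rewrite eqxx in_itv /= andbT.
Qed.

(** The points where the mollified indicators of the box need not converge to
    its indicator are negligible. *)
Lemma obox_boundary (a b : 'I_n -> R) :
  {ae mu, forall x : 'rV[R]_n, forall i, x 0 i != a i /\ x 0 i != b i}.
Proof.
apply: filter_forall => i.
have h (c : R) : {ae mu, forall x : 'rV[R]_n, x 0 i != c}.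
  exists (@coord_rV R n i @^-1` [set c]); split.
  - rewrite -[X in measurable X]setTI; exact: (@measurable_coord_rV R n i).
  - apply: null_coord_rV => //; exact: lebesgue_measure_set1.
  - by move=> x /= /negP; rewrite negbK => /eqP.
by apply: filterS2 (h (a i)) (h (b i)) => x.
Qed.
End boxes.

(** * Mollification *)

Section mollification.
Variables (R : realType) (n : nat).
Local Notation mu := (lebesgue_rV R n).

Definition mollify e (v : 'rV[R]_n -> R) (y : 'rV[R]_n) : R :=
  \int[mu]_x (v x * mollif e (x - y)).

Lemma measurable_mollif_pair e :
  measurable_fun setT (fun z : 'rV[R]_n * 'rV[R]_n => mollif e (z.2 - z.1)).
Proof.
apply: (measurableT_comp (measurable_mollif e)).
apply: measurable_fun_rV => i.
rewrite (_ : _ \o _ = (fun z => (coord_rV i \o snd) z - (coord_rV i \o fst) z)).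
  apply: measurable_funB; apply: measurableT_comp => //; exact: measurable_coord_rV.
by apply/funext => z; rewrite /coord_rV /= !mxE.
Qed.

Lemma measurable_mollifl e y : measurable_fun setT (fun x : 'rV[R]_n => mollif e (x - y)).
Proof. exact: (measurableT_comp (measurable_mollif_pair e) (measurable_pair1 y)). Qed.

Lemma measurable_mollifr e x : measurable_fun setT (fun y : 'rV[R]_n => mollif e (x - y)).
Proof. exact: (measurableT_comp (measurable_mollif_pair e) (measurable_pair2 x)). Qed.

Lemma integrable_mul_ball (u phi : 'rV[R]_n -> R) (y : 'rV[R]_n) r C : 0 < r ->
  measurable_fun setT u -> mu.-integrable (ball y r) (EFin \o u) ->
  measurable_fun setT phi -> (forall x, `|phi x| <= C) -> (forall x, phi x != 0 -> ball y r x) ->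
  mu.-integrable setT (EFin \o (fun x => u x * phi x)).
Proof.
move=> r0 mu_ iu mphi hC hB.
have mB : measurable (ball y r) by exact: measurable_ball_rV.
have [h _] := @integrable_mkcond _ _ _ mu _ (EFin \o u) mB.
have := h iu => {h} iu'.
apply: (@le_integrable _ _ _ mu setT measurableT _
   (fun x => (C%:E * ((EFin \o u) \_ (ball y r)) x)%E)).
- by apply/measurable_EFinP; exact: measurable_funM.
- move=> x _; rewrite patchE /=; case: ifPn => [xB|xB].
    rewrite -EFinM !abse_EFin lee_fin [leRHS]normrM [leLHS]normrM mulrC ler_wpM2r //.
    exact: le_trans (hC x) (ler_norm _).
  have [->|h] := eqVneq (phi x) 0; first by rewrite mulr0 mule0.
  by move: xB; rewrite notin_setE => -[]; exact: hB.
- exact: integrableZl.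
Qed.

Lemma integrable_mul_mollif (u : 'rV[R]_n -> R) e y : 0 < e -> measurable_fun setT u ->
  mu.-integrable (ball y (2 * e)) (EFin \o u) ->
  mu.-integrable setT (fun x => (u x * mollif e (x - y))%:E).
Proof.
move=> e0 mu_ iu; have [C C0 hC] := molli_bounded R n.
apply: (@integrable_mul_ball u (fun x => mollif e (x - y)) y (2 * e) (C * e^-1 ^+ n)) => //.
- by rewrite mulr_gt0.
- exact: measurable_mollifl.
- by move=> x; rewrite ger0_norm ?mollif_ge0 //; exact: hC.
- by move=> x; exact: mollif_supp.
Qed.

Section integrable.
Variable v : 'rV[R]_n -> R.
Hypothesis iv : mu.-integrable setT (EFin \o v).

Let mv : measurable_fun setT v.
Proof. by have /integrableP[/measurable_EFinP] := iv. Qed.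

(** The mass of the kernel is the same in either variable, so the double
    integral of the absolute value is at most this mass times the norm of [v]. *)
Lemma integrable_mollify_kernel e B : 0 < e -> measurable B ->
  (mu \x mu)%E.-integrable setT
    (fun z => (v z.2 * (mollif e (z.2 - z.1) * \1_B z.1))%:E).
Proof.
move=> e0 mB.
have mk : measurable_fun setT
    (fun z : 'rV[R]_n * 'rV[R]_n => (v z.2 * (mollif e (z.2 - z.1) * \1_B z.1))%:E).
  apply/measurable_EFinP; apply: measurable_funM; first exact: measurableT_comp.
  apply: measurable_funM; first exact: measurable_mollif_pair.
  by apply: measurableT_comp.
apply/(integrable21ltyP mu mu mk).
have /integrableP[_ hv] := iv.
apply: (@le_lt_trans _ _ (\int[mu]_x (`|(v x)%:E| * mollif_mass R n))%E).
  apply: ge0_le_integral => //.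
  - by move=> x _; exact: integral_ge0.
  - have mk' : measurable_fun setT (fun z : 'rV[R]_n * 'rV[R]_n =>
       `|(v z.2 * (mollif e (z.2 - z.1) * \1_B z.1))%:E|%E) by apply: measurableT_comp.
    exact: (@measurable_fun_fubini_tonelli_G _ _ _ _ _ mu _ mk' (fun=> abse_ge0 _)).
  - by apply: emeasurable_funM => //; apply: measurableT_comp => //; exact/measurable_EFinP.
  - move=> x _ /=.
    apply: (@le_trans _ _ (\int[mu]_y (`|v x|%:E * (mollif e (x - y))%:E))%E).
      apply: ge0_le_integral => //.
      + apply/measurable_EFinP; apply: (measurableT_comp (@normr_measurable R setT)) => //.
        by apply: measurable_funM => //; apply: measurable_funM => //; exact: measurable_mollifr.
      + apply: emeasurable_funM => //; apply/measurable_EFinP; exact: measurable_mollifr.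
      + move=> y _; rewrite lee_fin normrM [X in _ * X]normrM ler_wpM2l // [X in X * _]ger0_norm ?mollif_ge0 //.
        by rewrite ler_piMr ?mollif_ge0 // indicE; case: (_ \in _); rewrite ?normr1 ?normr0.
    rewrite ge0_integralZl; last 4 first.
    + exact: measurableT.
    + by apply/measurable_EFinP; exact: measurable_mollifr.
    + by move=> y _; rewrite lee_fin mollif_ge0.
    + by rewrite lee_fin.
    by rewrite (integral_mollif_sym x e0).
have mM : (0 <= mollif_mass R n)%E by apply: integral_ge0 => x _; rewrite lee_fin mollif_ge0.
rewrite ge0_integralZr //.
  rewrite muleC lte_mul_pinfty //.
  by rewrite ge0_fin_numE // mollif_mass_lty.
by apply: measurableT_comp => //; exact/measurable_EFinP.
Qed.

Lemma integrable_mollifl e y : 0 < e ->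
  mu.-integrable setT (fun x => (v x * mollif e (x - y))%:E).
Proof.
move=> e0; apply: integrable_mul_mollif => //.
by apply: integrableS iv => //; exact: measurable_ball_rV.
Qed.

Lemma mollifyE e y : 0 < e ->
  (mollify e v y)%:E = (\int[mu]_x (v x * mollif e (x - y))%:E)%E.
Proof.
by move=> e0; rewrite /mollify fineK //; apply: integrable_fin_num => //; exact: integrable_mollifl.
Qed.

Lemma integrable_mollify e : 0 < e -> mu.-integrable setT (EFin \o mollify e v).
Proof.
move=> e0; have := integrable_fubini_F (integrable_mollify_kernel e0 measurableT).
apply: eq_integrable => // y _ /=; rewrite mollifyE // /fubini_F /=.
by apply: eq_integral => x _; rewrite indicT mulr1.
Qed.

Lemma integrable_mollifr e x B : 0 < e -> measurable B ->
  mu.-integrable setT (fun y => (mollif e (x - y) * \1_B y)%:E).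
Proof.
move=> e0 mB; have mm : measurable_fun setT (fun y : 'rV[R]_n => (mollif e (x - y))%:E).
  by apply/measurable_EFinP; exact: measurable_mollifr.
apply: (@le_integrable _ _ _ mu setT measurableT _ (fun y : 'rV[R]_n => (mollif e (x - y))%:E)).
- by apply/measurable_EFinP; apply: measurable_funM => //; exact: measurable_mollifr.
- move=> y _; rewrite !abse_EFin lee_fin normrM ler_piMr // indicE.
  by case: (_ \in _); rewrite ?normr1 ?normr0.
- apply/integrableP; split=> //.
  rewrite (eq_integral (fun y : 'rV[R]_n => (mollif e (x - y))%:E)).
    by rewrite (integral_mollif_sym x e0) mollif_mass_lty.
  by move=> y _; rewrite gee0_abs // lee_fin mollif_ge0.
Qed.

Lemma integral_mollifr e x (B : set 'rV[R]_n) :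
  (\int[mu]_(y in B) (mollif e (x - y))%:E =
   \int[mu]_y (mollif e (x - y) * \1_B y)%:E)%E.
Proof.
rewrite integral_mkcond; apply: eq_integral => y _; rewrite patchE indicE.
by case: ifPn => yB; rewrite ?mulr1 ?mulr0.
Qed.

Lemma integral_mollifrZ c e x B : 0 < e -> measurable B ->
  (\int[mu]_y (c * (mollif e (x - y) * \1_B y))%:E =
   c%:E * \int[mu]_y (mollif e (x - y) * \1_B y)%:E)%E.
Proof.
move=> e0 mB; have := integralZl measurableT (integrable_mollifr x e0 mB) c.
by move=> <-; apply: eq_integral => y _; rewrite -EFinM.
Qed.

(** Fubini moves the mollification from [v] to the indicator of [B]. *)
Lemma integral_mollify e B : 0 < e -> measurable B ->
  (\int[mu]_(y in B) (mollify e v y)%:E =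
   \int[mu]_x ((v x)%:E * \int[mu]_(y in B) (mollif e (x - y))%:E))%E.
Proof.
move=> e0 mB; have := Fubini (integrable_mollify_kernel e0 mB).
set I1 := integral _ _ _; set I2 := integral _ _ _ => h.
rewrite integral_mkcond; transitivity I1.
  apply: eq_integral => y _; rewrite patchE; have [yB|yB] := boolP (y \in B).
    by rewrite (mollifyE y e0); apply: eq_integral => x _; rewrite indicE yB mulr1.
  by rewrite integral0_eq // => x _; rewrite indicE (negbTE yB) !mulr0.
rewrite h {h I1} /I2.
apply: eq_integral => x _ /=; rewrite integral_mollifr.
exact: integral_mollifrZ.
Qed.

End integrable.
End mollification.

Section mollification_boxes.
Variables (R : realType) (n : nat).
Local Notation mu := (lebesgue_rV R n).
Local Notation kap := (fine (mollif_mass R n)).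

Lemma mollif_massE : mollif_mass R n = kap%:E.
Proof.
rewrite fineK // ge0_fin_numE ?mollif_mass_lty //.
by apply: integral_ge0 => x _; rewrite lee_fin mollif_ge0.
Qed.

Lemma integral_mollifr_in e x a b d : 0 < e -> ball x d `<=` obox a b -> 2 * e <= d ->
  (\int[mu]_(y in obox a b) (mollif e (x - y))%:E = mollif_mass R n)%E.
Proof.
move=> e0 xd ed; rewrite -(integral_mollif_sym x e0) integral_mkcond.
apply: eq_integral => y _; rewrite patchE; have [yB|yB] := boolP (y \in obox a b) => //.
have [->//|h] := eqVneq (mollif e (x - y)) 0.
have /ball_sym h1 := mollif_supp e0 h.
by move: yB; rewrite notin_setE => -[]; apply: xd; exact: le_ball h1.
Qed.

Lemma integral_mollifr_out e (x : 'rV[R]_n) a b i : 0 < e ->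
  x 0 i + 2 * e <= a i \/ b i <= x 0 i - 2 * e ->
  (\int[mu]_(y in obox a b) (mollif e (x - y))%:E = 0)%E.
Proof.
move=> e0 hi; apply: integral0_eq => y hy.
have [->//|h] := eqVneq (mollif e (x - y)) 0.
have /ball_rVP := mollif_supp e0 h => /(_ (mulr_gt0 (ltr0Sn R 1) e0) i).
by rewrite ltr_norml => /andP[h1 h2]; have /andP[h3 h4] := hy i; exfalso; case: hi; lra.
Qed.

Lemma integral_mollifr_le e (x : 'rV[R]_n) B : 0 < e -> measurable B ->
  (0 <= \int[mu]_(y in B) (mollif e (x - y))%:E <= mollif_mass R n)%E.
Proof.
move=> e0 mB; apply/andP; split.
  by apply: integral_ge0 => y _; rewrite lee_fin mollif_ge0.
rewrite -(integral_mollif_sym x e0); apply: ge0_subset_integral => //.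
  by apply/measurable_EFinP; exact: measurable_mollifr.
by move=> y _; rewrite lee_fin mollif_ge0.
Qed.

Lemma harmonic_le (d : R) : 0 < d -> \forall m \near \oo, 2 * m.+1%:R^-1 <= d.
Proof.
move=> d0; exists (Num.bound (2 / d)) => // m /= hm.
rewrite ler_pdivrMr ?ltr0n // -ler_pdivrMl // mulrC.
apply: ltW; apply: lt_le_trans (archi_boundP _) _; first by rewrite divr_ge0 // ltW.
by rewrite ler_nat ltnW.
Qed.

Section box.
Variable v : 'rV[R]_n -> R.
Hypothesis iv : mu.-integrable setT (EFin \o v).

Let mv : measurable_fun setT v.
Proof. by have /integrableP[/measurable_EFinP] := iv. Qed.

(** By [integral_mollify] it suffices that the mollified indicator of the box
    tends to [kap] inside and to zero outside the box, and stays below [kap];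
    dominated convergence applies. *)
Lemma mollify_obox a b :
  (fun m => \int[mu]_(y in obox a b) (mollify m.+1%:R^-1 v y)%:E)%E @ \oo -->
  (\int[mu]_(x in obox a b) (kap * v x)%:E)%E.
Proof.
have e0 m : (0:R) < m.+1%:R^-1 by rewrite invr_gt0.
have mB := measurable_obox a b.
pose psi m x : \bar R := (\int[mu]_(y in obox a b) (mollif m.+1%:R^-1 (x - y))%:E)%E.
have psi0 m x : (0 <= psi m x <= mollif_mass R n)%E by exact: integral_mollifr_le.
have mpsi m : measurable_fun setT (psi m).
  have mk : measurable_fun setT (fun z : 'rV[R]_n * 'rV[R]_n =>
      (mollif m.+1%:R^-1 (z.2 - z.1) * \1_(obox a b) z.1)%:E).
    apply/measurable_EFinP; apply: measurable_funM; first exact: measurable_mollif_pair.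
    by apply: measurableT_comp.
  have k0 z : (0 <= (mollif m.+1%:R^-1 (z.2 - z.1) * \1_(obox a b) z.1)%:E :> \bar R)%E.
    by rewrite lee_fin mulr_ge0 ?mollif_ge0 // indicE.
  have := @measurable_fun_fubini_tonelli_G _ _ _ _ _ mu _ mk k0.
  by apply: eq_measurable_fun => x _; rewrite /psi integral_mollifr.
pose f_ m x : \bar R := ((v x)%:E * psi m x)%E.
pose f : 'rV[R]_n -> \bar R := ((fun x => (kap * v x)%:E) \_ (obox a b)).
pose g (x : 'rV[R]_n) : \bar R := (kap%:E * `|(v x)%:E|)%E.
have := @dominated_convergence _ _ _ mu setT measurableT f_ f g.
case.
- by move=> m; apply: emeasurable_funM => //; exact/measurable_EFinP.
- apply: (measurable_restrictT _ _).1 => //; apply/measurable_EFinP.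
  by apply: measurable_funTS; exact: measurable_funM.
- have := obox_boundary a b; apply: filterS => x hx _.
  rewrite /f patchE; have [xB|xB] := boolP (x \in obox a b).
    have /nbhs_ballP[d /= d0 hd] : nbhs x (obox a b).
      by apply: open_nbhs_nbhs; split; [exact: open_obox|exact: set_mem].
    apply: cvg_near_cst; apply: filterS (harmonic_le d0) => m hm.
    by rewrite /f_ /psi (integral_mollifr_in (e0 m) hd hm) mollif_massE -EFinM mulrC.
  have [i hi] : exists i, x 0 i < a i \/ b i < x 0 i.
    apply: contrapT => hn; move: xB; rewrite notin_setE; apply => i.
    have [h1 h2] := hx i; rewrite !lt_neqAle eq_sym h1 h2 /= !leNgt.
    by apply/andP; split; apply/negP => h; apply: hn; exists i; [left|right].
  pose d := Num.max (a i - x 0 i) (x 0 i - b i).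
  have d0 : 0 < d by rewrite lt_max !subr_gt0; apply/orP.
  apply: cvg_near_cst; apply: filterS (harmonic_le d0) => m hm.
  rewrite /f_ /psi (@integral_mollifr_out _ _ _ _ i) ?mule0 //.
  by move: hm; rewrite le_max => /orP[|] h; [left; rewrite -lerBrDl|right; rewrite lerBrDr -lerBrDl].
- by apply: integrableZl => //; exact: integrable_abse.
- apply: aeW => x m _; rewrite /f_ /g abseM -mollif_massE muleC.
  have /andP[h1 h2] := psi0 m x.
  rewrite (gee0_abs h1); apply: lee_wpmul2r h2; exact: abse_ge0.
move=> _ _; rewrite -integral_mkcond; apply: cvg_trans; apply: near_eq_cvg.
by apply: nearW => m; rewrite /= integral_mollify.
Qed.

End box.

End mollification_boxes.

(** * Passing to the limit in a bound for mollifications *)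

Section dominated_mollification.
Variables (R : realType) (n : nat).
Local Notation mu := (lebesgue_rV R n).
Local Notation kap := (fine (mollif_mass R n)).
Variable v : 'rV[R]_n -> R.
Hypothesis iv : mu.-integrable setT (EFin \o v).
Variables (a b : 'I_n -> R) (J : 'rV[R]_n -> \bar R).
Local Notation D := (obox a b).
Hypothesis iJ : mu.-integrable D J.
Hypothesis vJ : forall m y, D y -> (`|mollify m.+1%:R^-1 v y|%:E <= J y)%E.

Let w m x := mollify m.+1%:R^-1 v x - kap * v x.
Let h x : \bar R := (J x + (kap * `|v x|)%:E)%E.
Let mD : measurable D. Proof. exact: measurable_obox. Qed.

Let e0 m : (0:R) < m.+1%:R^-1. Proof. by rewrite invr_gt0. Qed.

Let kap0 : 0 <= kap.
Proof. by apply: fine_ge0; apply: integral_ge0 => x _; rewrite lee_fin mollif_ge0. Qed.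

Let ikv : mu.-integrable setT (EFin \o (fun x => kap * v x)).
Proof.
have := integrableZl measurableT kap iv; apply: eq_integrable => // x _ /=.
Qed.

Let iw m : mu.-integrable setT (EFin \o w m).
Proof.
have := integrableB measurableT (integrable_mollify iv (e0 m)) ikv.
by apply: eq_integrable => // x _ /=; rewrite EFinB.
Qed.

Let iwS m A : measurable A -> mu.-integrable A (EFin \o w m).
Proof. by move=> mA; apply: integrableS (iw m) => //. Qed.

Let ih : mu.-integrable D h.
Proof.
apply: integrableD => //.
have iS : mu.-integrable D (EFin \o v) by apply: integrableS iv.
have := integrableZl mD kap (integrable_abse iS).
by apply: eq_integrable => // x _ /=.
Qed.

Let w_le m x : D x -> (`|w m x|%:E <= h x)%E.
Proof.
move=> Dx; apply: (@le_trans _ _ (`|mollify m.+1%:R^-1 v x|%:E + `|kap * v x|%:E)%E).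
  by rewrite -EFinD lee_fin ler_normB.
by rewrite /h leeD ?vJ // lee_fin normrM ger0_norm.
Qed.

Let L m A := \int[mu]_(x in A `&` D) w m x.

Let L_le m A : measurable A -> (`|L m A|%:E <= \int[mu]_(x in A `&` D) h x)%E.
Proof.
move=> mA; have mAD : measurable (A `&` D) by exact: measurableI.
rewrite EFin_normr_Rintegral //; last exact: iwS.
apply: le_trans (le_abse_integral _ _ _) _ => //.
  by have /integrableP[] := iwS m mAD.
apply: ge0_le_integral => //.
- by apply: measurableT_comp => //; have /integrableP[] := iwS m mAD.
- apply: measurable_funS mD _ _; [exact: subIsetr|by have /integrableP[] := ih].
- by move=> x [_ Dx]; rewrite abse_EFin; exact: w_le.
Qed.

Let LU m A B : measurable A -> measurable B -> A `&` B = set0 ->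
  L m (A `|` B) = L m A + L m B.
Proof.
move=> mA mB AB; rewrite /L setIUl Rintegral_setU //.
- exact: measurableI.
- exact: measurableI.
- by apply: iwS; apply: measurableU; exact: measurableI.
- by apply/disj_setPS => x [[Ax _] [Bx _]]; rewrite -AB.
Qed.

(* Weak convergence of [mollify v] to [kap * v] on the part of [A] in the box
   [D]. It holds for boxes, and the sets where it holds form a Dynkin system. *)
Let P A := L ^~ A @ \oo --> 0.

Let P_obox A c d : A `&` D = obox c d -> P A.
Proof.
move=> Acd; have := @mollify_obox R n v iv c d => h1.
have mcd := measurable_obox c d.
have h2 : fine (\int[mu]_(y in obox c d) (mollify m.+1%:R^-1 v y)%:E)%E @[m --> \oo] -->
    fine (\int[mu]_(x in obox c d) (kap * v x)%:E)%E.
  apply: fine_cvg; rewrite fineK //; apply: integrable_fin_num => //.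
  by apply: integrableS ikv.
have h3 : L ^~ A @ \oo --> fine (\int[mu]_(x in obox c d) (kap * v x)%:E)%E - fine (\int[mu]_(x in obox c d) (kap * v x)%:E)%E; last by rewrite subrr in h3.
apply: cvg_trans (cvgB h2 (cvg_cst _)); apply: near_eq_cvg; apply: nearW => m.
rewrite /L Acd /w RintegralB //.
- by apply: integrableS (integrable_mollify iv (e0 m)).
- by apply: integrableS ikv.
Qed.

Let PT : P setT.
Proof. by apply: P_obox; rewrite setTI. Qed.

Let Porthant c : P (orthant c).
Proof.
apply: (@P_obox _ (fun i => Num.max (c i) (a i)) b).
apply/seteqP; split=> x.
  by move=> [h1 h2] i; have /andP[h3 h4] := h2 i; rewrite gt_max h1 h3.
by move=> h1; split=> i; have := h1 i; rewrite gt_max => /andP[/andP[h2 h3] h4] //; rewrite h3.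
Qed.

Let PC A : measurable A -> P A -> P (~` A).
Proof.
move=> mA PA; rewrite /P -(subrr 0); apply: cvg_trans (cvgB PT PA).
apply: near_eq_cvg; apply: nearW => m.
have := LU m mA (measurableC mA) (setICr A); rewrite setUv => h1.
by rewrite /= -[LHS]/(L m setT - L m A) h1 addrAC subrr add0r.
Qed.

(* The bound [h], which is uniform in [m], makes the contribution of the tail
   of a disjoint union small for all [m] at once. *)
Let P_bigU (F : (set 'rV[R]_n)^nat) : (forall k, measurable (F k)) ->
  trivIset setT F -> (forall k, P (F k)) -> P (\bigcup_k F k).
Proof.
move=> mF tF PF.
pose G K := \big[setU/set0]_(k < K) F k.
pose T K := \bigcup_k F k `\` G K.
have mG K : measurable (G K) by apply: bigsetU_measurable.
have mU : measurable (\bigcup_k F k) by exact: bigcupT_measurable.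
have mT K : measurable (T K) by exact: measurableD.
have UE K : \bigcup_k F k = G K `|` T K.
  rewrite /T setDE setUIr setUv setIT; apply/esym/setUidPr.
  rewrite /G -bigcup_mkord; apply: bigcup_sub => k _; exact: bigcup_sup.
have PG K : P (G K).
  elim: K => [|K IH].
    rewrite /G big_ord0 /P; apply: cvg_near_cst; apply: nearW => m.
    by rewrite /L set0I Rintegral_set0.
  rewrite /G big_ord_recr /=; rewrite /P -(addr0 0); apply: cvg_trans (cvgD IH (PF K)).
  apply: near_eq_cvg; apply: nearW => m; rewrite /= LU //; first exact: mG.
  rewrite -subset0 => x [+ Kx]; rewrite -bigcup_mkord => -[j /= jK jx].
  have := tF j K I I; rewrite /= => /(_ (ex_intro _ x (conj jx Kx))) jKe.
  by rewrite jKe ltnn in jK.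
have hT : (\int[mu]_(x in T K `&` D) h x)%E @[K --> \oo] --> 0%E.
  have h0 x : D x -> (0 <= h x)%E by move=> Dx; apply: le_trans (w_le 0 Dx); rewrite lee_fin.
  have mh : measurable_fun D h by have /integrableP[] := ih.
  have := @dominated_convergence _ _ _ mu D mD (fun K => h \_ (T K)) (cst 0%E) h.
  case=> //.
  - move=> K; apply: (measurable_restrict _ (mT K) mD).1.
    by apply: measurable_funS mh => //; exact: subIsetl.
  - apply: aeW => x Dx; apply: cvg_near_cst.
    have [[k _ Fkx]|nF] := pselect ((\bigcup_k F k) x); last first.
      by apply: nearW => K; rewrite patchE memNset // => -[].
    exists k.+1 => // K /= kK; rewrite patchE memNset // => -[_]; apply.
    by rewrite /G -bigcup_mkord; exists k.
  - apply: aeW => x K Dx; rewrite patchE; case: (_ \in _); first by rewrite gee0_abs ?h0.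
    by rewrite abse0 h0.
  move=> _ _; rewrite integral0; apply: cvg_trans; apply: near_eq_cvg; apply: nearW => K.
  by rewrite /= -integral_mkcondl.
apply/cvgrPdist_lt => e eps0.
have e2 : 0 < e / 2 by rewrite divr_gt0.
have [K _ hK] : \forall K \near \oo, (\int[mu]_(x in T K `&` D) h x < (e / 2)%:E)%E.
  have hn := @nbhs_open_ereal_lt R 0 (fun=> e / 2) e2.
  have [K _ hK] := hT _ hn; exists K => // K' KK'; exact: hK.
move/cvgrPdist_lt: (PG K) => /(_ _ e2); apply: filterS => m.
rewrite !sub0r !normrN => hm; rewrite (UE K) LU //; last first.
  by rewrite /T setDE setICA setICr setI0.
rewrite (splitr e); apply: le_lt_trans (ler_normD _ _) _; apply: ltrD => //.
rewrite -lte_fin; apply: le_lt_trans (L_le _ (mT K)) _; exact: (hK K (leqnn K)).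
Qed.

(** The bound [J] holds for the integrals of the mollifications over every
    measurable part of the box. These integrals converge for boxes by
    [mollify_obox], hence for all measurable sets by the pi-lambda theorem,
    and the limits compare the functions almost everywhere. *)
Lemma le_of_mollify : {ae mu, forall x, D x -> ((kap * v x)%:E <= J x)%E}.
Proof.
have PA A : measurable A -> P A.
  rewrite orthant_generate => sA.
  apply: (dynkin_induction (@orthant_generate R n) _ PT _ PC P_bigU sA).
    move=> _ _ [c1 ->] [c2 ->]; exists (fun i => Num.max (c1 i) (c2 i)).
    apply/seteqP; split=> x /=.
      by move=> [h1 h2] i; rewrite gt_max h1 h2.
    by move=> h1; split=> i; have := h1 i; rewrite gt_max => /andP[].
  by move=> _ [c ->]; exact: Porthant.
have mJ : measurable_fun D J by have /integrableP[] := iJ.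
have mkv : measurable_fun D (fun x => (kap * v x)%:E).
  by have /integrableP[mm _] := ikv; exact: measurable_funS mm.
have le A : measurable A -> (\int[mu]_(x in A `&` D) (kap * v x)%:E <= \int[mu]_(x in A `&` D) J x)%E.
  move=> mA; have mAD : measurable (A `&` D) by exact: measurableI.
  have iJA : mu.-integrable (A `&` D) J by apply: integrableS iJ => //; exact: subIsetr.
  have ikA : mu.-integrable (A `&` D) (EFin \o (fun x => kap * v x)) by apply: integrableS ikv.
  have fJ := integrable_fin_num mAD iJA.
  have fk := integrable_fin_num mAD ikA.
  rewrite -(fineK fJ) -(fineK fk) lee_fin; apply/ler_addgt0Pr => e eps0.
  have /cvgrPdist_lt /(_ _ eps0) [m _ hm] := PA A mA.
  have := hm m (leqnn m); rewrite sub0r normrN => /ltW; rewrite ler_norml => /andP[hL _].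
  have iV : mu.-integrable (A `&` D) (EFin \o mollify m.+1%:R^-1 v).
    by apply: integrableS (integrable_mollify iv (e0 m)).
  have hV : (\int[mu]_(x in A `&` D) (mollify m.+1%:R^-1 v x)%:E <= \int[mu]_(x in A `&` D) J x)%E.
    apply: le_integral => // x; rewrite inE => -[_ Dx].
    by apply: le_trans (vJ m Dx); rewrite lee_fin ler_norm.
  have fV := integrable_fin_num mAD iV.
  move: hV; rewrite -(fineK fJ) -(fineK fV) lee_fin => hV.
  move: hL; rewrite /L /w RintegralB // /Rintegral lerBrDl => hL.
  by rewrite -lerBlDr; apply: le_trans hL hV.
pose f x := ((kap * v x)%:E - J x)%E.
have if_ : mu.-integrable D f by apply: integrableB => //; apply: integrableS ikv.
have mf : measurable_fun D f by have /integrableP[] := if_.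
pose A := D `&` [set x | (0 < f x)%E].
have mA : measurable A by exact: emeasurable_fun_o_infty.
have AD : A `&` D = A by apply/setIidPl => x [].
have mfA : measurable_fun A f by apply: measurable_funS mf => // x [].
have If : (\int[mu]_(x in A) `|f x| = 0)%E.
  apply/eqP; rewrite eq_le integral_ge0 // andbT.
  have -> : (\int[mu]_(x in A) `|f x| = \int[mu]_(x in A) f x)%E.
    by apply: eq_integral => x; rewrite inE => -[_ /ltW] h1; rewrite gee0_abs.
  have iA1 : mu.-integrable A (EFin \o (fun x => kap * v x)) by apply: integrableS ikv.
  have iA2 : mu.-integrable A J by apply: integrableS iJ => // x [].
  have E : (\int[mu]_(x in A) f x = \int[mu]_(x in A) (kap * v x)%:E - \int[mu]_(x in A) J x)%E.
    by rewrite -(integralB mA iA1 iA2); apply: eq_integral.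
  by rewrite E sube_le0; have := le A mA; rewrite AD.
have /(ae_eq_integral_abs mu mA mfA) := If.
apply: filterS => x hx Dx; rewrite leNgt; apply/negP => h1.
have f0 : (0 < f x)%E by rewrite sube_gt0.
have Ax : A x by split.
by move: f0; rewrite (hx Ax) /cst ltxx.
Qed.
End dominated_mollification.

(** * From mollifications to the Riesz potential *)

Section potential_bound.
Variables (R : realType) (n : nat).
Hypothesis n0 : (0 < n)%N.
Local Notation mu := (lebesgue_rV R n).

Lemma riesz_newton (g : 'rV[R]_n -> R) e r y i : measurable_fun setT g ->
  (forall x, 0 <= g x) -> 0 < e <= r ->
  (\int[mu]_x (g x * `|radial (newton n e r) y i x|)%:E <= (4 ^+ n)%:E * riesz g y)%E.
Proof.
move=> mg g0 er.
pose c m : R := 4 ^+ n * rad R m `^ (1 - n%:R).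
have c0 m : 0 <= c m by rewrite mulr_ge0 ?exprn_ge0 ?powR_ge0.
pose f m x : \bar R := ((c m)%:E * ((EFin \o g) \_ (ball y (rad R m))) x)%E.
have mgb m : measurable_fun setT ((EFin \o g) \_ (ball y (rad R m))).
  apply: (measurable_restrictT _ _).1; first exact: measurable_ball_rV.
  by apply: measurable_funTS; exact/measurable_EFinP.
have mf m : measurable_fun setT (f m) by exact: emeasurable_funM.
have gb0 m x : (0 <= ((EFin \o g) \_ (ball y (rad R m))) x)%E.
  by rewrite patchE; case: (_ \in _) => //=; rewrite lee_fin.
have f0 m x : (0 <= f m x)%E by rewrite mule_ge0 ?lee_fin.
have -> : ((4 ^+ n)%:E * riesz g y = \int[mu]_x \sum_(m <oo) f m x)%E.
  rewrite integral_nneseries // -nneseriesZl; last first.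
    move=> m _; rewrite mule_ge0 ?lee_fin ?powR_ge0 //.
    by apply: integral_ge0 => x _; rewrite lee_fin.
  apply: eq_eseriesr => m _; rewrite /f ge0_integralZl //; last by rewrite lee_fin.
  by rewrite -integral_mkcond muleA -EFinM.
apply: ge0_le_integral => //.
- by move=> x _; rewrite lee_fin mulr_ge0.
- apply/measurable_EFinP; apply: measurable_funM => //.
  apply: measurableT_comp => //; apply: continuous_measurable_rV.
  apply: Ck_continuous; have [/(_ 0%N) h _] := @test_function_radial R n (newton n e r) (2 * r ^+ 2) y i
    (fun m => C1k_newton n m er) (fun s => @newton_eq0 R n e r s er).
  exact: h.
- exact: measurable_nneseries.
- move=> x _; have [->|[m xm h]] := radial_newton_bound n0 y i x er.
    by rewrite normr0 mulr0; apply: nneseries_ge0 => m _ _.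
  apply: le_trans (nneseries_ge_term m (fun m => f0 m x)).
  rewrite /f patchE mem_set //= -EFinM lee_fin mulrC.
  exact: ler_wpM2r.
Qed.

(** The total exponent of [r] is [- n / p]. For [n > 0] this is negative. *)
Lemma powR_tail (A p e d : R) : 0 <= A -> 0 < p -> 0 < d ->
  exists r, [/\ e <= r, 0 < r & A * (r^-1 ^+ n * (r ^+ n) `^ (1 - p^-1)) <= d].
Proof.
move=> A0 p0 d0; pose D := (A + 1) / d.
have D0 : 0 < D by rewrite divr_gt0 // ltr_wpDl.
pose r := Num.max (Num.max e 1) (D `^ p).
have r1 : 1 <= r by rewrite !le_max lexx orbT.
have r0 : 0 < r by exact: lt_le_trans ltr01 r1.
exists r; split=> //; first by rewrite !le_max lexx.
have t0 : 0 < r ^+ n by rewrite exprn_gt0.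
have -> : r^-1 ^+ n * (r ^+ n) `^ (1 - p^-1) = ((r ^+ n) `^ p^-1)^-1.
  rewrite exprVn powRD; last by rewrite (gt_eqF t0) implybT.
  by rewrite powRr1 ?(ltW t0) // mulrA mulVf ?(gt_eqF t0) // mul1r powRN.
have h : D <= (r ^+ n) `^ p^-1.
  rewrite -[D]powRr1 ?(ltW D0) // -(mulfV (lt0r_neq0 p0)) powRrM.
  apply: ge0_ler_powR; rewrite ?nnegrE ?powR_ge0 ?invr_ge0 ?(ltW p0) ?(ltW t0) //.
  apply: (@le_trans _ _ r); first by rewrite le_max lexx orbT.
  by apply: ler_eXnr.
rewrite ler_pdivrMr; last exact: lt_le_trans h.
apply: (@le_trans _ _ (d * D)); last by rewrite ler_pM2l.
by rewrite /D mulrCA mulfV ?(gt_eqF d0) // mulr1 lerDl.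
Qed.

Variables (p : R) (u g : 'rV[R]_n -> R) (nu : R).
Hypothesis p1 : 1 < p.
Hypothesis mu_ : measurable_fun setT u.
Hypothesis unu : ((\int[mu]_x (`|u x| `^ p)%:E) `^ p^-1)%E = nu%:E.

Let p0 : 0 < p. Proof. exact: lt_trans ltr01 p1. Qed.
Let mau : measurable_fun setT (fun x => `|u x|). Proof. exact: measurableT_comp. Qed.

Let Lu : (\int[mu]_x (`|u x| `^ p)%:E < +oo)%E.
Proof.
rewrite ltey; apply/eqP => h; move: unu; rewrite h poweRyr //.
by rewrite gt_eqF // invr_gt0.
Qed.

Let u_ball y r : 0 < r ->
  (\int[mu]_(x in ball y r) `|u x|%:E <= (nu * ((2 * r) ^+ n) `^ (1 - p^-1))%:E)%E.
Proof.
move=> r0; rewrite EFinM -unu.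
by apply: (@ball_hoelder R n (fun x => `|u x|) p r y) => // x.
Qed.

Let nu_ge0 : 0 <= nu. Proof. by rewrite -lee_fin -unu poweR_ge0. Qed.

Lemma Lp_local (y : 'rV[R]_n) r : 0 < r -> mu.-integrable (ball y r) (EFin \o u).
Proof.
move=> r0; apply/integrableP; split.
  by apply: measurable_funTS; exact/measurable_EFinP.
by apply: le_lt_trans (u_ball y r0) _; rewrite ltry.
Qed.

Let integrable_u_mollif e y : 0 < e ->
  mu.-integrable setT (fun x => (u x * mollif e (x - y))%:E).
Proof.
by move=> e0; apply: integrable_mul_mollif => //; apply: Lp_local; rewrite mulr_gt0.
Qed.

(** By the inequality of Hoelder, the mollification at the scale [r] of a
    function of [L^p] is at most of order [r ^ (- n / p)]. *)
Let mollify_large y d e : 0 < d -> exists2 r, 0 < r /\ e <= r &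
  `|mollify r u y| <= d.
Proof.
move=> d0; have [C C0 hC] := molli_bounded R n.
have A0 : 0 <= C * nu * (4 ^+ n) `^ (1 - p^-1) by rewrite !mulr_ge0 ?powR_ge0.
have [r [er r0 hr]] := @powR_tail _ p e d A0 p0 d0.
exists r => //; apply: le_trans hr.
have r20 : 0 < 2 * r by rewrite mulr_gt0.
have mB : measurable (ball y (2 * r)) by exact: measurable_ball_rV.
rewrite -lee_fin /mollify EFin_normr_Rintegral //; last exact: integrable_u_mollif.
apply: le_trans (le_abse_integral _ _ _) _ => //.
  by have /integrableP[] := integrable_u_mollif y r0.
have c0 : 0 <= C * r^-1 ^+ n by rewrite mulr_ge0 // exprn_ge0 // invr_ge0 ltW.
apply: (@le_trans _ _ (\int[mu]_x ((C * r^-1 ^+ n)%:E * ((fun x => `|u x|%:E) \_ (ball y (2 * r))) x))%E).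
  apply: ge0_le_integral => //.
  - by apply: measurableT_comp => //; have /integrableP[] := integrable_u_mollif y r0.
  - apply: emeasurable_funM => //; apply: (measurable_restrictT _ _).1 => //.
    by apply: measurable_funTS; exact/measurable_EFinP.
  - move=> x _; rewrite patchE; case: ifPn => [xB|xB].
      rewrite abse_EFin -EFinM lee_fin normrM mulrC ler_wpM2r //.
      by rewrite ger0_norm ?mollif_ge0 //; exact: hC.
    have [->|h] := eqVneq (mollif r (x - y)) 0; first by rewrite mulr0 mule0 abse0.
    by move: xB; rewrite notin_setE => -[]; exact: mollif_supp.
rewrite ge0_integralZl //; last 2 first.
- apply: (measurable_restrictT _ _).1 => //.
  by apply: measurable_funTS; exact/measurable_EFinP.
- by move=> x _; rewrite patchE; case: (_ \in _) => //; rewrite lee_fin.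
rewrite -integral_mkcond; apply: (@le_trans _ _ ((C * r^-1 ^+ n)%:E *
   (nu * ((2 * (2 * r)) ^+ n) `^ (1 - p^-1))%:E)%E).
  by apply: lee_wpmul2l; [rewrite lee_fin|exact: u_ball].
rewrite -EFinM lee_fin mulrA -natrM exprMn powRM ?exprn_ge0 ?(ltW r0) //.
by rewrite le_eqVlt; apply/orP; left; apply/eqP; ring.
Qed.

Hypothesis mg : measurable_fun setT g.
Hypothesis g0 : forall x, 0 <= g x.
Hypothesis hyp : forall e r y, 0 < e <= r ->
  (`|mollify e u y - mollify r u y|%:E <=
   \sum_(i < n) \int[mu]_x (g x * `|radial (newton n e r) y i x|)%:E)%E.

(** The hypothesis [hyp] compares the mollifications at two scales, and the
    one at the larger scale tends to zero. *)
Lemma mollify_le_riesz e y : 0 < e ->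
  (`|mollify e u y|%:E <= (n%:R * 4 ^+ n)%:E * riesz g y)%E.
Proof.
move=> e0; apply/lee_addgt0Pr => d d0.
have [r [r0 er] hr] := mollify_large y e d0.
have err : 0 < e <= r by rewrite e0.
apply: (@le_trans _ _ (`|mollify e u y - mollify r u y|%:E + `|mollify r u y|%:E)%E).
  by rewrite -EFinD lee_fin -{1}(subrK (mollify r u y) (mollify e u y)) ler_normD.
apply: leeD; last by rewrite lee_fin.
apply: le_trans (hyp y err) _.
apply: (@le_trans _ _ (\sum_(i < n) ((4 ^+ n)%:E * riesz g y))%E).
  by apply: lee_sum => i _; exact: riesz_newton.
rewrite EFinM -muleA mule_natl sumr_const card_ord.
by [].
Qed.

Variables (q : R).
Hypotheses (q1 : 1 < q) (pq : p^-1 - q^-1 = n%:R^-1).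
Hypothesis Lg : (\int[mu]_x (g x `^ p)%:E < +oo)%E.

Let mJ : measurable_fun setT (riesz g). Proof. exact: measurable_riesz. Qed.

Let J0 x : (0 <= riesz g x)%E. Proof. exact: riesz_ge0. Qed.

Let Jq : (\int[mu]_x riesz g x `^ q < +oo)%E.
Proof.
have [K K0 hK] := riesz_strong p1 q1 n0 pq.
have fI : (\int[mu]_x (g x `^ p)%:E)%E \is a fin_num.
  by rewrite ge0_fin_numE //; apply: integral_ge0 => x _; rewrite lee_fin powR_ge0.
have := hK g (fine (\int[mu]_x (g x `^ p)%:E)%E `^ p^-1) mg g0.
rewrite -poweR_EFin fineK // => /(_ erefl) h.
by apply: le_lt_trans h _; rewrite ltry.
Qed.

(** The potential is in [L^q], and [t <= 1 + t ^ q]. *)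
Lemma riesz_local (a b : 'I_n -> R) : (mu (obox a b) < +oo)%E ->
  mu.-integrable (obox a b) (riesz g).
Proof.
move=> ab; have mab := measurable_obox a b.
apply/integrableP; split; first exact: measurable_funTS.
apply: (@le_lt_trans _ _ (\int[mu]_(x in obox a b) (1 + riesz g x `^ q))%E).
  apply: ge0_le_integral => //.
  - by apply: measurable_funTS; apply: measurableT_comp.
  - apply: measurable_funTS; apply: emeasurable_funD => //.
    exact: (measurableT_comp (measurable_poweR q)).
  - move=> x _; rewrite gee0_abs //; have [h|h] := leP (riesz g x) 1%E.
      by apply: (le_trans h); rewrite leeDl // poweR_ge0.
    apply: (@le_trans _ _ (riesz g x `^ q)%E); last by rewrite leeDr.
    move: h; case: (riesz g x) (J0 x) => [r r0 r1| |//].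
      rewrite poweR_EFin lee_fin -{1}[r]powRr1 ?ler_powR //; exact: ltW.
    by rewrite poweRyr // gt_eqF // (lt_trans ltr01 q1).
rewrite ge0_integralD //; last 2 first.
- by move=> x _; exact: poweR_ge0.
- by apply: measurable_funTS; exact: (measurableT_comp (measurable_poweR q)).
rewrite lte_add_pinfty //; first by rewrite integral_cst // mul1e.
apply: le_lt_trans Jq; apply: ge0_subset_integral => //.
  exact: (measurableT_comp (measurable_poweR q)).
by move=> x _; exact: poweR_ge0.
Qed.

(** On a box, [u] may be replaced by its restriction to a larger ball, which
    is integrable and has the same mollifications at small scales; then
    [le_of_mollify] applies to this restriction and to its opposite. The boxes
    exhaust the space. *)
Lemma le_riesz : {ae mu, forall x, ((fine (mollif_mass R n) * `|u x|)%:E <= (n%:R * 4 ^+ n)%:E * riesz g x)%E}.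
Proof.
have main N : {ae mu, forall x, obox (fun=> - N.+1%:R) (fun=> N.+1%:R) x ->
    ((fine (mollif_mass R n) * `|u x|)%:E <= (n%:R * 4 ^+ n)%:E * riesz g x)%E}.
  pose z : 'rV[R]_n := 0.
  have N0 : (0:R) < N.+3%:R by [].
  have mB : measurable (ball z N.+3%:R) by exact: measurable_ball_rV.
  set D := obox _ _.
  have DB : D `<=` ball z N.+3%:R.
    move=> x hx; apply/ball_rVP => // i; rewrite mxE sub0r normrN ltr_norml.
    have /andP[h1 h2] := hx i; have h3 : N.+1%:R < N.+3%:R :> R by rewrite ltr_nat.
    by apply/andP; split; [apply: lt_trans h1; rewrite ltrN2|exact: lt_trans h3].
  have mD : measurable D by exact: measurable_obox.
  have muD : (mu D < +oo)%E.
    apply: le_lt_trans (le_measure mu _ _ DB) _; rewrite ?inE //.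
    apply: (le_lt_trans (eq_leW (measure_ball_rV z N0))); exact: ltry.
  have iJ : mu.-integrable D (fun x => (n%:R * 4 ^+ n)%:E * riesz g x)%E.
    by apply: integrableZl => //; exact: riesz_local.
  pose v : 'rV[R]_n -> R := u \_ (ball z N.+3%:R).
  have iv : mu.-integrable setT (EFin \o v).
    have [h _] := @integrable_mkcond _ _ _ mu _ (EFin \o u) mB.
    have := h (Lp_local z N0); rewrite restrict_EFin. exact.
  (* The kernel of scale [1 / (m + 1)] reaches no farther than 2, so from a
     point of the box it does not see beyond the ball of radius [N + 3]. *)
  have vE m y : D y -> mollify m.+1%:R^-1 v y = mollify m.+1%:R^-1 u y.
    move=> Dy; apply: eq_Rintegral => x _; rewrite /v patchE; case: ifPn => //.
    rewrite notin_setE => xB; have [->|h] := eqVneq (mollif m.+1%:R^-1 (x - y)) 0.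
      by rewrite !mulr0.
    exfalso; apply: xB; have m0 : (0:R) < m.+1%:R^-1 by rewrite invr_gt0.
    have := mollif_supp m0 h; have m1 : m.+1%:R^-1 <= 1 :> R.
      by rewrite invf_le1 // ler1n.
    have t0 : 0 < 2 * m.+1%:R^-1 :> R by rewrite mulr_gt0.
    move=> /(ball_rVP _ _ t0) hh; apply/ball_rVP => // i; rewrite mxE sub0r normrN.
    have := hh i; rewrite distrC => hi; have /andP[h1 h2] := Dy i.
    have h3 : `|x 0 i| <= `|x 0 i - y 0 i| + `|y 0 i| by rewrite -{1}(subrK (y 0 i) (x 0 i)) ler_normD.
    apply: le_lt_trans h3 _; have -> : N.+3%:R = 2 + N.+1%:R :> R by rewrite -natrD.
    apply: ltrD; last by rewrite ltr_norml h1.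
    apply: lt_le_trans hi _; rewrite -[leRHS]mulr1; exact: ler_wpM2l.
  have e0 m : (0:R) < m.+1%:R^-1 by rewrite invr_gt0.
  have h1 := le_of_mollify iv iJ; have h2 : {ae mu, forall x, D x ->
      ((fine (mollif_mass R n) * v x)%:E <= (n%:R * 4 ^+ n)%:E * riesz g x)%E}.
    by apply: h1 => m y Dy; rewrite vE //; exact: mollify_le_riesz.
  have iNv : mu.-integrable setT (EFin \o (fun x => - v x)).
    have := integrableN iv; apply: eq_integrable => //.
  have h3 : {ae mu, forall x, D x ->
      ((fine (mollif_mass R n) * - v x)%:E <= (n%:R * 4 ^+ n)%:E * riesz g x)%E}.
    apply: (le_of_mollify iNv iJ) => m y Dy.
    have -> : mollify m.+1%:R^-1 (fun x => - v x) y = - mollify m.+1%:R^-1 v y.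
      rewrite /mollify -mulN1r -RintegralZl //; last exact: integrable_mollifl.
      by apply: eq_Rintegral => x _; rewrite mulrA !mulN1r.
    by rewrite normrN vE //; exact: mollify_le_riesz.
  apply: filterS2 h2 h3 => x hx1 hx2 Dx.
  have vu : v x = u x by rewrite /v patchE mem_set //; exact: DB.
  move: (hx1 Dx) (hx2 Dx); rewrite vu.
  by have [h|h] := leP 0 (u x); [rewrite ger0_norm|rewrite ltr0_norm].
have := ae_foralln main; apply: filterS => x hx.
have [N hN] := rV_bounded x; apply: (hx N) => i.
by rewrite -ltr_norml (lt_trans (hN i)) // ltr_nat.
Qed.

End potential_bound.

(** * Coefficients of alternating forms *)

Section alternating_algebra.
Variables (R : realType) (n : nat).

Lemma row'_eq k (A B : 'M[R]_(k, n)) i :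
  (forall r, r != i -> row r A = row r B) -> row' i A = row' i B.
Proof.
move=> h; apply/matrixP => r c; rewrite !mxE.
have /rowP/(_ c) := h (lift i r) (negbT (lift_eqF i r)).
by rewrite !mxE.
Qed.

Let rows2 k (A : 'M[R]_(k, n)) (i j : 'I_k) (u v : 'rV[R]_n) : 'M[R]_(k, n) :=
  \matrix_(r, c) if r == i then u 0 c else if r == j then v 0 c else A r c.

(** Polarization: the form vanishes on equal rows, in particular on the row
    sums [row i A + row j A] at both places. *)
Lemma alternating_xrow k (w : 'M[R]_(k, n) -> R) i j A : alternating_form w ->
  i != j -> w (xrow i j A) = - w A.
Proof.
move=> [ml alt] ij.
have row_i u v : row i (rows2 A i j u v) = u.
  by apply/rowP => c; rewrite !mxE eqxx.
have row_j u v : row j (rows2 A i j u v) = v.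
  by apply/rowP => c; rewrite !mxE eq_sym (negbTE ij) eqxx.
have row_r u v u' v' r : r != i -> r != j ->
    row r (rows2 A i j u v) = row r (rows2 A i j u' v').
  by move=> ri rj; apply/rowP => c; rewrite !mxE (negbTE ri) (negbTE rj).
have addl u u' v : w (rows2 A i j (u + u') v) = w (rows2 A i j u v) + w (rows2 A i j u' v).
  rewrite (ml _ (rows2 A i j u v) (rows2 A i j u' v) i 1 1) ?mul1r //.
  - by rewrite !row_i !scale1r.
  - apply: row'_eq => r ri; have [->|rj] := eqVneq r j; first by rewrite !row_j.
    exact: row_r.
  - apply: row'_eq => r ri; have [->|rj] := eqVneq r j; first by rewrite !row_j.
    exact: row_r.
have addr u v v' : w (rows2 A i j u (v + v')) = w (rows2 A i j u v) + w (rows2 A i j u v').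
  rewrite (ml _ (rows2 A i j u v) (rows2 A i j u v') j 1 1) ?mul1r //.
  - by rewrite !row_j !scale1r.
  - apply: row'_eq => r rj; have [->|ri] := eqVneq r i; first by rewrite !row_i.
    exact: row_r.
  - apply: row'_eq => r rj; have [->|ri] := eqVneq r i; first by rewrite !row_i.
    exact: row_r.
have same u : w (rows2 A i j u u) = 0 by apply: (alt _ i j) => //; rewrite row_i row_j.
have := same (row i A + row j A); rewrite addl !addr !same add0r addr0.
have -> : rows2 A i j (row i A) (row j A) = A.
  apply/matrixP => r c; rewrite !mxE; case: eqP => [->//|_].
  by case: eqP => [->|].
have -> : rows2 A i j (row j A) (row i A) = xrow i j A.
  apply/matrixP => r c; rewrite !mxE; case: tpermP => [->|->|/eqP ri /eqP rj].
  - by rewrite eqxx.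
  - by rewrite eq_sym (negbTE ij) eqxx.
  - by rewrite (negbTE ri) (negbTE rj).
by move/eqP; rewrite addrC addr_eq0 => /eqP.
Qed.

Lemma alternating_perm k (s : 'S_k) : exists2 c : R, `|c| = 1 &
  forall w : 'M[R]_(k, n) -> R, alternating_form w -> forall A, w (row_perm s A) = c * w A.
Proof.
have [ts -> dts] := prod_tpermP s.
elim: ts dts => [_|[i j] ts IH /= /andP[ij dts]].
  by exists 1; [rewrite normr1|move=> w _ A; rewrite big_nil row_perm1 mul1r].
have [c c1 hc] := IH dts; exists (- c); first by rewrite normrN.
move=> w aw A; rewrite big_cons /= row_permM.
have -> : row_perm (tperm i j) (row_perm (\prod_(t <- ts) tperm t.1 t.2)%g A) =
   xrow i j (row_perm (\prod_(t <- ts) tperm t.1 t.2)%g A) by [].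
by rewrite alternating_xrow // hc // mulNr.
Qed.

(** If two of the vectors coincide the form vanishes; otherwise sorting the
    indices changes it by a sign. *)
Lemma alternating_coef k (g : {ffun 'I_k -> 'I_n}) :
  (forall w : 'M[R]_(k, n) -> R, alternating_form w -> w (rowsub g 1%:M) = 0) \/
  exists f : {ffun 'I_k -> 'I_n}, exists2 c : R, multi_index f /\ `|c| = 1 &
    forall w : 'M[R]_(k, n) -> R, alternating_form w ->
      w (rowsub g 1%:M) = c * w (rowsub f 1%:M).
Proof.
have [inj|ninj] := boolP (injectiveb g); last first.
  left=> w [_ alt]; have [i [j ij gij]] := injectivePn _ ninj.
  by apply: (alt _ i j) => //; apply/rowP => c; rewrite !mxE gij.
right; have ginj := injectiveP _ inj.
pose le (a b : 'I_n) := (a <= b)%N.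
have le_tot : total le by move=> a b; exact: leq_total.
have le_tr : transitive le by move=> a b c; exact: leq_trans.
pose t := [tuple g i | i < k]; have st : sorted le (sort le t) by exact: sort_sorted.
have /tuple_permP[s ts] : perm_eq (sort le t) t by rewrite perm_sort.
have hs i : nth (g i) (sort le t) i = g (s i).
  by rewrite ts -tnth_nth !tnth_mktuple.
pose f : {ffun 'I_k -> 'I_n} := [ffun i => g (s i)].
have [c c1 hc] := alternating_perm s.
exists f; exists c^-1.
  split; last by rewrite normfV c1 invr1.
  apply/forallP => i; apply/forallP => j; apply/implyP => ij.
  have ij' : i != j by rewrite -val_eqE /= ltn_eqF.
  have sz (l : 'I_k) : (l < size (sort le t))%N by rewrite size_sort size_tuple.
  have := sorted_ltn_nth le_tr (g i) st i j (sz i) (sz j) ij.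
  rewrite hs (set_nth_default (g j)) // hs /le => h; rewrite !ffunE ltn_neqAle h andbT.
  by rewrite val_eqE (inj_eq ginj) (inj_eq perm_inj).
move=> w aw; have := hc w aw (rowsub g 1%:M).
have -> : row_perm s (rowsub g 1%:M) = rowsub f 1%:M :> 'M[R]_(k, n).
  by apply/matrixP => i j; rewrite !mxE ffunE.
by move=> ->; rewrite mulrA mulVf ?mul1r // -normr_eq0 c1 oner_neq0.
Qed.

Lemma form_coef_le k (w : 'M[R]_(k, n) -> R) (f : {ffun 'I_k -> 'I_n}) :
  multi_index f -> `|w (rowsub f 1%:M)| <= form_norm w.
Proof.
move=> mf; rewrite -sqrtr_sqr; apply: ler_wsqrtr.
rewrite (bigD1 f) //= lerDl; apply: sumr_ge0 => g _; exact: sqr_ge0.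
Qed.

Lemma alternating_le k (w : 'M[R]_(k, n) -> R) (g : {ffun 'I_k -> 'I_n}) :
  alternating_form w -> `|w (rowsub g 1%:M)| <= form_norm w.
Proof.
move=> aw; have [h|[f [c [mf c1] h]]] := alternating_coef g.
  by rewrite h // normr0 sqrtr_ge0.
by rewrite h // normrM c1 mul1r form_coef_le.
Qed.

End alternating_algebra.

(** * Norms in Lebesgue spaces *)

Section Lp_norm.
Local Open Scope ereal_scope.
Variables (d : measure_display) (T : measurableType d) (R : realType).
Variables (mu : {measure set T -> \bar R}) (p : R).
Hypothesis p1 : (1 < p)%R.

Let p0 : (0 < p)%R. Proof. exact: lt_trans ltr01 p1. Qed.

Lemma Rintegral_sum (I : Type) (s : seq I) (F : I -> T -> R) :
  (forall i, mu.-integrable setT (EFin \o F i)) ->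
  (\sum_(i <- s) \int[mu]_x F i x = \int[mu]_x (\sum_(i <- s) F i x))%R.
Proof.
move=> iF; have iS (r : seq I) : mu.-integrable setT (fun x => (\sum_(i <- r) F i x)%R%:E).
  have := integrable_sum measurableT r (P := xpredT) (fun i _ => iF i).
  by apply: eq_integrable => // x _; rewrite sumEFin.
elim: s => [|i s IH].
  rewrite big_nil; under eq_Rintegral do rewrite big_nil.
  by rewrite /Rintegral integral0.
rewrite big_cons IH -RintegralD //; last exact: iS.
by apply: eq_Rintegral => x _; rewrite big_cons.
Qed.

Lemma LfunE (f : T -> R) : (f \in Lfun mu p%:E) <->
  measurable_fun setT f /\ Lnorm mu p%:E (EFin \o f) < +oo.
Proof.
split.
  move=> h; split; first by have := sub_Lfun_mfun h; rewrite inE.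
  by have := sub_Lfun_finLfun h; rewrite inE.
by move=> [h1 h2]; apply/andP; split; rewrite inE.
Qed.

Lemma le_Lnorm (f g : T -> R) : measurable_fun setT f -> measurable_fun setT g ->
  (forall x, `|f x| <= `|g x|)%R ->
  Lnorm mu p%:E (EFin \o f) <= Lnorm mu p%:E (EFin \o g).
Proof.
move=> mf mg fg; rewrite unlock /Lnorm.
apply: gt0_ler_poweR; rewrite ?invr_ge0 ?(ltW p0) //.
- by rewrite in_itv /= leey andbT; apply: integral_ge0.
- by rewrite in_itv /= leey andbT; apply: integral_ge0.
apply: ge0_le_integral => //.
- by move=> x _; exact: poweR_ge0.
- apply: (measurableT_comp (measurable_poweR p)); apply: measurableT_comp => //.
  exact/measurable_EFinP.
- apply: (measurableT_comp (measurable_poweR p)); apply: measurableT_comp => //.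
  exact/measurable_EFinP.
- move=> x _; rewrite !poweR_EFin lee_fin; apply: ge0_ler_powR; rewrite ?nnegrE ?(ltW p0) //.
Qed.

Lemma Lnorm_sum (I : Type) (r : seq I) (P : pred I) (F : I -> T -> R) :
  (forall i, measurable_fun setT (F i)) ->
  Lnorm mu p%:E (fun x => (\sum_(i <- r | P i) F i x)%:E)
    <= \sum_(i <- r | P i) Lnorm mu p%:E (EFin \o F i).
Proof.
move=> mF; elim: r => [|i r IH].
  rewrite big_nil (eq_Lnorm mu p%:E (g := cst 0)); last by move=> x; rewrite big_nil.
  by rewrite Lnorm0 // eqe gt_eqF.
rewrite big_cons; case: ifPn => iP; last first.
  rewrite (eq_Lnorm mu p%:E (g := fun x => (\sum_(i <- r | P i) F i x)%:E)) //.
  by move=> x; rewrite big_cons (negbTE iP).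
rewrite (eq_Lnorm mu p%:E (g := EFin \o (F i \+ (fun x => \sum_(i <- r | P i) F i x))%R)); last first.
  by move=> x; rewrite big_cons iP.
apply: le_trans (@minkowski_EFin _ _ _ mu (F i) _ p (mF i) _ (ltW p1)) _; last exact: leeD.
rewrite (_ : (fun _ => _) = fun x => \sum_(i <- [seq i <- r | P i]) F i x)%R; first exact: measurable_sum.
by apply/funext => x; rewrite big_filter.
Qed.

Lemma Lnorm_scale (c : R) (f : T -> R) : measurable_fun setT f ->
  Lnorm mu p%:E (fun x => (c * f x)%:E) = `|c|%:E * Lnorm mu p%:E (EFin \o f).
Proof.
move=> mf; rewrite unlock /Lnorm.
rewrite (eq_integral (fun x => (`|c| `^ p)%:E * (`|(f x)%:E| `^ p))); last first.
  by move=> x _; rewrite !abse_EFin !poweR_EFin -EFinM normrM powRM.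
rewrite ge0_integralZl //.
- rewrite poweRM ?lee_fin ?powR_ge0 //; last by apply: integral_ge0 => x _; exact: poweR_ge0.
  by rewrite poweR_EFin -powRrM mulfV ?gt_eqF // powRr1.
- apply: (measurableT_comp (measurable_poweR p)); apply: measurableT_comp => //.
  exact/measurable_EFinP.
- by move=> x _; exact: poweR_ge0.
Qed.

End Lp_norm.

(** * Norms of forms *)

Section Lp_forms.
Variables (R : realType) (n : nat).
Local Notation mu := (lebesgue_rV R n).
Variable p : R.
Hypothesis p1 : 1 < p.

Lemma measurable_form_coef k (eta : 'rV[R]_n -> 'M[R]_(k, n) -> R) (g : {ffun 'I_k -> 'I_n}) :
  Lp_form p eta -> measurable_fun setT (fun x => eta x (rowsub g 1%:M)).
Proof.
move=> [aeta heta]; have [h|[f [c [mf c1] h]]] := alternating_coef R g.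
  by rewrite (_ : (fun _ => _) = cst 0) //; apply/funext => x; rewrite h.
rewrite (_ : (fun _ => _) = (fun x => c * form_coef (eta x) f)); last first.
  by apply/funext => x; rewrite h.
by apply: measurable_funM => //; have /LfunE[] := heta f mf.
Qed.

Lemma measurable_form_norm k (eta : 'rV[R]_n -> 'M[R]_(k, n) -> R) :
  Lp_form p eta -> measurable_fun setT (fun x => form_norm (eta x)).
Proof.
move=> Leta; rewrite (_ : (fun _ => _) = fun x => (\sum_(f <- [seq f <- enum {ffun 'I_k -> 'I_n} | multi_index f])
   form_coef (eta x) f ^+ 2) `^ 2^-1).
  apply: (measurableT_comp (measurable_powR _)).
  by apply: measurable_sum => f; apply: measurable_funX; exact: measurable_form_coef.
apply/funext => x; rewrite /form_norm powR12_sqrt; last by apply: sumr_ge0 => f _; exact: sqr_ge0.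
by rewrite big_filter big_enum_cond.
Qed.

Lemma form_norm_le k (w : 'M[R]_(k, n) -> R) :
  form_norm w <= \sum_(f : {ffun 'I_k -> 'I_n} | multi_index f) `|form_coef w f|.
Proof.
rewrite -[leRHS]ger0_norm ?sumr_ge0 // -sqrtr_sqr; apply: ler_wsqrtr.
rewrite expr2 mulr_suml; apply: ler_sum => f mf.
rewrite -[leLHS]ger0_norm ?sqr_ge0 // normrX expr2; apply: ler_wpM2l => //.
by rewrite (bigD1 f) //= lerDl sumr_ge0.
Qed.

Lemma form_Lnorm_le_coef s k (eta : 'rV[R]_n -> 'M[R]_(k, n) -> R) :
  1 < s -> Lp_form p eta ->
  (form_Lnorm s eta <= \sum_(f : {ffun 'I_k -> 'I_n} | multi_index f)
    Lnorm mu s%:E (EFin \o (fun x => form_coef (eta x) f)))%E.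
Proof.
move=> s1 Leta.
pose S x := \sum_(f : {ffun 'I_k -> 'I_n} | multi_index f) `|form_coef (eta x) f|.
have mc f : measurable_fun setT (fun x => `|form_coef (eta x) f|).
  by apply: measurableT_comp => //; exact: measurable_form_coef.
have mS : measurable_fun setT S.
  rewrite (_ : S = fun x => \sum_(f <- [seq f <- enum {ffun 'I_k -> 'I_n} | multi_index f])
    `|form_coef (eta x) f|); first exact: measurable_sum.
  by apply/funext => x; rewrite big_filter big_enum_cond.
apply: (@le_trans _ _ (Lnorm mu s%:E (EFin \o S))).
  apply: le_Lnorm => //; first exact: measurable_form_norm.
  move=> x; rewrite ger0_norm ?sqrtr_ge0 // ger0_norm ?form_norm_le //.
  exact: sumr_ge0.
apply: le_trans (Lnorm_sum mu s1 _ _ mc) _; apply: lee_sum => f _.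
by rewrite (_ : _ \o _ = abse \o (EFin \o (fun x => form_coef (eta x) f))) ?Lnorm_abse.
Qed.

Lemma form_Lnorm_lty k (eta : 'rV[R]_n -> 'M[R]_(k, n) -> R) :
  Lp_form p eta -> (form_Lnorm p eta < +oo)%E.
Proof.
move=> Leta; apply: le_lt_trans (form_Lnorm_le_coef p1 Leta) _.
elim/big_ind: _ => // [a b ha hb|f mf]; first exact: lte_add_pinfty.
by have [_ /(_ f mf)/LfunE[]] := Leta.
Qed.

End Lp_forms.

(** * The Hodge identity for currents *)

Section hodge.
Variables (R : realType) (n : nat).

(** [col_mx] with [k.+1] rows instead of [1 + k]. *)
Definition cons_row k (v : 'rV[R]_n) (B : 'M[R]_(k, n)) : 'M[R]_(k.+1, n) := col_mx v B.

Lemma cons_row0 k v (B : 'M[R]_(k, n)) j : cons_row v B ord0 j = v 0 j.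
Proof.
rewrite /cons_row; have -> : ord0 = lshift k (0 : 'I_1) :> 'I_(1 + k) by exact: val_inj.
exact: col_mxEu.
Qed.

Lemma cons_rowS k v (B : 'M[R]_(k, n)) l j : cons_row v B (lift ord0 l) j = B l j.
Proof.
rewrite /cons_row; have -> : lift ord0 l = rshift 1 l :> 'I_(1 + k) by exact: val_inj.
exact: col_mxEd.
Qed.

Lemma row'0_cons k v (B : 'M[R]_(k, n)) : row' ord0 (cons_row v B) = B.
Proof. by apply/matrixP => l j; rewrite mxE cons_rowS. Qed.

Lemma row'S_cons k v (B : 'M[R]_(k.+1, n)) l :
  row' (lift ord0 l) (cons_row v B) = cons_row v (row' l B).
Proof.
apply/matrixP => r j; rewrite mxE; case: (unliftP ord0 r) => [r' ->|->].
  have -> : lift (lift ord0 l) (lift ord0 r') = lift ord0 (lift l r').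
    by apply: val_inj; rewrite /= /fintype.bump /= !add1n ltnS; case: leqP.
  by rewrite !cons_rowS mxE.
have -> : lift (lift ord0 l) ord0 = ord0 by exact: val_inj.
by rewrite !cons_row0.
Qed.

(** The identity [iota_i (dx_j /\ w) + dx_j /\ iota_i w = delta_ij w]
    contracted with the matrix of the [d_j V_i]. The symmetry of this matrix
    turns the mixed terms into those of [delta]. In other words,
    [d delta + delta d] is minus the Laplacian, tested with the gradient of a
    potential. *)
Lemma current_hodge k (T : current R n k) (V : 'I_n -> 'rV[R]_n -> R) (B : 'M[R]_(k, n)) :
  (forall i j, partial j (V i) = partial i (V j)) ->
  \sum_(i < n) T (partial i (V i)) B =
  - (\sum_(i < n) current_d T (V i) (col_mx (delta_mx 0 i : 'rV[R]_n) B : 'M[R]_(k.+1, n))) +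
  \sum_(l < k) \sum_(i < n) (-1) ^+ l * B l i * current_delta T (V i) (row' l B).
Proof.
move=> Vsym.
have E i : current_d T (V i) (cons_row (delta_mx 0 i : 'rV[R]_n) B) =
   - T (partial i (V i)) B + \sum_(l < k) \sum_(j < n) (-1) ^+ l * B l j *
     T (partial j (V i)) (row' (lift ord0 l) (cons_row (delta_mx 0 i : 'rV[R]_n) B)).
  rewrite /current_d /dx_wedge /current_partial exchange_big big_ord_recl; congr (_ + _).
    rewrite (bigD1 i) //= [X in _ + X]big1 ?addr0.
      by rewrite expr0 mul1r cons_row0 mxE !eqxx mul1r row'0_cons.
    by move=> j ji; rewrite cons_row0 mxE eqxx (negbTE ji) mulr0 mul0r.
  apply: eq_bigr => l _; apply: eq_bigr => j _.
  by rewrite cons_rowS /= /bump /= exprD expr1 !mulN1r mulNr mulrNN.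
under [X in - X]eq_bigr do rewrite E.
rewrite big_split /= sumrN opprD opprK -addrA -[LHS]addr0; congr (_ + _).
apply/esym/eqP; rewrite addrC subr_eq0; apply/eqP; rewrite [RHS]exchange_big.
apply: eq_bigr => l _; rewrite [RHS]exchange_big; apply: eq_bigr => i _ /=.
case: k T B E l => [|k] T B E l; first by case: l.
rewrite /current_delta /iota_dx /current_partial -sumrN mulr_sumr.
by apply: eq_bigr => j _; rewrite opprK row'S_cons Vsym.
Qed.

Local Notation mu := (lebesgue_rV R n).

(** If the integral on the left is infinite its real value is zero. *)
Lemma Rintegral_le (F : 'rV[R]_n -> R) : measurable_fun setT F ->
  (`|\int[mu]_x F x|%:E <= \int[mu]_x `|F x|%:E)%E.
Proof.
move=> mF; apply: (@le_trans _ _ `|\int[mu]_x (F x)%:E|%E).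
  rewrite /Rintegral; case: (\int[mu]_x (F x)%:E)%E => [r| |] //=; by rewrite normr0 leey.
by apply: le_trans (le_abse_integral _ _ _) _ => //; exact/measurable_EFinP.
Qed.

Lemma continuous_bounded_ball (phi : 'rV[R]_n -> R) (y : 'rV[R]_n) r : 0 < r -> continuous phi ->
  exists2 C, 0 <= C & forall x, ball y r x -> `|phi x| <= C.
Proof.
move=> r0 cphi.
have cK := @rV_compact R n (fun i => `[y 0 i - r, y 0 i + r]%classic)
   (fun i => @segment_compact R (y 0 i - r) (y 0 i + r)).
have cphiK : compact (phi @` [set v : 'rV[R]_n | forall i, `[y 0 i - r, y 0 i + r]%classic (v ord0 i)]).
  by apply: continuous_compact => //; exact: continuous_subspaceT.
have [M [Mr hM]] := compact_bounded cphiK.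
exists `|M + 1| => // x xB; apply: le_trans (ler_norm _).
apply: (hM (M + 1)); first by rewrite ltrDl.
exists x => // i; have := (ball_rVP y x r0).1 xB i; rewrite /= in_itv /= ltr_norml => /andP[h1 h2].
by apply/andP; split; lra.
Qed.

Variables (e r : R) (y : 'rV[R]_n).
Hypothesis er : 0 < e <= r.
Local Notation V := (radial (newton n e r) y).

Let e0 : 0 < e. Proof. by case/andP: er. Qed.
Let r0 : 0 < r. Proof. by case/andP: er => h1 h2; exact: lt_le_trans h2. Qed.

Lemma partial_newton_sym i j : partial j (V i) = partial i (V j).
Proof.
apply/funext => x; have C1 := C1k_newton n 1 er.
rewrite /partial; have -> := @derive_val _ _ _ _ _ _ _ (is_derive_radial y i j x C1).
have -> := @derive_val _ _ _ _ _ _ _ (is_derive_radial y j i x C1).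
by rewrite [j == i]eq_sym; congr (_ + _ * _); ring.
Qed.

Lemma partial_newton_div x :
  \sum_(i < n) partial i (V i) x = mollif e (x - y) - mollif r (x - y).
Proof.
have C1 := C1k_newton n 1 er.
rewrite !mollifE -newton_div //; last exact: sqnorm_ge0.
under eq_bigr => i _.
  rewrite /partial; have -> := @derive_val _ _ _ _ _ _ _ (is_derive_radial y i i x C1).
  rewrite eqxx mul1r. over.
rewrite big_split /= sumr_const card_ord mulr_natl; congr (_ + _).
rewrite -mulr_suml; congr (_ * _); rewrite /sqnorm mulr_sumr; apply: eq_bigr => i _.
by rewrite !mxE -mulrA expr2.
Qed.

Lemma test_newton i : test_function (V i).
Proof.
apply: (@test_function_radial R n (newton n e r) (2 * r ^+ 2)) => [m|s].
  exact: C1k_newton.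
exact: newton_eq0.
Qed.

Lemma partial_newton_supp i j x : partial j (V i) x != 0 -> ball y (2 * r) x.
Proof.
apply: contraNP => xB; apply/eqP.
have r20 : 0 < 2 * r by rewrite mulr_gt0.
have hs : 2 * r ^+ 2 < sqnorm (x - y).
  rewrite ltNge; apply: contra_notN xB => h; apply: sqnorm_lt_ball => //.
  by apply: le_lt_trans h _; rewrite exprMn ltr_pM2r ?exprn_gt0 // expr2; lra.
rewrite /partial -(@near_eq_derive _ _ _ (cst 0)) ?derive_cst //.
have cs : {for x, continuous (fun z : 'rV[R]_n => sqnorm (z - y))}.
  have := Ck_continuous (Ck_sqnorm 0 y); exact.
have hn : \forall z \near x, 2 * r ^+ 2 < sqnorm (z - y) by exact: (cvgr_gt _ cs _ hs).
apply: filterS hn => z hz.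
by rewrite /radial newton_eq0 ?mulr0.
Qed.

Variable u : 'rV[R]_n -> R.
Hypothesis mu_ : measurable_fun setT u.
Hypothesis iu : forall z r, 0 < r -> mu.-integrable (ball z r) (EFin \o u).

Lemma integrable_mul_partial i j :
  mu.-integrable setT (EFin \o (fun x => u x * partial j (V i) x)).
Proof.
have r20 : 0 < 2 * r by rewrite mulr_gt0.
have [h _] := test_newton i.
have cp : continuous (partial j (V i)) by case: (h 1%N) => _ /(_ j)[].
have [C C0 hC] := continuous_bounded_ball y r20 cp.
apply: (@integrable_mul_ball R n u (partial j (V i)) y (2 * r) C) => //.
- exact: iu.
- exact: continuous_measurable_rV.
- move=> x; have [->|/partial_newton_supp/hC//] := eqVneq (partial j (V i) x) 0.
  by rewrite normr0.
- by move=> x; exact: partial_newton_supp.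
Qed.

Lemma mollify_newton : mollify e u y - mollify r u y =
  \sum_(i < n) \int[mu]_x (u x * partial i (V i) x).
Proof.
have im s : 0 < s -> mu.-integrable setT (EFin \o (fun x => u x * mollif s (x - y))).
  by move=> s0; apply: integrable_mul_mollif => //; apply: iu; rewrite mulr_gt0.
rewrite Rintegral_sum; last by move=> i; exact: integrable_mul_partial.
rewrite /mollify -RintegralB //; last 2 first.
- exact: im.
- exact: im.
by apply: eq_Rintegral => x _; rewrite -mulrBr -partial_newton_div mulr_sumr.
Qed.
End hodge.

(** * Mollified coefficients and the two differentials *)

Section hodge_bound.
Variables (R : realType) (n : nat) (p : R) (k : nat).
Local Notation mu := (lebesgue_rV R n).
Variable theta : 'rV[R]_n -> 'M[R]_(k, n) -> R.
Variable eta1 : 'rV[R]_n -> 'M[R]_(k.+1, n) -> R.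
Variable eta2 : 'rV[R]_n -> 'M[R]_(k.-1, n) -> R.
Hypothesis Lt : Lp_form p theta.
Hypothesis L1 : Lp_form p eta1.
Hypothesis L2 : Lp_form p eta2.
Hypothesis d1 : forall phi, test_function phi ->
  current_d (current_of theta) phi =1 current_of eta1 phi.
Hypothesis d2 : forall phi, test_function phi ->
  current_delta (current_of theta) phi =1 current_of eta2 phi.

(** The factor [k] counts the terms of the sum over [l] in [current_hodge]. *)
Definition diff_norm (x : 'rV[R]_n) : R := form_norm (eta1 x) + k%:R * form_norm (eta2 x).

Lemma diff_norm_ge0 x : 0 <= diff_norm x.
Proof. by rewrite addr_ge0 ?mulr_ge0 ?sqrtr_ge0. Qed.

Lemma measurable_diff_norm : measurable_fun setT diff_norm.
Proof.
apply: measurable_funD; first exact: measurable_form_norm L1.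
by apply: measurable_funM => //; exact: measurable_form_norm L2.
Qed.

Variable f : {ffun 'I_k -> 'I_n}.
Local Notation B := (rowsub f 1%:M : 'M[R]_(k, n)).
Local Notation u := (fun x => form_coef (theta x) f).

Let mV (e r : R) (y : 'rV[R]_n) i : 0 < e <= r -> measurable_fun setT (radial (newton n e r) y i).
Proof.
move=> er; apply: continuous_measurable_rV; have [h _] := test_newton y er i.
exact: (Ck_continuous (h 0%N)).
Qed.

Let term_le j (eta : 'rV[R]_n -> 'M[R]_(j, n) -> R) (g : {ffun 'I_j -> 'I_n}) (e r : R) y i :
  0 < e <= r -> Lp_form p eta ->
  (`|current_of eta (radial (newton n e r) y i) (rowsub g 1%:M)|%:E <=
   \int[mu]_x (form_norm (eta x) * `|radial (newton n e r) y i x|)%:E)%E.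
Proof.
move=> er Leta; have mg := measurable_form_coef g Leta.
apply: le_trans (Rintegral_le _) _; first by apply: measurable_funM => //; exact: mV.
apply: ge0_le_integral => //.
- apply/measurable_EFinP; apply: measurableT_comp => //.
  by apply: measurable_funM => //; exact: mV.
- apply/measurable_EFinP; apply: measurable_funM; first exact: measurable_form_norm Leta.
  by apply: measurableT_comp => //; exact: mV.
- move=> x _; rewrite lee_fin normrM ler_wpM2r //; apply: alternating_le.
  by case: Leta.
Qed.

(** Every value of [d theta] and [delta theta] in [current_hodge] is a
    coefficient of [eta1] or [eta2], up to a factor of absolute value at most
    one, since the rows of [B] are basis vectors. *)
Lemma hodge_bound (e r : R) y : (forall z r, 0 < r -> mu.-integrable (ball z r) (EFin \o u)) ->
  0 < e <= r ->
  (`|mollify e u y - mollify r u y|%:E <=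
   \sum_(i < n) \int[mu]_x (diff_norm x * `|radial (newton n e r) y i x|)%:E)%E.
Proof.
move=> iu er.
have mu_ : measurable_fun setT u by exact: (measurable_form_coef f Lt).
rewrite (mollify_newton y er mu_ iu).
have -> : \sum_(i < n) \int[mu]_x (u x * partial i (radial (newton n e r) y i) x) =
  \sum_(i < n) current_of theta (partial i (radial (newton n e r) y i)) B by [].
rewrite (current_hodge _ _ (partial_newton_sym y er)).
pose fi i : {ffun 'I_k.+1 -> 'I_n} := [ffun r => if unlift ord0 r is Some r' then f r' else i].
have Bi i : (col_mx (delta_mx 0 i : 'rV[R]_n) B : 'M[R]_(k.+1, n)) = rowsub (fi i) 1%:M.
  apply/matrixP => a c; rewrite !mxE ffunE; case: (unliftP ord0 a) => [a' ->|->].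
    case: splitP => j' /=; first by rewrite ord1 /fintype.bump.
    rewrite /fintype.bump /= !add1n => -[] /val_inj <-; by rewrite !mxE.
  by case: splitP => j' //= _; rewrite ord1 mxE eqxx [i == c]eq_sym.
pose gl (l : 'I_k) : {ffun 'I_k.-1 -> 'I_n} := [ffun r => f (lift l r)].
have Bl l : row' l B = rowsub (gl l) 1%:M by apply/matrixP => a c; rewrite !mxE ffunE.
pose P i := (\int[mu]_x (form_norm (eta1 x) * `|radial (newton n e r) y i x|)%:E)%E.
pose Q i := (\int[mu]_x (form_norm (eta2 x) * `|radial (newton n e r) y i x|)%:E)%E.
have mVa i : measurable_fun setT (fun x => `|radial (newton n e r) y i x|).
  by apply: measurableT_comp => //; exact: mV.
have P0 i : (0 <= P i)%E.
  by apply: integral_ge0 => x _; rewrite lee_fin mulr_ge0 ?sqrtr_ge0.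
have Q0 i : (0 <= Q i)%E.
  by apply: integral_ge0 => x _; rewrite lee_fin mulr_ge0 ?sqrtr_ge0.
have PQ i : (\int[mu]_x (diff_norm x * `|radial (newton n e r) y i x|)%:E = P i + k%:R%:E * Q i)%E.
  rewrite -ge0_integralZl //; last 2 first.
  - by apply/measurable_EFinP; apply: measurable_funM => //; exact: measurable_form_norm L2.
  - by move=> x _; rewrite lee_fin mulr_ge0 ?sqrtr_ge0.
  rewrite -ge0_integralD //; last 4 first.
  - by move=> x _; rewrite lee_fin mulr_ge0 ?sqrtr_ge0.
  - by apply/measurable_EFinP; apply: measurable_funM => //; exact: measurable_form_norm L1.
  - by move=> x _; rewrite -EFinM lee_fin !mulr_ge0 ?sqrtr_ge0.
  - apply: emeasurable_funM => //.
    by apply/measurable_EFinP; apply: measurable_funM => //; exact: measurable_form_norm L2.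
  by apply: eq_integral => x _; rewrite -EFinM -EFinD /diff_norm mulrDl mulrA.
have -> : (\sum_(i < n) \int[mu]_x (diff_norm x * `|radial (newton n e r) y i x|)%:E =
    \sum_(i < n) P i + \sum_(i < n) (k%:R%:E * Q i))%E.
  by rewrite -big_split; apply: eq_bigr => i _; exact: PQ.
apply: (@le_trans _ _ (\sum_(i < n) `|current_d (current_of theta) (radial (newton n e r) y i) (rowsub (fi i) 1%:M)| +
  \sum_(l < k) \sum_(i < n) `|current_delta (current_of theta) (radial (newton n e r) y i) (rowsub (gl l) 1%:M)|)%:E%R).
  rewrite lee_fin; apply: le_trans (ler_normD _ _) _; rewrite normrN; apply: lerD.
    apply: le_trans (ler_norm_sum _ _ _) _; apply: ler_sum => i _.
    by rewrite Bi.
  apply: le_trans (ler_norm_sum _ _ _) _; apply: ler_sum => l _.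
  apply: le_trans (ler_norm_sum _ _ _) _; apply: ler_sum => i _.
  rewrite Bl normrM ler_piMl // normrM normrX normrN1 expr1n mul1r !mxE.
  by case: (_ == _); rewrite ?normr1 ?normr0.
rewrite EFinD -sumEFin; apply: leeD.
  apply: lee_sum => i _; rewrite d1; last exact: test_newton.
  exact: term_le.
rewrite -sumEFin; apply: (@le_trans _ _ (\sum_(l < k) \sum_(i < n) Q i)%E).
  apply: lee_sum => l _; rewrite -sumEFin; apply: lee_sum => i _.
  by rewrite d2; [exact: term_le|exact: test_newton].
rewrite sumr_const card_ord -ge0_sume_distrr //.
by rewrite mule_natl.
Qed.

End hodge_bound.

(** * The inequality for the critical exponents *)

Section sufficiency.
Variables (R : realType) (p q : R) (n k : nat).
Local Notation mu := (lebesgue_rV R n).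
Hypotheses (p1 : 1 < p) (q1 : 1 < q) (n0 : (0 < n)%N) (pq : p^-1 - q^-1 = n%:R^-1).

Let p0 : 0 < p. Proof. exact: lt_trans ltr01 p1. Qed.
Let q0 : 0 < q. Proof. exact: lt_trans ltr01 q1. Qed.

(** The two sets are the norms of the forms that represent [d theta] and
    [delta theta]. An empty set has infimum [+oo]. *)
Lemma ereal_inf_add (S1 S2 : set \bar R) X :
  (forall a, S1 a -> 0 <= a < +oo)%E -> (forall b, S2 b -> 0 <= b < +oo)%E ->
  (forall a b, S1 a -> S2 b -> X <= a + b)%E ->
  (X <= ereal_inf S1 + ereal_inf S2)%E.
Proof.
move=> h1 h2 h.
have i1 : (0 <= ereal_inf S1)%E by apply: le_ereal_inf_tmp => a /h1/andP[].
have i2 : (0 <= ereal_inf S2)%E by apply: le_ereal_inf_tmp => a /h2/andP[].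
have [->|n1] := eqVneq (ereal_inf S1) +oo%E.
  by rewrite addye ?leey // gt_eqF // (lt_le_trans _ i2).
have f1 : ereal_inf S1 \is a fin_num by rewrite ge0_fin_numE // ltey.
rewrite -leeBlDl //; apply: le_ereal_inf_tmp => b Sb.
have fb : b \is a fin_num by have /andP[b0 bo] := h2 b Sb; rewrite ge0_fin_numE.
rewrite leeBlDl // -leeBlDr //; apply: le_ereal_inf_tmp => a Sa.
by rewrite leeBlDr //; exact: h.
Qed.

(** The pointwise bound of [le_riesz] is integrated by [riesz_strong]. *)
Lemma gaffney_coef : exists2 C : R, 0 <= C & forall (u g : 'rV[R]_n -> R) (nu : R),
  measurable_fun setT u -> measurable_fun setT g -> (forall x, 0 <= g x) ->
  Lnorm mu p%:E (EFin \o g) = nu%:E ->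
  {ae mu, forall x, ((fine (mollif_mass R n) * `|u x|)%:E <= (n%:R * 4 ^+ n)%:E * riesz g x)%E} ->
  (Lnorm mu q%:E (EFin \o u) <= (C * nu)%:E)%E.
Proof.
have [K K0 hK] := riesz_strong p1 q1 n0 pq.
set kap := fine (mollif_mass R n).
have kap0 : 0 < kap by rewrite -lte_fin -mollif_massE mollif_mass_gt0.
pose c : R := kap^-1 * (n%:R * 4 ^+ n).
have c0 : 0 <= c by rewrite mulr_ge0 ?invr_ge0 ?(ltW kap0) // mulr_ge0 // exprn_ge0.
exists (c * K `^ q^-1); first by rewrite mulr_ge0 // powR_ge0.
move=> u g nu mu_ mg g0 gnu hae.
have nu0 : 0 <= nu by rewrite -lee_fin -gnu Lnorm_ge0.
have mq (f : 'rV[R]_n -> \bar R) : measurable_fun setT f -> measurable_fun setT (fun x => f x `^ q)%E.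
  by move=> mf; exact: (measurableT_comp (measurable_poweR q)).
have mJ : measurable_fun setT (riesz g) by exact: measurable_riesz.
have J0 x := riesz_ge0 x g0.
have gp : ((\int[mu]_x (g x `^ p)%:E) `^ p^-1)%E = nu%:E.
  rewrite -gnu unlock /Lnorm; congr (_ `^ _)%E; apply: eq_integral => x _ /=.
  by rewrite ger0_norm.
have := hK g nu mg g0 gp => hKg.
have le1 : (\int[mu]_x (`|(u x)%:E| `^ q) <= (c `^ q)%:E * (K * nu `^ q)%:E)%E.
  apply: (@le_trans _ _ (\int[mu]_x ((c `^ q)%:E * riesz g x `^ q))%E).
    apply: ae_ge0_le_integral => //.
    - by move=> x _; exact: poweR_ge0.
    - by apply: mq; apply: measurableT_comp => //; exact/measurable_EFinP.
    - by move=> x _; rewrite mule_ge0 ?lee_fin ?powR_ge0 // poweR_ge0.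
    - by apply: emeasurable_funM => //; exact: mq.
    - apply: filterS hae => x hx _.
      rewrite -poweR_EFin -poweRM //.
      apply: gt0_ler_poweR; rewrite ?in_itv /= ?leey ?andbT ?(ltW q0) //.
        by rewrite mule_ge0.
      have := lee_wpmul2l _ hx => /(_ kap^-1%:E); rewrite lee_fin invr_ge0 (ltW kap0) => /(_ isT).
      rewrite -EFinM mulrA mulVf ?(gt_eqF kap0) // mul1r muleA -EFinM. exact.
  rewrite ge0_integralZl //; last 3 first.
  - exact: mq.
  - by move=> x _; exact: poweR_ge0.
  - by rewrite lee_fin powR_ge0.
  by apply: lee_wpmul2l hKg; rewrite lee_fin powR_ge0.
clearbody c; rewrite unlock /Lnorm.
apply: (@le_trans _ _ (((c `^ q)%:E * (K * nu `^ q)%:E) `^ q^-1)%E).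
  apply: gt0_ler_poweR; rewrite ?in_itv /= ?leey ?andbT ?invr_ge0 ?(ltW q0) //.
  - by apply: integral_ge0 => x _; rewrite lee_fin powR_ge0.
  - by rewrite -EFinM lee_fin !mulr_ge0 ?powR_ge0 // ltW.
rewrite -EFinM poweR_EFin lee_fin !powRM ?mulr_ge0 ?powR_ge0 ?(ltW K0) //.
by rewrite -!powRrM mulfV ?(gt_eqF q0) // !powRr1 // mulrA.
Qed.

Lemma gaffney : exists C : R, forall theta : 'rV[R]_n -> 'M[R]_(k, n) -> R,
     Lp_form p theta ->
     (form_Lnorm q theta <=
        C%:E * (current_Lnorm p (current_d (current_of theta)) +
                current_Lnorm p (current_delta (current_of theta))))%E.
Proof.
have [C C0 hC] := gaffney_coef.
pose N : R := #|{ffun 'I_k -> 'I_n}|%:R.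
(* The factors account for the number of coefficients and for [diff_norm]; the
   summand 1 makes [D] invertible. *)
pose D := N * C * (1 + k%:R) + 1.
have D0 : 0 < D by rewrite ltr_wpDl // !mulr_ge0 // addr_ge0.
exists D => theta Lt.
suff h : (D^-1%:E * form_Lnorm q theta <= current_Lnorm p (current_d (current_of theta)) +
                current_Lnorm p (current_delta (current_of theta)))%E.
  have := lee_wpmul2l _ h => /(_ D%:E); rewrite lee_fin (ltW D0) => /(_ isT).
  by rewrite muleA -EFinM mulfV ?(gt_eqF D0) // mul1e.
apply: ereal_inf_add.
- by move=> _ [eta [Leta _] <-]; rewrite Lnorm_ge0 form_Lnorm_lty.
- by move=> _ [eta [Leta _] <-]; rewrite Lnorm_ge0 form_Lnorm_lty.
move=> _ _ [eta1 [L1 d1] <-] [eta2 [L2 d2] <-].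
have mN1 := measurable_form_norm L1; have mN2 := measurable_form_norm L2.
pose g := diff_norm eta1 eta2.
have mg : measurable_fun setT g := measurable_diff_norm L1 L2.
have g0 x : 0 <= g x by exact: diff_norm_ge0.
have gle : (Lnorm mu p%:E (EFin \o g) <= form_Lnorm p eta1 + k%:R%:E * form_Lnorm p eta2)%E.
  apply: le_trans (@minkowski_EFin _ _ _ mu (fun x => form_norm (eta1 x))
    (fun x => k%:R * form_norm (eta2 x)) p mN1 _ (ltW p1)) _; first exact: measurable_funM.
  by rewrite leeD2l // Lnorm_scale // ger0_norm.
have f1 := form_Lnorm_lty p1 L1; have f2 := form_Lnorm_lty p1 L2.
have gfin : Lnorm mu p%:E (EFin \o g) \is a fin_num.
  rewrite ge0_fin_numE ?Lnorm_ge0 //; apply: le_lt_trans gle _.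
  by rewrite lte_add_pinfty // lte_mul_pinfty // ?lee_fin.
pose nu := fine (Lnorm mu p%:E (EFin \o g)).
have gnu : Lnorm mu p%:E (EFin \o g) = nu%:E by rewrite fineK.
have gLp : (\int[mu]_x (g x `^ p)%:E < +oo)%E.
  have := @poweR_Lnorm _ _ _ mu (EFin \o g) p; rewrite gnu poweR_EFin => /(_ (lt0r_neq0 p0)) h.
  apply: (@le_lt_trans _ _ (nu `^ p)%:E); last exact: ltry.
  rewrite h; apply: eq_leW; apply: eq_integral => x _ /=.
  by rewrite ger0_norm.
have coef f : multi_index f -> (Lnorm mu q%:E (EFin \o (fun x => form_coef (theta x) f)) <= (C * nu)%:E)%E.
  move=> mf; pose u x := form_coef (theta x) f.
  have mu_ : measurable_fun setT u by exact: measurable_form_coef f Lt.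
  have [_ /(_ f mf)/LfunE[_ ufin]] := Lt.
  have unu : ((\int[mu]_x (`|u x| `^ p)%:E) `^ p^-1)%E = (fine (Lnorm mu p%:E (EFin \o u)))%:E.
    rewrite fineK; last by rewrite ge0_fin_numE ?Lnorm_ge0.
    by rewrite unlock /Lnorm; congr (_ `^ _)%E; apply: eq_integral.
  apply: (hC u g nu) => //.
  apply: (le_riesz n0 p1 mu_ unu mg g0 _ q1 pq gLp) => e r y er.
  exact: (hodge_bound Lt L1 L2 d1 d2 y (fun z s s0 => Lp_local p1 mu_ unu z s0) er).
have tle : (form_Lnorm q theta <= (N * C * nu)%:E)%E.
  apply: le_trans (form_Lnorm_le_coef q1 Lt) _.
  apply: (@le_trans _ _ (\sum_(f : {ffun 'I_k -> 'I_n}) (C * nu)%:E)%E).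
    rewrite big_mkcond; apply: lee_sum => f _; case: ifPn => mf; first exact: coef.
    by rewrite lee_fin mulr_ge0 // -lee_fin -gnu Lnorm_ge0.
  by rewrite sumEFin lee_fin sumr_const -mulr_natl mulrA.
rewrite -(@fineK _ (form_Lnorm p eta1)) ?ge0_fin_numE ?Lnorm_ge0 //.
rewrite -(@fineK _ (form_Lnorm p eta2)) ?ge0_fin_numE ?Lnorm_ge0 //.
move: gle; rewrite gnu.
rewrite -(@fineK _ (form_Lnorm p eta1)) ?ge0_fin_numE ?Lnorm_ge0 //.
rewrite -(@fineK _ (form_Lnorm p eta2)) ?ge0_fin_numE ?Lnorm_ge0 //.
set a := fine _; set b := fine _.
have a0 : 0 <= a by rewrite fine_ge0 ?Lnorm_ge0.
have b0 : 0 <= b by rewrite fine_ge0 ?Lnorm_ge0.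
rewrite -EFinM -!EFinD lee_fin => gle.
apply: (@le_trans _ _ (D^-1%:E * (N * C * nu)%:E)%E).
  by apply: lee_wpmul2l tle; rewrite lee_fin invr_ge0 ltW.
rewrite -EFinM lee_fin mulrC ler_pdivrMr //.
have NC : 0 <= N * C by rewrite mulr_ge0.
apply: (@le_trans _ _ (N * C * (a + k%:R * b))); first exact: ler_wpM2l.
have hk : a + k%:R * b <= (1 + k%:R) * (a + b).
  have : 0 <= k%:R * a by rewrite mulr_ge0.
  by move: b0; lra.
apply: (@le_trans _ _ (N * C * ((1 + k%:R) * (a + b)))); first exact: ler_wpM2l.
rewrite -/a -/b /=; have -> : (a + b) * D = N * C * ((1 + k%:R) * (a + b)) + (a + b) by rewrite /D; ring.
by rewrite lerDl addr_ge0.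
Qed.
End sufficiency.

(** * Integration by parts *)

Section integration_by_parts.
Variables (R : realType) (n : nat).
Local Notation mu := (lebesgue_rV R n).
Local Notation z0 := (0 : 'rV[R]_n).

Lemma integral_translate (F : 'rV[R]_n -> \bar R) (b : 'rV[R]_n) : measurable_fun setT F ->
  (\int[mu]_x F (x + b)%R = \int[mu]_x F x)%E.
Proof.
have ge0 (G : 'rV[R]_n -> \bar R) : measurable_fun setT G -> (forall x, 0 <= G x)%E ->
    (\int[mu]_x G (x + b)%R = \int[mu]_x G x)%E.
  move=> mG G0; have := integral_affine b ltr01 mG G0.
  by rewrite invr1 expr1n mul1e => <-; apply: eq_integral => x _; rewrite scale1r.
move=> mF; rewrite integralE [RHS]integralE.
congr (_ - _)%E.
  transitivity (\int[mu]_x (F^\+ (x + b)%R))%E; first by apply: eq_integral => x _; rewrite !funeposE.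
  by apply: ge0 => //; exact: measurable_funepos.
transitivity (\int[mu]_x (F^\- (x + b)%R))%E; first by apply: eq_integral => x _; rewrite !funenegE.
by apply: ge0 => //; exact: measurable_funeneg.
Qed.

Lemma integrable_ball (F : 'rV[R]_n -> R) C (y : 'rV[R]_n) r : 0 < r ->
  measurable_fun setT F -> (forall x, `|F x| <= C) -> (forall x, F x != 0 -> ball y r x) ->
  mu.-integrable setT (EFin \o F).
Proof.
move=> r0 mF hC hB; have mB : measurable (ball y r) by exact: measurable_ball_rV.
have i1 : mu.-integrable (ball y r) (EFin \o cst 1).
  apply/integrableP; split; first exact/measurable_EFinP.
  rewrite (eq_integral (cst 1%E)); last by move=> x _ /=; rewrite normr1.
  rewrite integral_cst // mul1e; apply: (le_lt_trans (eq_leW (measure_ball_rV y r0))).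
  exact: ltry.
have := integrable_mul_ball r0 (measurable_cst (1:R)) i1 mF hC hB.
by apply: eq_integrable => // x _ /=; rewrite mul1r.
Qed.

(** The difference quotients of [g] have integral zero by translation
    invariance. By the mean value theorem they are bounded by the maximum of
    the partial derivative, so that they converge dominatedly to it. *)
Lemma integral_partial0 (g : 'rV[R]_n -> R) r i : Ck 1 g -> 0 < r ->
  (forall x, g x != 0 -> ball z0 r x) -> \int[mu]_x partial i g x = 0.
Proof.
move=> C1 r0 gB.
have cg : continuous g := Ck_continuous C1.
have cp : continuous (partial i g) by case: C1 => _ /(_ i)[].
have mg := continuous_measurable_rV cg; have mp := continuous_measurable_rV cp.
pose v : 'rV[R]_n := delta_mx 0 i.
pose t m : R := m.+1%:R^-1.
have t0 m : 0 < t m by rewrite invr_gt0.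
have t1 m : t m <= 1 by rewrite invf_le1 // ler1n.
have r10 : 0 < r + 1 by rewrite addr_gt0.
have r20 : 0 < r + 2 by rewrite addr_gt0.
have [C C0 hC] := continuous_bounded_ball z0 r20 cp.
have line x (h : R) : is_derive h (1 : R) (fun s : R => g (s *: v + x)) (partial i g (h *: v + x)).
  have /is_derive_line h1 := Ck_is_derive i (h *: v + x) C1.
  pose G s := g (s *: v + (h *: v + x)).
  have h2 : is_derive (h - h) (1 : R) G (partial i g (h *: v + x)) by rewrite subrr.
  have h3 : is_derive h (1 : R) (fun s : R => s - h) 1.
    by rewrite -[X in is_derive _ _ _ X]subr0; apply: is_deriveB.
  have := @is_derive1_comp R G (fun s => s - h) h _ _ h2 h3; rewrite mulr1.
  rewrite (_ : G \o _ = fun s => g (s *: v + x)) //; apply/funext => s.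
  by rewrite /G /= scalerBl addrA subrK.
have vnorm (h : R) (x : 'rV[R]_n) j : `|(h *: v + x) 0 j - x 0 j| <= `|h|.
  rewrite !mxE addrK normrM eqxx /= ler_piMr //.
  by case: (_ == _); rewrite ?normr1 ?normr0.
pose q m x := (t m)^-1 * (g (t m *: v + x) - g x).
have qle m x : `|q m x| <= C /\ (q m x != 0 -> ball z0 (r + 1) x).
  have [xB|xB] := pselect (ball z0 (r + 1) x); last first.
    have gx : g x = 0.
      apply: contrapT => /eqP /gB gx; apply: xB; apply: le_ball gx; by rewrite lerDl.
    have gtx : g (t m *: v + x) = 0.
      apply: contrapT => /eqP /gB h; apply: xB.
      apply/ball_rVP => // j; rewrite mxE sub0r normrN.
      move/(ball_rVP _ _ r0): h => /(_ j); rewrite [z0 _ _]mxE sub0r normrN => h.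
      have := vnorm (t m) x j; rewrite (gtr0_norm (t0 m)) => h2.
      apply: (@le_lt_trans _ _ (`|(t m *: v + x) 0 j| + `|(t m *: v + x) 0 j - x 0 j|)).
        by rewrite -[x in `|x| <= _](subKr ((t m *: v + x) 0 j)) ler_normB.
      by apply: ltr_leD => //; exact: le_trans (t1 m).
    by rewrite /q gx gtx subrr mulr0 eqxx normr0.
  split=> //.
  have [c ct cE] := MVT_segment (ltW (t0 m)) (fun h _ => line x h)
    (derivable_within_continuous (fun h _ => @ex_derive _ _ _ _ _ _ _ (line x h))).
  rewrite /q; have -> : g (t m *: v + x) - g x = partial i g (c *: v + x) * t m.
    by move: cE; rewrite scale0r add0r subr0.
  rewrite mulrCA mulVf ?gt_eqF // mulr1; apply: hC.
  apply/ball_rVP => // j; rewrite mxE sub0r normrN.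
  move/(ball_rVP _ _ r10): xB => /(_ j); rewrite [z0 _ _]mxE sub0r normrN => h.
  have h2 := vnorm c x j.
  apply: (@le_lt_trans _ _ (`|x 0 j| + `|(c *: v + x) 0 j - x 0 j|)).
    by rewrite -{1}(subrK (x 0 j) ((c *: v + x) 0 j)) addrC ler_normD.
  have c1 : `|c| <= 1.
    by move: ct; rewrite in_itv /= => /andP[c0 ct]; rewrite ger0_norm // (le_trans ct).
  have -> : r + 2 = r + 1 + 1 by rewrite -addrA.
  by apply: ltr_leD => //; exact: le_trans c1.
have mtr m : measurable_fun setT (fun x => g (t m *: v + x)).
  apply: continuous_measurable_rV => x; apply: (@continuous_comp _ _ _ (fun x => t m *: v + x) g).
    apply: (@continuousD R _ _ (cst (t m *: v)) id x).
      exact: cst_continuous.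
    exact: cvg_id.
  exact: cg.
have mq m : measurable_fun setT (q m) by apply: measurable_funM => //; exact: measurable_funB.
have [Cg Cg0 hCg] := continuous_bounded_ball z0 r0 cg.
have ig : mu.-integrable setT (EFin \o g).
  apply: (@integrable_ball g Cg z0 r) => // x.
  by have [->|/gB/hCg//] := eqVneq (g x) 0; rewrite normr0.
have iq m : (\int[mu]_x (q m x)%:E = 0)%E.
  have E (F : 'rV[R]_n -> \bar R) : measurable_fun setT F ->
      (\int[mu]_x F (t m *: v + x)%R = \int[mu]_x F x)%E.
    by move=> mF; rewrite -(integral_translate (t m *: v) mF); apply: eq_integral => x _; rewrite addrC.
  have it : mu.-integrable setT (fun x => (g (t m *: v + x))%:E).
    apply/integrableP; split; first exact/measurable_EFinP.
    have me : measurable_fun setT (fun x => `|(g x)%:E|%E).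
      by apply: measurableT_comp => //; exact/measurable_EFinP.
    by rewrite (E _ me); case/integrableP: ig.
  have -> : (\int[mu]_x (q m x)%:E = \int[mu]_x ((t m)^-1%:E * ((g (t m *: v + x))%:E - (g x)%:E)))%E.
    by apply: eq_integral => x _; rewrite -EFinB -EFinM.
  have iB : mu.-integrable setT (fun x => ((g (t m *: v + x))%:E - (g x)%:E)%E).
    exact: integrableB.
  rewrite integralZl // integralB //.
  have mg' : measurable_fun setT (EFin \o g) by exact/measurable_EFinP.
  by rewrite (E _ mg') subee ?mule0 //; exact: integrable_fin_num.
have ib : mu.-integrable setT (fun x => (C * \1_(ball z0 (r + 1)) x)%:E).
  have mB : measurable (ball z0 (r + 1)) by exact: measurable_ball_rV.
  apply: (@integrable_ball (fun x => C * \1_(ball z0 (r + 1)) x) C z0 (r + 1)) => //.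
  - by apply: measurable_funM => //; exact: measurable_indic.
  - move=> x; rewrite normrM ger0_norm // ler_piMr // indicE.
    by case: (_ \in _); rewrite ?normr1 ?normr0.
  - move=> x; rewrite indicE; case: (boolP (x \in _)) => [|_]; last by rewrite mulr0 eqxx.
    by rewrite inE.
have := @dominated_convergence _ _ _ mu setT measurableT (fun m x => (q m x)%:E)
  (fun x => (partial i g x)%:E) (fun x => (C * \1_(ball z0 (r + 1)) x)%:E).
case=> //.
- by move=> m; exact/measurable_EFinP.
- exact/measurable_EFinP.
- apply: aeW => x _; apply: cvg_EFin; first exact: nearW.
  have hd : derivable g x v := @ex_derive _ _ _ _ _ _ _ (Ck_is_derive i x C1).
  have hc : (fun h => h^-1 *: (g (h *: v + x) - g x)) @ (0:R)^' --> partial i g x by exact: hd.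
  have ht : (forall m, t m != 0) /\ t m @[m --> \oo] --> (0:R).
    by split=> [m|]; [rewrite gt_eqF|exact: cvg_harmonic].
  exact: ((cvgr_dnbhsP _ _ _).1 hc t ht).
- apply: aeW => x m _; rewrite abse_EFin lee_fin.
  have [h1 h2] := qle m x; have [->|/h2 h] := eqVneq (q m x) 0.
    by rewrite normr0 mulr_ge0 // indicE.
  by rewrite indicE mem_set // mulr1.
move=> _ _ h; rewrite /Rintegral.
have : (\int[mu]_x (q m x)%:E)%E @[m --> \oo] --> (\int[mu]_x (partial i g x)%:E)%E by exact: h.
rewrite (_ : (fun m => _) = cst 0%E); last by apply/funext => m; rewrite iq.
move=> h1; have h2 : (cst 0%E : nat -> \bar R) @ \oo --> (0%E : \bar R) by exact: cvg_cst.
by rewrite (cvg_unique _ h1 h2).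
Qed.

Lemma partialM (f phi : 'rV[R]_n -> R) i x : Ck 1 f -> Ck 1 phi ->
  partial i (fun x => f x * phi x) x = f x * partial i phi x + partial i f x * phi x.
Proof.
move=> C1 C2; have h1 := Ck_is_derive i x C1; have h2 := Ck_is_derive i x C2.
rewrite /partial; have -> := @derive_val _ _ _ _ _ _ _ (is_deriveM h1 h2).
by rewrite /partial; congr (_ + _); rewrite mulrC.
Qed.

Lemma integration_by_parts_rV (f phi : 'rV[R]_n -> R) r i : Ck 1 f -> Ck 1 phi -> 0 < r ->
  (forall x, f x != 0 -> ball z0 r x) -> (forall x, partial i f x != 0 -> ball z0 r x) ->
  \int[mu]_x (f x * partial i phi x) = - \int[mu]_x (partial i f x * phi x).
Proof.
move=> C1 C2 r0 fB dfB.
have cf := Ck_continuous C1; have cphi := Ck_continuous C2.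
have cdf : continuous (partial i f) by case: C1 => _ /(_ i)[].
have cdphi : continuous (partial i phi) by case: C2 => _ /(_ i)[].
have int (F G : 'rV[R]_n -> R) : continuous F -> continuous G ->
    (forall x, F x != 0 -> ball z0 r x) -> mu.-integrable setT (EFin \o (fun x => F x * G x)).
  move=> cF cG FB.
  have [A A0 hA] := continuous_bounded_ball z0 r0 cF.
  have [B B0 hB] := continuous_bounded_ball z0 r0 cG.
  apply: (@integrable_ball (fun x => F x * G x) (A * B) z0 r) => //.
  - by apply: measurable_funM; exact: continuous_measurable_rV.
  - move=> x; have [->|/FB xB] := eqVneq (F x) 0; first by rewrite mul0r normr0 mulr_ge0.
    by rewrite normrM ler_pM // ?hA ?hB.
  - by move=> x; have [->|/FB//] := eqVneq (F x) 0; rewrite mul0r eqxx.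
have i1 := int _ _ cf cdphi fB; have i2 := int _ _ cdf cphi dfB.
apply/eqP; rewrite -addr_eq0 -RintegralD //; apply/eqP.
have fphiB x : f x * phi x != 0 -> ball z0 r x.
  by have [->|/fB//] := eqVneq (f x) 0; rewrite mul0r eqxx.
apply: eq_trans (integral_partial0 i (CkM C1 C2) r0 fphiB).
by apply: eq_Rintegral => x _; rewrite partialM.
Qed.
End integration_by_parts.

(** * Determinants as alternating forms *)

Section determinant_forms.
Variables (R : realType) (n : nat).

Lemma alternating_det k (g : 'I_k -> 'I_n) :
  alternating_form (fun A : 'M[R]_(k, n) => \det (colsub g A)).
Proof.
split=> [A B C i b c hA hB hC|A i j ij hA].
  apply: (@determinant_multilinear _ _ _ _ _ i).
  - by apply/rowP => l; move/rowP: hA => /(_ (g l)); rewrite !mxE.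
  - by apply/matrixP => r l; move/matrixP: hB => /(_ r (g l)); rewrite !mxE.
  - by apply/matrixP => r l; move/matrixP: hC => /(_ r (g l)); rewrite !mxE.
apply: (determinant_alternate ij) => l; rewrite !mxE.
by move/rowP: hA => /(_ (g l)); rewrite !mxE.
Qed.

(** Expansion of the determinant along its first column. *)
Lemma dx_wedge_det k (g : 'I_k -> 'I_n) i (A : 'M[R]_(k.+1, n)) :
  dx_wedge i (fun A : 'M[R]_(k, n) => \det (colsub g A)) A =
  \det (colsub (fun r => if unlift ord0 r is Some r' then g r' else i) A).
Proof.
rewrite (expand_det_col _ ord0) /dx_wedge; apply: eq_bigr => j _.
rewrite mxE unlift_none /cofactor addn0 [RHS]mulrCA mulrA; congr (_ * \det _); apply/matrixP => r l; rewrite !mxE.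
by rewrite liftK.
Qed.

Lemma alternating_sum k (I : finType) (c : I -> R) (w : I -> 'M[R]_(k, n) -> R) :
  (forall i, alternating_form (w i)) -> alternating_form (fun A => \sum_i c i * w i A).
Proof.
move=> aw; split=> [A B C i b d hA hB hC|A i j ij hA].
  rewrite !mulr_sumr -big_split; apply: eq_bigr => l _ /=.
  have [ml _] := aw l; rewrite (ml A B C i b d) //; ring.
by rewrite big1 // => l _; have [_ alt] := aw l; rewrite (alt A i j) ?mulr0.
Qed.

Lemma alternating0 k : alternating_form (fun _ : 'M[R]_(k, n) => 0).
Proof. by split=> [A B C i b c _ _ _|//]; rewrite !mulr0 addr0. Qed.

Lemma alternating_iota k (i : 'I_n) (w : 'M[R]_(k, n) -> R) :
  alternating_form w -> alternating_form (iota_dx i w).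
Proof.
case: k w => [|k] w [ml alt] /=; first exact: alternating0.
have rowE (A : 'M[R]_(k, n)) r : row (lift ord0 r) (cons_row (delta_mx 0 i) A) = row r A.
  by apply/rowP => l; rewrite mxE [RHS]mxE cons_rowS.
have other (A B : 'M[R]_(k, n)) r : row' r A = row' r B ->
   row' (lift ord0 r) (cons_row (delta_mx 0 i) A) = row' (lift ord0 r) (cons_row (delta_mx 0 i) B).
  case: k A B r {w ml alt rowE} => [|k] A B r; first by case: r.
  by rewrite !row'S_cons => ->.
split=> [A B C r b c hA hB hC|A r s rs hA].
  by apply: (ml _ _ _ (lift ord0 r)); rewrite ?rowE //; exact: other.
by apply: (alt _ (lift ord0 r) (lift ord0 s)); rewrite ?rowE // (inj_eq lift_inj).
Qed.

End determinant_forms.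

(** * Dilated cut-off functions *)

Section cutoff.
Variables (R : realType) (n : nat).
Local Notation mu := (lebesgue_rV R n).
Local Notation z0 := (0 : 'rV[R]_n).

Definition cutoff (a : R) (x : 'rV[R]_n) : R := 1 - step (a ^- 2 * sqnorm x + 0).

Lemma Ck_cutoff m a : Ck m (cutoff a).
Proof.
have h : C1k m (fun s : R => 1 + -1 * step (a ^- 2 * s + 0)).
  apply: C1kD; first exact: C1k_cst.
  by apply: C1kM; [exact: C1k_cst|apply: C1k_affine; exact: C1k_step].
have := Ck_comp h (Ck_sqnorm m z0).
rewrite (_ : (fun x => _) = cutoff a) //; apply/funext => x.
by rewrite subr0 /cutoff mulN1r.
Qed.

Lemma partial_cutoff a i x :
  partial i (cutoff a) x = - (bump (a ^- 2 * sqnorm x + 0) * (a ^- 2 * (2 * x 0 i))).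
Proof.
have ha := is_derive_affine (a ^- 2) 0.
have hs : is_derive x ('e_i : 'rV[R]_n) (@sqnorm R n) (2 * x 0 i).
  have := is_derive_sqnorm z0 i x; rewrite !mxE subr0.
  by rewrite (_ : (fun z => sqnorm (z - z0)) = @sqnorm R n) //; apply/funext => z; rewrite subr0.
have hc := is_derive_comp_line (is_derive1_comp (is_derive_step _) (ha (sqnorm x))) hs.
have h := is_deriveB (is_derive_cst (1 : R) x ('e_i : 'rV[R]_n)) hc.
rewrite /partial; have -> : cutoff a = cst 1 - (@step R \o (fun s => a ^- 2 * s + 0)) \o @sqnorm R n.
  by apply/funext.
have -> := @derive_val _ _ _ _ _ _ _ h.
by rewrite sub0r -mulrA.
Qed.

Lemma sqnorm_ball a (x : 'rV[R]_n) : 0 < a -> a ^- 2 * sqnorm x + 0 <= 2 -> ball z0 (2 * a) x.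
Proof.
move=> a0; rewrite addr0 mulrC ler_pdivrMr ?exprn_gt0 // => h.
apply: sqnorm_lt_ball; rewrite ?subr0 ?mulr_gt0 // (le_lt_trans h) //.
by rewrite exprMn ltr_pM2r ?exprn_gt0 // expr2; lra.
Qed.

Lemma cutoff_supp a x : 0 < a -> cutoff a x != 0 -> ball z0 (2 * a) x.
Proof.
move=> a0 h; apply: sqnorm_ball => //; rewrite leNgt; apply/negP => h2.
by move: h; rewrite /cutoff step_eq1 ?subrr ?eqxx // ltW.
Qed.

Lemma partial_cutoff_supp a i x : 0 < a -> partial i (cutoff a) x != 0 -> ball z0 (2 * a) x.
Proof.
move=> a0; rewrite partial_cutoff => h; apply: sqnorm_ball => //; rewrite leNgt; apply/negP => h2.
by move: h; rewrite bump_eq0 ?mul0r ?oppr0 ?eqxx //; right.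
Qed.

Lemma cutoff_ge0 a x : 0 <= cutoff a x.
Proof. by rewrite /cutoff subr_ge0 step_le1. Qed.

Lemma cutoff_le1 a x : cutoff a x <= 1.
Proof. by rewrite /cutoff gerBl step_ge0. Qed.

(** On the support of the derivative the squared norm of [x] is at most
    [2 * a ^ 2], and the derivative of [x |-> |x| ^ 2 / a ^ 2] is at most
    [4 / a] there. *)
Lemma partial_cutoff_bound : exists2 M : R, 0 <= M & forall a i x, 0 < a ->
  `|partial i (cutoff a) x| <= M / a.
Proof.
have [M M0 hM] := bump_bounded R.
exists (4 * M); first by rewrite mulr_ge0.
move=> a i x a0; have [->|h] := eqVneq (partial i (cutoff a) x) 0.
  by rewrite normr0 divr_ge0 ?mulr_ge0 // ltW.
have a20 : 0 < 2 * a by rewrite mulr_gt0.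
have := partial_cutoff_supp a0 h => /(ball_rVP _ _ a20) /(_ i); rewrite mxE sub0r normrN => xi.
rewrite partial_cutoff normrN normrM ger0_norm ?bump_ge0 //.
have -> : 4 * M / a = M * (a ^- 2 * (2 * (2 * a))).
  by rewrite expr2 invfM; field; rewrite gt_eqF.
apply: ler_pM => //; first exact: bump_ge0.
rewrite normrM (ger0_norm (_ : 0 <= a ^- 2)) ?invr_ge0 ?exprn_ge0 ?(ltW a0) //.
rewrite ler_wpM2l ?invr_ge0 ?exprn_ge0 ?(ltW a0) // normrM ger0_norm // ler_wpM2l //.
exact: ltW.
Qed.

Lemma cutoff_eq1 a x : (0 < n)%N -> 0 < a -> ball z0 (a / n%:R) x -> cutoff a x = 1.
Proof.
move=> n0 a0; have nR : 0 < n%:R :> R by rewrite ltr0n.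
have an : 0 < a / n%:R by rewrite divr_gt0.
move=> /(ball_rVP _ _ an) h; rewrite /cutoff step_eq0 ?subr0 // addr0 mulrC.
rewrite ler_pdivrMr ?exprn_gt0 // mul1r.
apply: (@le_trans _ _ (\sum_(i < n) (a / n%:R) ^+ 2)).
  apply: ler_sum => i _; have := h i; rewrite mxE sub0r normrN => hi.
  by rewrite -real_normK ?num_real // lerXn2r ?nnegrE ?(ltW an) // ltW.
rewrite sumr_const card_ord -[leLHS]mulr_natl.
have -> : n%:R * (a / n%:R) ^+ 2 = a ^+ 2 * n%:R^-1 by field; rewrite gt_eqF.
by rewrite ler_piMr ?exprn_ge0 ?(ltW a0) // invf_le1 // ler1n.
Qed.

End cutoff.

(** * Combinations of constant forms with bounded coefficients *)

Section bounded_support.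
Variables (R : realType) (n : nat).
Local Notation mu := (lebesgue_rV R n).
Local Notation z0 := (0 : 'rV[R]_n).

Lemma Lnorm_ball (F : 'rV[R]_n -> R) (s D r : R) : 1 < s -> 0 <= D -> 0 < r ->
  measurable_fun setT F -> (forall x, `|F x| <= D) -> (forall x, F x != 0 -> ball z0 r x) ->
  (Lnorm mu s%:E (EFin \o F) <= (D * ((2 * r) ^+ n) `^ s^-1)%:E)%E.
Proof.
move=> s1 D0 r0 mF hD hB; have s0 : 0 < s by exact: lt_trans ltr01 s1.
have mB : measurable (ball z0 r) by exact: measurable_ball_rV.
have h : (\int[mu]_x (`|F x| `^ s)%:E <= (D `^ s * (2 * r) ^+ n)%:E)%E.
  apply: (@le_trans _ _ (\int[mu]_(x in ball z0 r) (D `^ s)%:E)%E).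
    rewrite [leRHS]integral_mkcond; apply: ge0_le_integral => //.
    - apply/measurable_EFinP; apply: (measurableT_comp (measurable_powR s)).
      exact: measurableT_comp.
    - by apply: (measurable_restrictT _ _).1.
    - move=> x _; rewrite patchE; case: ifPn => xB.
        by rewrite lee_fin; apply: ge0_ler_powR; rewrite ?nnegrE // ltW.
      have [->|/hB h] := eqVneq (F x) 0; first by rewrite normr0 powR0 ?gt_eqF.
      by move: xB; rewrite notin_setE.
  rewrite integral_cst // EFinM; apply: lee_wpmul2l; first by rewrite lee_fin powR_ge0.
  apply: (le_trans (eq_leW (measure_ball_rV z0 r0))).
  by rewrite mulr_natl.
rewrite unlock /Lnorm.
apply: (@le_trans _ _ ((D `^ s * (2 * r) ^+ n)%:E `^ s^-1)%E).
  apply: gt0_ler_poweR; rewrite ?in_itv /= ?leey ?andbT ?invr_ge0 ?(ltW s0) //.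
  - by apply: integral_ge0 => x _; rewrite lee_fin powR_ge0.
  - by rewrite lee_fin mulr_ge0 ?powR_ge0 // exprn_ge0 // mulr_ge0 // ltW.
rewrite poweR_EFin lee_fin powRM ?powR_ge0 //; last by rewrite exprn_ge0 // mulr_ge0 // ltW.
by rewrite -powRrM mulfV ?gt_eqF // powRr1.
Qed.

Lemma Lnorm_ge_ball (F : 'rV[R]_n -> R) (s r : R) : 1 < s -> 0 < r ->
  measurable_fun setT F -> (forall x, ball z0 r x -> 1 <= `|F x|) ->
  ((((2 * r) ^+ n) `^ s^-1)%:E <= Lnorm mu s%:E (EFin \o F))%E.
Proof.
move=> s1 r0 mF hB; have s0 : 0 < s by exact: lt_trans ltr01 s1.
have mB : measurable (ball z0 r) by exact: measurable_ball_rV.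
have h : (((2 * r) ^+ n)%:E <= \int[mu]_x (`|F x| `^ s)%:E)%E.
  apply: (@le_trans _ _ (\int[mu]_(x in ball z0 r) 1)%E).
    rewrite integral_cst // mul1e.
    apply: (le_trans _ (eq_leW (esym (measure_ball_rV z0 r0)))).
    by rewrite mulr_natl.
  rewrite integral_mkcond; apply: ge0_le_integral => //.
  - by move=> x _; rewrite patchE; case: (_ \in _).
  - by apply: (measurable_restrictT _ _).1.
  - apply/measurable_EFinP; apply: (measurableT_comp (measurable_powR s)).
    exact: measurableT_comp.
  - move=> x _; rewrite patchE; case: ifPn => xB; last by rewrite lee_fin powR_ge0.
    have {1}-> : 1 = 1 `^ s :> R by rewrite powR1.
    rewrite lee_fin; apply: ge0_ler_powR; rewrite ?nnegrE ?(ltW s0) //.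
    by apply: hB; rewrite inE in xB.
rewrite unlock /Lnorm -poweR_EFin; apply: gt0_ler_poweR; rewrite ?in_itv /= ?leey ?andbT ?invr_ge0 ?(ltW s0) //.
- by rewrite lee_fin exprn_ge0 // mulr_ge0 // ltW.
- by apply: integral_ge0 => x _; rewrite lee_fin powR_ge0.
Qed.

Variables (I : finType) (k : nat) (c : I -> 'rV[R]_n -> R) (w : I -> 'M[R]_(k, n) -> R).
Variables (D r : R).
Hypothesis D0 : 0 <= D.
Hypothesis r0 : 0 < r.
Hypothesis mc : forall i, measurable_fun setT (c i).
Hypothesis hD : forall i x, `|c i x| <= D.
Hypothesis hB : forall i x, c i x != 0 -> ball z0 r x.
Hypothesis aw : forall i, alternating_form (w i).

Let eta x A := \sum_i c i x * w i A.

Definition coef_sum := \sum_(f : {ffun 'I_k -> 'I_n}) \sum_i `|form_coef (w i) f|.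

Lemma coef_sum_ge0 : 0 <= coef_sum.
Proof. by apply: sumr_ge0 => f _; exact: sumr_ge0. Qed.

Let mcoef f : measurable_fun setT (fun x => form_coef (eta x) f).
Proof. by apply: measurable_sum => i; exact: measurable_funM. Qed.

Let coef_le f x : `|form_coef (eta x) f| <= D * \sum_i `|form_coef (w i) f|.
Proof.
apply: le_trans (ler_norm_sum _ _ _) _; rewrite mulr_sumr; apply: ler_sum => i _.
by rewrite normrM ler_wpM2r.
Qed.

Let eta0 A x : ~ ball z0 r x -> eta x A = 0.
Proof.
move=> xB; apply: big1 => i _; have [->|/hB//] := eqVneq (c i x) 0.
by rewrite mul0r.
Qed.

Lemma Lp_form_sum s : 1 < s -> Lp_form s eta.
Proof.
move=> s1; split=> [x|f mf]; first exact: (alternating_sum (fun i => c i x)).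
apply/LfunE; split=> //.
apply: le_lt_trans (Lnorm_ball s1 _ r0 (mcoef f) (coef_le f) _) _; last exact: ltry.
  by rewrite mulr_ge0 // sumr_ge0.
by move=> x; apply: contraNP => xB; rewrite /form_coef eta0.
Qed.

Lemma form_Lnorm_sum_le s : 1 < s ->
  (form_Lnorm s eta <= (coef_sum * D * ((2 * r) ^+ n) `^ s^-1)%:E)%E.
Proof.
move=> s1; apply: Lnorm_ball => //.
- by rewrite mulr_ge0 // coef_sum_ge0.
- exact: measurable_form_norm (Lp_form_sum s1).
- move=> x; rewrite ger0_norm ?sqrtr_ge0 //; apply: le_trans (form_norm_le _) _.
  rewrite /coef_sum mulr_suml big_mkcond; apply: ler_sum => f _.
  case: ifPn => _; first by rewrite mulrC.
  by rewrite mulr_ge0 // sumr_ge0.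
- move=> x; apply: contraNP => xB; rewrite /form_norm big1 ?sqrtr0 // => f _.
  by rewrite /form_coef eta0 // expr0n.
Qed.

Lemma current_of_sum phi A : continuous phi ->
  current_of eta phi A = \sum_i w i A * \int[mu]_x (c i x * phi x).
Proof.
move=> cphi; rewrite /current_of.
have [B B0 hB'] := continuous_bounded_ball z0 r0 cphi.
have ic i : mu.-integrable setT (EFin \o (fun x => c i x * phi x)).
  apply: (@integrable_ball R n (fun x => c i x * phi x) (D * B) z0 r) => //.
  - by apply: measurable_funM => //; exact: continuous_measurable_rV.
  - move=> x; have [->|/hB xB] := eqVneq (c i x) 0; first by rewrite mul0r normr0 mulr_ge0.
    by rewrite normrM ler_pM // ?hD ?hB'.
  - by move=> x; have [->|/hB//] := eqVneq (c i x) 0; rewrite mul0r eqxx.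
transitivity (\int[mu]_x (\sum_i c i x * w i A * phi x)).
  by apply: eq_Rintegral => x _; rewrite /eta mulr_suml.
have icw i : mu.-integrable setT (EFin \o (fun x => c i x * w i A * phi x)).
  have := integrableZl measurableT (w i A) (ic i).
  by apply: eq_integrable => // x _ /=; rewrite -EFinM mulrA [w i A * _]mulrC.
rewrite -Rintegral_sum //; apply: eq_bigr => i _; rewrite -RintegralZl //.
by apply: eq_Rintegral => x _; rewrite mulrA [w i A * _]mulrC.
Qed.

End bounded_support.

(** * Necessity of the relation between the exponents *)

Section necessity.
Variables (R : realType) (p q : R) (n k : nat).
Local Notation mu := (lebesgue_rV R n).
Local Notation z0 := (0 : 'rV[R]_n).

Lemma powR_unbounded (s K : R) : (forall a, 0 < a -> a `^ s <= K) -> s = 0.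
Proof.
move=> h; apply/eqP; apply: contrapT => /negP s0.
have K1 : 0 < `|K| + 1 by rewrite ltr_wpDl.
have := h ((`|K| + 1) `^ s^-1) (powR_gt0 _ K1).
rewrite -powRrM mulVf // powRr1 ?(ltW K1) //; apply/negP; rewrite -ltNge.
by apply: le_lt_trans (ler_norm K) _; rewrite ltrDl.
Qed.

Hypotheses (p1 : 1 < p) (q1 : 1 < q) (n0 : (0 < n)%N) (kn : (k <= n)%N).

Let p0 : 0 < p. Proof. exact: lt_trans ltr01 p1. Qed.
Let q0 : 0 < q. Proof. exact: lt_trans ltr01 q1. Qed.

(* The form [dx_0 /\ ... /\ dx_(k-1)]. *)
Let w0 (A : 'M[R]_(k, n)) := \det (colsub (widen_ord kn) A).

Let aw0 : alternating_form w0. Proof. exact: alternating_det. Qed.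

(* All three are combinations of constant forms with coefficients of bounded
   support; the sum over a single index puts [theta] in this shape. *)
Let theta a (x : 'rV[R]_n) A := \sum_(i < 1) cutoff a x * w0 A.
Let eta1 a (x : 'rV[R]_n) A := \sum_(i < n) partial i (cutoff a) x * dx_wedge i w0 A.
Let eta2 a (x : 'rV[R]_n) A := \sum_(i < n) partial i (cutoff a) x * (- 1 * iota_dx i w0 A).

Let aw1 i : alternating_form (dx_wedge i w0).
Proof.
rewrite (_ : dx_wedge i w0 = fun A => \det (colsub (fun r => if unlift ord0 r is Some r' then widen_ord kn r' else i) A)).
  exact: alternating_det.
by apply/funext => A; exact: dx_wedge_det.
Qed.

Let aw2 i : alternating_form (fun A => - 1 * iota_dx i w0 A).
Proof.
have := alternating_sum (fun _ : 'I_1 => - 1) (fun _ => alternating_iota i aw0).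
by rewrite (_ : (fun A => \sum_i0 _) = (fun A => - 1 * iota_dx i w0 A)) //; apply/funext => A; rewrite big_ord1.
Qed.

Let mcut a : measurable_fun setT (@cutoff R n a).
Proof. by apply: continuous_measurable_rV; exact: (Ck_continuous (@Ck_cutoff R n 0 a)). Qed.

Let cpcut a i : continuous (partial i (@cutoff R n a)).
Proof. by have [_ /(_ i)[_ h]] := @Ck_cutoff R n 1 a. Qed.

Let mpcut a i : measurable_fun setT (partial i (@cutoff R n a)).
Proof. by apply: continuous_measurable_rV; exact: cpcut. Qed.

Let cut1 a x : `|@cutoff R n a x| <= 1.
Proof. by rewrite ger0_norm ?cutoff_ge0 // cutoff_le1. Qed.

Let Lp_theta a : 0 < a -> Lp_form p (theta a).
Proof.
move=> a0; have a20 : 0 < 2 * a by rewrite mulr_gt0.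
apply: (@Lp_form_sum R n _ k (fun _ : 'I_1 => cutoff a) (fun=> w0) 1 (2 * a)) => //.
by move=> _ x; exact: cutoff_supp.
Qed.

Let theta_ge a : 0 < a ->
  ((((2 * (a / n%:R)) ^+ n) `^ q^-1)%:E <= form_Lnorm q (theta a))%E.
Proof.
move=> a0; have an : 0 < a / n%:R by rewrite divr_gt0 // ltr0n.
apply: (Lnorm_ge_ball q1 an); first exact: measurable_form_norm (Lp_theta a0).
move=> x xB; rewrite ger0_norm ?sqrtr_ge0 //.
pose f0 : {ffun 'I_k -> 'I_n} := [ffun i => widen_ord kn i].
have mf0 : multi_index f0.
  by apply/forallP => i; apply/forallP => j; apply/implyP => ij; rewrite !ffunE.
apply: le_trans (form_coef_le _ mf0); rewrite /theta big_ord1 (cutoff_eq1 n0 a0 xB) mul1r.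
rewrite /w0 (_ : colsub _ _ = 1%:M) ?det1 ?normr1 //.
by apply/matrixP => i j; rewrite !mxE ffunE.
Qed.

Let current_partial_theta a i phi A : 0 < a -> test_function phi ->
  current_partial i (current_of (theta a)) phi A =
  w0 A * \int[mu]_x (partial i (cutoff a) x * phi x).
Proof.
move=> a0 [Cphi _]; have a20 : 0 < 2 * a by rewrite mulr_gt0.
have cp : continuous (partial i phi) by have [_ /(_ i)[_ h]] := Cphi 1%N.
rewrite /current_partial (@current_of_sum R n _ k (fun _ : 'I_1 => cutoff a) (fun=> w0) 1 (2 * a)) //; last first.
  by move=> _ x; exact: cutoff_supp.
rewrite big_ord1 -mulrN; congr (_ * _).
rewrite (@integration_by_parts_rV R n (cutoff a) phi (2 * a) i) ?opprK //.
- exact: Ck_cutoff.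
- by move=> x; exact: cutoff_supp.
- by move=> x; exact: partial_cutoff_supp.
Qed.

Let iota_dx_scale j (w w' : 'M[R]_(j, n) -> R) (b : R) i A : (forall A, w A = w' A * b) ->
  iota_dx i w A = iota_dx i w' A * b.
Proof. by case: j w w' A => [|j] w w' A h /=; [rewrite mul0r|exact: h]. Qed.

Lemma exponents_of_gaffney : (exists C : R, forall theta : 'rV[R]_n -> 'M[R]_(k, n) -> R,
     Lp_form p theta ->
     (form_Lnorm q theta <=
        C%:E * (current_Lnorm p (current_d (current_of theta)) +
                current_Lnorm p (current_delta (current_of theta))))%E) ->
  p^-1 - q^-1 = n%:R^-1.
Proof.
move=> [C hC]; have [M M0 hM] := partial_cutoff_bound R n.
pose W := coef_sum (fun i : 'I_n => dx_wedge i w0) + coef_sum (fun (i : 'I_n) A => - 1 * iota_dx i w0 A).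
have nR : 0 < n%:R :> R by rewrite ltr0n.
(* The inequality for [theta a]: the sides are constant multiples of
   [a ^ (n / q)] and [a ^ (n / p - 1)]. *)
have key a : 0 < a -> ((2 * (a / n%:R)) ^+ n) `^ q^-1 <= `|C| * (W * (M / a) * ((2 * (2 * a)) ^+ n) `^ p^-1).
  move=> a0; have a20 : 0 < 2 * a by rewrite mulr_gt0.
  have Ma0 : 0 <= M / a by rewrite divr_ge0 // ltW.
  have hb (i : 'I_n) x : `|partial i (cutoff a) x| <= M / a by exact: hM.
  have hs (i : 'I_n) x : partial i (cutoff a) x != 0 -> ball z0 (2 * a) x by exact: partial_cutoff_supp.
  have L1 : Lp_form p (eta1 a) by apply: (Lp_form_sum Ma0 a20 (mpcut a) hb hs aw1 p1).
  have L2 : Lp_form p (eta2 a) by apply: (Lp_form_sum Ma0 a20 (mpcut a) hb hs aw2 p1).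
  have N1 : (current_Lnorm p (current_d (current_of (theta a))) <= form_Lnorm p (eta1 a))%E.
    apply: ereal_inf_lbound; exists (eta1 a) => //; split=> // phi tphi A.
    have cphi : continuous phi by case: tphi => /(_ 0%N).
    rewrite (current_of_sum (fun i : 'I_n => dx_wedge i w0) Ma0 a20 (mpcut a) hb hs A cphi) /current_d.
    apply: eq_bigr => i _; rewrite /dx_wedge mulr_suml; apply: eq_bigr => j _.
    by rewrite current_partial_theta // mulrA.
  have N2 : (current_Lnorm p (current_delta (current_of (theta a))) <= form_Lnorm p (eta2 a))%E.
    apply: ereal_inf_lbound; exists (eta2 a) => //; split=> // phi tphi A.
    have cphi : continuous phi by case: tphi => /(_ 0%N).
    rewrite (current_of_sum (fun (i : 'I_n) A => - 1 * iota_dx i w0 A) Ma0 a20 (mpcut a) hb hs A cphi) /current_delta -sumrN.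
    apply: eq_bigr => i _; rewrite mulN1r mulNr; congr (- _).
    by apply: iota_dx_scale => A'; rewrite current_partial_theta.
  have B1 := form_Lnorm_sum_le Ma0 a20 (mpcut a) hb hs aw1 p1.
  have B2 := form_Lnorm_sum_le Ma0 a20 (mpcut a) hb hs aw2 p1.
  rewrite -lee_fin; apply: le_trans (theta_ge a0) _.
  apply: le_trans (hC _ (Lp_theta a0)) _.
  have X0 : (0 <= current_Lnorm p (current_d (current_of (theta a))) +
                current_Lnorm p (current_delta (current_of (theta a))))%E.
    by apply: adde_ge0; apply: le_ereal_inf_tmp => _ [eta _ <-]; exact: Lnorm_ge0.
  apply: (@le_trans _ _ (`|C|%:E * (current_Lnorm p (current_d (current_of (theta a))) +
                current_Lnorm p (current_delta (current_of (theta a)))))%E).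
    by apply: lee_wpmul2r => //; rewrite lee_fin ler_norm.
  rewrite EFinM; apply: lee_wpmul2l; first by rewrite lee_fin.
  have -> : W * (M / a) * ((2 * (2 * a)) ^+ n) `^ p^-1 =
    coef_sum (fun i : 'I_n => dx_wedge i w0) * (M / a) * ((2 * (2 * a)) ^+ n) `^ p^-1 +
    coef_sum (fun (i : 'I_n) A => - 1 * iota_dx i w0 A) * (M / a) * ((2 * (2 * a)) ^+ n) `^ p^-1.
    by rewrite /W; ring.
  by rewrite EFinD; apply: leeD; [exact: le_trans N1 B1|exact: le_trans N2 B2].
pose s := n%:R * q^-1 - n%:R * p^-1 + 1.
have s0 : s = 0.
  pose c1 := ((2 / n%:R) ^+ n) `^ q^-1.
  have c10 : 0 < c1 by rewrite powR_gt0 // exprn_gt0 // divr_gt0.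
  pose c2 := ((4 : R) ^+ n) `^ p^-1.
  apply: (@powR_unbounded s (c1^-1 * (`|C| * (W * M * c2)))) => a a0.
  have pw (t : R) : 0 < t -> (a ^+ n) `^ t^-1 = a `^ (n%:R * t^-1).
    by move=> t0; rewrite -powR_mulrn ?(ltW a0) // -powRrM.
  have := key a a0.
  have -> : 2 * (a / n%:R) = 2 / n%:R * a by rewrite mulrCA mulrC.
  have -> : 2 * (2 * a) = 4 * a by rewrite mulrA -natrM.
  have E1 : ((2 / n%:R * a) ^+ n) `^ q^-1 = c1 * a `^ (n%:R * q^-1).
    by rewrite exprMn powRM ?exprn_ge0 ?(ltW a0) ?divr_ge0 // pw.
  have E2 : ((4 * a) ^+ n) `^ p^-1 = c2 * a `^ (n%:R * p^-1).
    by rewrite exprMn powRM ?exprn_ge0 ?(ltW a0) // pw.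
  rewrite E1 E2 => h.
  rewrite /s powRD ?(gt_eqF a0) ?implybT // powRB ?(gt_eqF a0) ?implybT // powRr1 ?(ltW a0) //.
  rewrite ler_pdivlMl //.
  have := powR_gt0 (n%:R * p^-1) a0; move: h.
  move: (a `^ (n%:R * p^-1)) (a `^ (n%:R * q^-1)) => Y X h Y0.
  have aY0 : 0 <= a / Y by rewrite divr_ge0 // ltW.
  have -> : c1 * (X / Y * a) = c1 * X * (a / Y) by ring.
  apply: le_trans (ler_wpM2r aY0 h) _; apply: eq_leW; field.
  by rewrite !gt_eqF.
move: s0; rewrite /s => s0.
have : n%:R * (p^-1 - q^-1) = 1 by rewrite mulrBr; move: s0; lra.
by move=> h; rewrite -[LHS](mulKf (lt0r_neq0 nR)) h mulr1.
Qed.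
End necessity.

Theorem theorem8p2 (R : realType) (p q : R) (n k : nat) :
  1 < p -> 1 < q -> (1 <= n)%N -> (k <= n)%N ->
  (exists C : R, forall theta : 'rV[R]_n -> 'M[R]_(k, n) -> R,
     Lp_form p theta ->
     (form_Lnorm q theta <=
        C%:E * (current_Lnorm p (current_d (current_of theta)) +
                current_Lnorm p (current_delta (current_of theta))))%E)
  <-> p^-1 - q^-1 = n%:R^-1.
Proof.
move=> p1 q1 n1 kn; split; first exact: exponents_of_gaffney.
exact: gaffney.
Qed.
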